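(* Let $(c_l)_{l\in\mathbb{Z}}$ be complex numbers with $c_l\to 0$ as $|l|\to\infty$, and let $(n_k)_{k\ge 1}$ be a sequence of positive integers with $n_k\to\infty$ such that $$\lim_{k\to\infty}\sum_{l=-n_k}^{n_k}c_l e^{ilx}=0\qquad\text{for every }x\in[0,2\pi].$$ Let $K$ be the support of the distribution $\sum_{l\in\mathbb{Z}} c_l e^{ilx}$ on the circle $\mathbb{R}/2\pi\mathbb{Z}$, and assume that the upper Minkowski dimension of $K$ satisfies $$\dim_{\mathrm{Mink}}(K)<\tfrac12(\sqrt{17}-3).$$ Then $c_l=0$ for all $l\in\mathbb{Z}$.
   Context: The support of the distribution is its usual distributional support, a closed (hence compact) subset of the circle. The upper Minkowski (box counting) dimension of a compact set $K$ is $\dim_{\mathrm{Mink}}(K)=\limsup_{\delta\to 0^+}\frac{\log N(K,\delta)}{\log(1/\delta)}$, where $N(K,\delta)$ is the minimal number of intervals of length $\delta$ needed to cover $K$ (for $K=\emptyset$ the dimension is taken to be $-\infty$ or $0$, so the hypothesis holds). *)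

(* Defs.v *)
From Stdlib Require Import Reals ZArith.
From Coquelicot Require Import Coquelicot.

Open Scope R_scope.

(* Points, subsets and functions of the circle R/2piZ are represented by real
   numbers and by 2pi-periodic subsets and functions of R. *)

Definition periodic_set (U : R -> Prop) : Prop :=
  forall x : R, U (x + 2 * PI) <-> U x.

Definition periodic_fun (f : R -> C) : Prop :=
  forall x : R, f (x + 2 * PI) = f x.

Definition Cexpi (t : R) : C := (cos t, sin t).

(* The sum of the a_l over -N <= l <= N, reindexed by l = j - N. *)
Definition symmetric_sum (a : Z -> C) (N : nat) : C :=
  sum_n (fun j : nat => a (Z.of_nat j - Z.of_nat N)%Z) (2 * N).

Definition trig_partial_sum (c : Z -> C) (N : nat) (x : R) : C :=
  symmetric_sum (fun l : Z => (c l * Cexpi (IZR l * x))%C) N.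

Definition vanishes_at_infinity (c : Z -> C) : Prop :=
  forall eps : posreal, exists L : Z,
    forall l : Z, (L <= Z.abs l)%Z -> Cmod (c l) < eps.

Definition smooth (f : R -> R) : Prop :=
  forall (m : nat) (x : R), ex_derive_n f m x.

Definition test_function (phi : R -> C) : Prop :=
  periodic_fun phi /\
  smooth (fun x => Re (phi x)) /\ smooth (fun x => Im (phi x)).

Definition fun_support (phi : R -> C) (x : R) : Prop :=
  forall eps : posreal, exists y : R, ball x eps y /\ phi y <> RtoC 0.

(* The value z at phi of the distribution sum_l c_l e^{ilx}.  For bounded c the
   series converges absolutely, because the integrals decay rapidly in l, so
   summing it symmetrically involves no choice. *)
Definition is_distr_pairing (c : Z -> C) (phi : R -> C) (z : C) : Prop :=
  filterlim
    (symmetric_sum (fun l : Z =>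
       (c l * RInt (V := C_R_CompleteNormedModule)
                (fun x => (Cexpi (IZR l * x) * phi x)%C) 0 (2 * PI))%C))
    eventually (locally z).

Definition distr_vanishes_on (c : Z -> C) (U : R -> Prop) : Prop :=
  forall phi : R -> C, test_function phi ->
    (forall x : R, fun_support phi x -> U x) ->
    is_distr_pairing c phi (RtoC 0).

(* The complement of the union of the open subsets of the circle on which the
   distribution vanishes. *)
Definition distr_support (c : Z -> C) (x : R) : Prop :=
  ~ exists U : R -> Prop,
      open U /\ periodic_set U /\ distr_vanishes_on c U /\ U x.

(* K, a subset of the circle, is covered by the m arcs [a i, a i + delta]. *)
Definition covered_by (K : R -> Prop) (delta : R) (m : nat) : Prop :=
  exists a : nat -> R, forall x : R, K x ->
    exists (i : nat) (k : Z), (i < m)%nat /\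
      a i <= x + 2 * PI * IZR k <= a i + delta.

(* The infimum of a nonempty set of natural numbers, hence its minimum. *)
Definition covering_number (K : R -> Prop) (delta : R) : R :=
  real (Glb_Rbar (fun r => exists m : nat, r = INR m /\ covered_by K delta m)).

(* limsup of f at 0+, as the infimum in Rbar of its eventual upper bounds. *)
Definition LimSup_right0 (f : R -> R) : Rbar :=
  Glb_Rbar (fun y => at_right 0 (fun d => f d <= y)).

(* For empty K this is 0, since ln 0 = 0. *)
Definition upper_Minkowski_dim (K : R -> Prop) : Rbar :=
  LimSup_right0 (fun d => ln (covering_number K d) / ln (1 / d)).

(* Main.v *)
(** Write [T] for the distribution, [K] for its support and [S_n] for its symmetric
    partial sums.  By Baire's theorem the [S_{n_k}] are uniformly bounded on a
    nonempty relatively open part of [K]; multiplying [T] by a smooth bump there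
    changes partial sums only by a bounded amount (Rajchman), so one may assume that
    they are bounded on all of [K].  Let [a] be the coefficients of the localized
    distribution and [E_n] the sum of the [|a_m|^2] over [|m| <= n].  Mollifying at
    scale [d] gives a function [u] supported in the [4d]-neighbourhood of [K], which
    is covered by [N ~ d^{-y}] arcs of length [~ d].
    - Pairing [u] with the [n]-th partial sum, which is [O(1)] near [K] up to an error
      controlled in [L^2] by its derivative, gives [E_n^2 <= C (N + d n^2 E_n)], and
      [d ~ E_n / n^2] yields [E_n^{2+y} <= C n^{2y}] along [n = n_k].
    - Pairing [u] with one character whose coefficient is nonzero gives
      [1 <= C N d E_n] for [d = n^{-1+eps}], that is [E_n >= c n^{(1-eps)(1-y)}].
    The two are compatible only if [(2 + y) (1 - y) <= 2 y], that is
    [y >= (sqrt 17 - 3) / 2]. *)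

Require Import Defs.
From Stdlib Require Import Reals ZArith.
From Stdlib Require Import Lra Lia Classical ClassicalEpsilon FunctionalExtensionality.
From Coquelicot Require Import Coquelicot.

Open Scope R_scope.

(** * Symmetric sums *)

(** Both energy bounds are Cauchy-Schwarz for [u], which lives on a set of measure [O(N d)]; they
    differ in how its [L^2] norm is estimated. The coefficients of [u] are [b_m a_m], with
    [|b_m| <= 2 d], and with [b_m] of exact order [d] as long as [|m| d <= 1/4]. For the upper
    bound, boundedness of [a] gives [||u||^2 = O(d)]. The partial sums are bounded on [K] only, not
    near it; this costs the derivative term, and [(d E_n)^2 <= C d (N d + d^2 n^2 E_n)]. For the
    lower bound, [n] lies so far beyond [1/d] that the decay of [b_m] makes frequencies above [n]
    harmless: [||u||^2 = O(d^2 (E_n + 1))], and pairing with a character gives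
    [d^2 <= C d^2 E_n N d]. Many integrations by parts make the loss [eps] as small as desired. No
    convolution or infinite series is formed: [u] occurs through truncations of order [M] with error
    [O(1/(M+1))], and Cauchy-Schwarz in AM-GM form with a free parameter. Distances on the circle
    enter through the periodic function [|sin (x/2)|]. *)

Lemma symmetric_sum_0 (a : Z -> C) : symmetric_sum a 0 = a 0%Z.
Proof. unfold symmetric_sum; simpl; now rewrite sum_O. Qed.

Lemma symmetric_sum_S (a : Z -> C) (N : nat) :
  symmetric_sum a (S N) =
  (symmetric_sum a N + a (Z.of_nat N + 1)%Z + a (- (Z.of_nat N + 1))%Z)%C.
Proof.
unfold symmetric_sum.
replace (2 * S N)%nat with (S (S (2 * N))) by lia.
rewrite sum_Sn.
unfold sum_n; rewrite sum_Sn_m, <- sum_n_m_S by lia.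
rewrite (sum_n_m_ext _ (fun j : nat => a (Z.of_nat j - Z.of_nat N)%Z)).
2:{ intros j; f_equal; lia. }
change plus with Cplus.
replace (Z.of_nat (S (S (2 * N))) - Z.of_nat (S N))%Z with (Z.of_nat N + 1)%Z by lia.
replace (Z.of_nat 0 - Z.of_nat (S N))%Z with (- (Z.of_nat N + 1))%Z by lia.
ring.
Qed.

Fixpoint real_symmetric_sum (a : Z -> R) (N : nat) : R :=
  match N with
  | O => a 0%Z
  | S N' => real_symmetric_sum a N' + a (Z.of_nat N' + 1)%Z + a (- (Z.of_nat N' + 1))%Z
  end.

Lemma symmetric_sum_ext (a b : Z -> C) (N : nat) :
  (forall l, (Z.abs l <= Z.of_nat N)%Z -> a l = b l) ->
  symmetric_sum a N = symmetric_sum b N.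
Proof.
induction N as [|N IH]; intros H.
- rewrite !symmetric_sum_0; apply H; lia.
- rewrite !symmetric_sum_S, IH, !H by (try intros; try apply H; lia); reflexivity.
Qed.

Lemma symmetric_sum_plus (a b : Z -> C) (N : nat) :
  symmetric_sum (fun l => (a l + b l)%C) N = (symmetric_sum a N + symmetric_sum b N)%C.
Proof.
induction N as [|N IH]; [now rewrite !symmetric_sum_0|].
rewrite !symmetric_sum_S, IH; ring.
Qed.

Lemma symmetric_sum_mult_l (z : C) (a : Z -> C) (N : nat) :
  symmetric_sum (fun l => (z * a l)%C) N = (z * symmetric_sum a N)%C.
Proof.
induction N as [|N IH]; [now rewrite !symmetric_sum_0|].
rewrite !symmetric_sum_S, IH; ring.
Qed.

Lemma symmetric_sum_minus (a b : Z -> C) (N : nat) :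
  symmetric_sum (fun l => (a l - b l)%C) N = (symmetric_sum a N - symmetric_sum b N)%C.
Proof.
induction N as [|N IH]; [now rewrite !symmetric_sum_0|].
rewrite !symmetric_sum_S, IH; ring.
Qed.

Lemma symmetric_sum_eq0 (a : Z -> C) (N : nat) :
  (forall l, (Z.abs l <= Z.of_nat N)%Z -> a l = RtoC 0) -> symmetric_sum a N = RtoC 0.
Proof.
induction N as [|N IH]; intros H.
- rewrite symmetric_sum_0; apply H; lia.
- rewrite symmetric_sum_S, IH, !H by (try intros; try apply H; lia); ring.
Qed.

Lemma symmetric_sum_swap (f : Z -> Z -> C) (M N : nat) :
  symmetric_sum (fun l => symmetric_sum (f l) M) N =
  symmetric_sum (fun m => symmetric_sum (fun l => f l m) N) M.
Proof.
induction N as [|N IH].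
- rewrite symmetric_sum_0; apply symmetric_sum_ext; intros; now rewrite symmetric_sum_0.
- rewrite symmetric_sum_S, IH, <- !symmetric_sum_plus.
  apply symmetric_sum_ext; intros; now rewrite symmetric_sum_S.
Qed.

Lemma symmetric_sum_opp_index (a : Z -> C) (N : nat) :
  symmetric_sum (fun l => a (- l)%Z) N = symmetric_sum a N.
Proof.
induction N as [|N IH]; [now rewrite !symmetric_sum_0|].
rewrite !symmetric_sum_S, IH, Z.opp_involutive; ring.
Qed.

Lemma symmetric_sum_single (a : Z -> C) (k : Z) (N : nat) :
  (forall l, l <> k -> a l = RtoC 0) -> (Z.abs k <= Z.of_nat N)%Z ->
  symmetric_sum a N = a k.
Proof.
intros H; induction N as [|N IH]; intros Hk.
- rewrite symmetric_sum_0; f_equal; lia.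
- rewrite symmetric_sum_S.
  destruct (Z_le_gt_dec (Z.abs k) (Z.of_nat N)) as [h|h].
  + rewrite IH, (H (Z.of_nat N + 1)%Z), (H (- (Z.of_nat N + 1))%Z) by lia; ring.
  + rewrite symmetric_sum_eq0 by (intros; apply H; lia).
    destruct (Z.eq_dec k (Z.of_nat N + 1)) as [->|h'].
    * rewrite (H (- _)%Z) by lia; ring.
    * rewrite (H (Z.of_nat N + 1)%Z) by lia.
      replace (- (Z.of_nat N + 1))%Z with k by lia; ring.
Qed.

Lemma symmetric_sum_conj (a : Z -> C) (N : nat) :
  Cconj (symmetric_sum a N) = symmetric_sum (fun l => Cconj (a l)) N.
Proof.
induction N as [|N IH]; [now rewrite !symmetric_sum_0|].
now rewrite !symmetric_sum_S, !Cplus_conj, IH.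
Qed.

Lemma symmetric_sum_Re (a : Z -> C) (N : nat) :
  Re (symmetric_sum a N) = real_symmetric_sum (fun l => Re (a l)) N.
Proof.
induction N as [|N IH]; [now rewrite !symmetric_sum_0|].
now rewrite !symmetric_sum_S; simpl; rewrite <- IH.
Qed.

Lemma symmetric_sum_RtoC (a : Z -> R) (N : nat) :
  symmetric_sum (fun l => RtoC (a l)) N = RtoC (real_symmetric_sum a N).
Proof.
induction N as [|N IH]; [now rewrite !symmetric_sum_0|].
rewrite !symmetric_sum_S, IH; simpl; now rewrite !RtoC_plus.
Qed.

Lemma Cmod_symmetric_sum (a : Z -> C) (N : nat) :
  Cmod (symmetric_sum a N) <= real_symmetric_sum (fun l => Cmod (a l)) N.
Proof.
induction N as [|N IH]; [rewrite !symmetric_sum_0; apply Rle_refl|].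
rewrite !symmetric_sum_S; simpl.
eapply Rle_trans; [apply Cmod_triangle|].
apply Rplus_le_compat_r.
eapply Rle_trans; [apply Cmod_triangle|lra].
Qed.

Lemma real_symmetric_sum_le (a b : Z -> R) (N : nat) :
  (forall l, (Z.abs l <= Z.of_nat N)%Z -> a l <= b l) ->
  real_symmetric_sum a N <= real_symmetric_sum b N.
Proof.
induction N as [|N IH]; intros H; simpl.
- apply H; lia.
- apply Rplus_le_compat; [apply Rplus_le_compat|]; try apply H; try lia.
  apply IH; intros; apply H; lia.
Qed.

Lemma real_symmetric_sum_plus (a b : Z -> R) (N : nat) :
  real_symmetric_sum (fun l => a l + b l) N = real_symmetric_sum a N + real_symmetric_sum b N.
Proof. induction N as [|N IH]; simpl; [|rewrite IH]; ring. Qed.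

Lemma real_symmetric_sum_scal (z : R) (a : Z -> R) (N : nat) :
  real_symmetric_sum (fun l => z * a l) N = z * real_symmetric_sum a N.
Proof. induction N as [|N IH]; simpl; [|rewrite IH]; ring. Qed.

Lemma real_symmetric_sum_nonneg (a : Z -> R) (N : nat) :
  (forall l, 0 <= a l) -> 0 <= real_symmetric_sum a N.
Proof.
intros H; induction N as [|N IH]; simpl; [apply H|].
pose proof (H (Z.of_nat N + 1)%Z); pose proof (H (- (Z.of_nat N + 1))%Z); lra.
Qed.

Lemma real_symmetric_sum_mono (a : Z -> R) (N M : nat) :
  (forall l, 0 <= a l) -> (N <= M)%nat ->
  real_symmetric_sum a N <= real_symmetric_sum a M.
Proof.
intros H; induction 1 as [|M _ IH]; simpl; [lra|].
pose proof (H (Z.of_nat M + 1)%Z); pose proof (H (- (Z.of_nat M + 1))%Z); lra.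
Qed.

Lemma real_symmetric_sum_ge_term (a : Z -> R) (k : Z) (N : nat) :
  (forall l, 0 <= a l) -> (Z.abs k <= Z.of_nat N)%Z -> a k <= real_symmetric_sum a N.
Proof.
intros H; induction N as [|N IH]; intros Hk; simpl.
- replace k with 0%Z by lia; lra.
- pose proof (H (Z.of_nat N + 1)%Z); pose proof (H (- (Z.of_nat N + 1))%Z).
  destruct (Z_le_gt_dec (Z.abs k) (Z.of_nat N)) as [h|h]; [specialize (IH h); lra|].
  pose proof (real_symmetric_sum_nonneg a N H).
  destruct (Z.eq_dec k (Z.of_nat N + 1)) as [->|h']; [lra|].
  replace k with (- (Z.of_nat N + 1))%Z by lia; lra.
Qed.

Lemma real_symmetric_sum_const (A : R) (N : nat) :
  real_symmetric_sum (fun _ => A) N = (2 * INR N + 1) * A.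
Proof. induction N as [|N IH]; [simpl; ring|]. rewrite S_INR; simpl; rewrite IH; ring. Qed.

(* Comparison with the telescoping sum of [1 / (l (l + 1))]. *)
Lemma real_symmetric_sum_tail (a : Z -> R) (A : R) (N M : nat) :
  (forall l, a l <= A / (1 + IZR l ^ 2)) -> 0 <= A -> (N <= M)%nat ->
  real_symmetric_sum a M <= real_symmetric_sum a N + 4 * A * (/ (INR N + 1) - / (INR M + 1)).
Proof.
intros H HA; induction 1 as [|M _ IH]; [lra|].
change (real_symmetric_sum a (S M)) with
  (real_symmetric_sum a M + a (Z.of_nat M + 1)%Z + a (- (Z.of_nat M + 1))%Z).
pose proof (H (Z.of_nat M + 1)%Z) as h1.
pose proof (H (- (Z.of_nat M + 1))%Z) as h2.
rewrite opp_IZR in h2.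
rewrite plus_IZR, <- INR_IZR_INZ in h1, h2.
replace ((- (INR M + 1)) ^ 2) with ((INR M + 1) ^ 2) in h2 by ring.
rewrite S_INR.
pose proof (pos_INR M) as hM.
assert (h3 : A / (1 + (INR M + 1) ^ 2) <= 2 * A * (/ (INR M + 1) - / (INR M + 1 + 1))).
{ unfold Rdiv; rewrite (Rmult_comm 2 A), Rmult_assoc.
  apply Rmult_le_compat_l; [exact HA|].
  replace (2 * (/ (INR M + 1) - / (INR M + 1 + 1)))
    with (/ ((INR M + 1) * (INR M + 2) / 2)) by (field; lra).
  apply Rinv_le_contravar; nra. }
lra.
Qed.

Lemma real_symmetric_sum_tail_le (a : Z -> R) (A : R) (N M : nat) :
  (forall l, a l <= A / (1 + IZR l ^ 2)) -> 0 <= A -> (N <= M)%nat ->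
  real_symmetric_sum a M <= real_symmetric_sum a N + 4 * A / (INR N + 1).
Proof.
intros H HA HNM.
pose proof (real_symmetric_sum_tail a A N M H HA HNM).
pose proof (pos_INR M) as hM.
assert (0 < / (INR M + 1)) by (apply Rinv_0_lt_compat; lra).
unfold Rdiv; nra.
Qed.

Lemma real_symmetric_sum_bound (a : Z -> R) (A : R) (N : nat) :
  (forall l, a l <= A / (1 + IZR l ^ 2)) -> 0 <= A ->
  real_symmetric_sum a N <= 5 * A.
Proof.
intros H HA.
pose proof (real_symmetric_sum_tail_le a A 0 N H HA (Nat.le_0_l N)) as h.
pose proof (H 0%Z) as h0.
simpl in h, h0.
replace (A / (1 + 0 * (0 * 1))) with A in h0 by (field; lra).
replace (4 * A / (0 + 1)) with (4 * A) in h by (field; lra).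
lra.
Qed.

Lemma Cmod_symmetric_sum_tail (a : Z -> C) (A : R) (N M : nat) :
  (forall l, Cmod (a l) <= A / (1 + IZR l ^ 2)) -> 0 <= A -> (N <= M)%nat ->
  Cmod (symmetric_sum a M - symmetric_sum a N) <= 4 * A / (INR N + 1).
Proof.
intros H HA HNM.
apply Rle_trans with (real_symmetric_sum (fun l => Cmod (a l)) M
   - real_symmetric_sum (fun l => Cmod (a l)) N).
- clear H HA; induction HNM as [|M _ IH].
  + unfold Cminus; rewrite Cplus_opp_r, Cmod_0; lra.
  + rewrite symmetric_sum_S; simpl.
    replace (_ - _)%C with ((symmetric_sum a M - symmetric_sum a N)
      + (a (Z.of_nat M + 1)%Z + a (- (Z.of_nat M + 1))%Z))%C by ring.
    eapply Rle_trans; [apply Cmod_triangle|].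
    pose proof (Cmod_triangle (a (Z.of_nat M + 1)%Z) (a (- (Z.of_nat M + 1))%Z)).
    lra.
- pose proof (real_symmetric_sum_tail_le _ A N M H HA HNM); lra.
Qed.

Lemma symmetric_sum_shift1 (a : Z -> C) (N : nat) :
  symmetric_sum (fun l => a (l + 1)%Z) N =
  (symmetric_sum a N + a (Z.of_nat N + 1)%Z - a (- Z.of_nat N)%Z)%C.
Proof.
induction N as [|N IH].
- rewrite !symmetric_sum_0; simpl; ring.
- rewrite !symmetric_sum_S, IH.
  replace (- (Z.of_nat N + 1) + 1)%Z with (- Z.of_nat N)%Z by lia.
  replace (Z.of_nat (S N)) with (Z.of_nat N + 1)%Z by lia.
  ring.
Qed.

(** Each unit shift trades one end term for another, so the error is linear in the shift and
    independent of [N]. This independence is what makes the error of the formal multiplication in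
    [localized_partial_sum_close] bounded. *)
Lemma symmetric_sum_shift_nat (a : Z -> C) (B : R) (N m : nat) :
  (forall l, Cmod (a l) <= B) ->
  Cmod (symmetric_sum (fun l => a (l + Z.of_nat m)%Z) N - symmetric_sum a N)
    <= 2 * INR m * B.
Proof.
intros H; induction m as [|m IH].
- rewrite (symmetric_sum_ext _ a) by (intros; f_equal; lia).
  unfold Cminus; rewrite Cplus_opp_r, Cmod_0; simpl; lra.
- rewrite S_INR.
  rewrite (symmetric_sum_ext _ (fun l => a (l + 1 + Z.of_nat m)%Z)) by (intros; f_equal; lia).
  pose proof (symmetric_sum_shift1 (fun k => a (k + Z.of_nat m)%Z) N) as h1.
  cbv beta in h1; rewrite h1.
  set (s := symmetric_sum _ N) in *.
  replace (_ - _)%C with ((s - symmetric_sum a N)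
    + (a (Z.of_nat N + 1 + Z.of_nat m)%Z + - a (- Z.of_nat N + Z.of_nat m)%Z))%C by ring.
  eapply Rle_trans; [apply Cmod_triangle|].
  pose proof (Cmod_triangle (a (Z.of_nat N + 1 + Z.of_nat m)%Z)
    (- a (- Z.of_nat N + Z.of_nat m)%Z)) as h.
  rewrite Cmod_opp in h.
  pose proof (H (Z.of_nat N + 1 + Z.of_nat m)%Z).
  pose proof (H (- Z.of_nat N + Z.of_nat m)%Z).
  lra.
Qed.

Lemma symmetric_sum_shift (a : Z -> C) (B : R) (N : nat) (m : Z) :
  (forall l, Cmod (a l) <= B) ->
  Cmod (symmetric_sum (fun l => a (l + m)%Z) N - symmetric_sum a N)
    <= 2 * Rabs (IZR m) * B.
Proof.
intros H.
rewrite <- abs_IZR.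
destruct (Z_le_gt_dec 0 m) as [h|h].
- replace m with (Z.of_nat (Z.to_nat m)) by lia.
  rewrite Z.abs_eq, <- INR_IZR_INZ by lia.
  now apply symmetric_sum_shift_nat.
- replace (Z.abs m) with (Z.of_nat (Z.to_nat (- m))) by lia.
  rewrite <- INR_IZR_INZ.
  rewrite <- (symmetric_sum_opp_index (fun l => a (l + m)%Z)), <- (symmetric_sum_opp_index a).
  rewrite (symmetric_sum_ext _ (fun l => (fun k => a (- k)%Z) (l + Z.of_nat (Z.to_nat (- m)))%Z))
    by (intros; f_equal; lia).
  now apply (symmetric_sum_shift_nat (fun k => a (- k)%Z)).
Qed.

(** * Limits of complex sequences *)

Lemma filterlim_C_eps (u : nat -> C) (z : C) :
  filterlim u eventually (locally z) <->
  forall eps : R, 0 < eps -> exists N, forall n, (N <= n)%nat -> Cmod (u n - z) < eps.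
Proof.
split.
- intros H eps He.
  (* Balls of [C] are squares: a ball of radius [r] only gives modulus below [sqrt 2 * r], and
     [sqrt 2 <= 2]. *)
  assert (He' : 0 < eps / 2) by lra.
  apply (proj1 (filterlim_locally (U := C_UniformSpace) u z)) with (eps := mkposreal _ He') in H.
  destruct H as [N HN]; exists N; intros n Hn.
  eapply Rlt_le_trans; [apply (C_NormedModule_mixin_compat2 z (u n) (mkposreal _ He')), (HN n Hn)|].
  simpl.
  assert (sqrt 2 <= 2) by (rewrite <- (sqrt_square 2) at 2 by lra; apply sqrt_le_1_alt; lra).
  nra.
- intros H; apply (filterlim_locally (U := C_UniformSpace) u z); intros eps.
  destruct (H eps (cond_pos eps)) as [N HN]; exists N; intros n Hn.
  apply C_NormedModule_mixin_compat1, (HN n Hn).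
Qed.

Lemma C_lim_unique (u : nat -> C) (y z : C) :
  filterlim u eventually (locally y) -> filterlim u eventually (locally z) -> y = z.
Proof. apply (filterlim_locally_unique (V := C_NormedModule)). Qed.

Lemma Cmod_le_of_lim (u : nat -> C) (z w : C) (A : R) (N : nat) :
  filterlim u eventually (locally z) ->
  (forall n, (N <= n)%nat -> Cmod (u n - w) <= A) -> Cmod (z - w) <= A.
Proof.
intros H HA; apply le_epsilon; intros eps He.
destruct (proj1 (filterlim_C_eps u z) H eps He) as [N' HN'].
specialize (HN' (N + N')%nat ltac:(lia)); specialize (HA (N + N')%nat ltac:(lia)).
replace (z - w)%C with ((u (N + N')%nat - w) + - (u (N + N')%nat - z))%C by ring.
eapply Rle_trans; [apply Cmod_triangle|]; rewrite Cmod_opp; lra.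
Qed.

Lemma Rdiv_lt_swap (a b e : R) : 0 < b -> 0 < e -> a / e < b -> a / b < e.
Proof.
intros Hb He H; apply Rlt_div_l in H; [|exact He]; apply Rlt_div_l; [exact Hb|lra].
Qed.

Lemma C_lim_of_rate (u : nat -> C) (z : C) (A : R) :
  (forall n, Cmod (u n - z) <= A / (INR n + 1)) -> filterlim u eventually (locally z).
Proof.
intros H; apply filterlim_C_eps; intros eps He.
destruct (nfloor_ex (Rabs A / eps)) as [N [_ HN]].
{ apply Rle_mult_inv_pos; [apply Rabs_pos|exact He]. }
exists N; intros n Hn.
eapply Rle_lt_trans; [apply H|].
pose proof (le_INR _ _ Hn); pose proof (pos_INR N).
apply Rle_lt_trans with (Rabs A / (INR n + 1)).
{ apply Rmult_le_compat_r; [apply Rlt_le, Rinv_0_lt_compat; lra|apply Rle_abs]. }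
apply Rdiv_lt_swap; lra.
Qed.

Lemma symmetric_sum_converges (a : Z -> C) (A : R) :
  (forall l, Cmod (a l) <= A / (1 + IZR l ^ 2)) -> 0 <= A ->
  exists z, filterlim (symmetric_sum a) eventually (locally z).
Proof.
intros H HA.
apply (filterlim_locally_cauchy (U := C_R_CompleteNormedModule) (F := eventually)).
intros eps.
destruct (nfloor_ex (4 * A / eps)) as [N [_ HN]].
{ apply Rle_mult_inv_pos; [lra|apply cond_pos]. }
exists (fun n => (N <= n)%nat); split; [exists N; now intros|].
assert (key : forall n m, (N <= n)%nat -> (n <= m)%nat ->
  Cmod (symmetric_sum a m - symmetric_sum a n) < eps).
{ intros n m Hn Hm.
  eapply Rle_lt_trans; [apply (Cmod_symmetric_sum_tail a A n m H HA Hm)|].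
  pose proof (le_INR _ _ Hn); pose proof (pos_INR N); pose proof (cond_pos eps).
  apply Rdiv_lt_swap; lra. }
intros n m Hn Hm.
apply C_NormedModule_mixin_compat1.
destruct (Nat.le_ge_cases n m) as [h|h].
- now apply key.
- change (Cmod (symmetric_sum a m - symmetric_sum a n) < eps).
  replace (symmetric_sum a m - symmetric_sum a n)%C
    with (- (symmetric_sum a n - symmetric_sum a m))%C by ring.
  rewrite Cmod_opp; now apply key.
Qed.

(** * Integration over a period *)

Definition cont (f : R -> R) : Prop := forall x, continuous f x.

Lemma cont_const (a : R) : cont (fun _ => a).
Proof. intro x; apply continuous_const. Qed.

Lemma cont_id : cont (fun x => x).
Proof. intro x; apply continuous_id. Qed.

Lemma cont_plus f g : cont f -> cont g -> cont (fun x => f x + g x).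
Proof. intros Hf Hg x; apply (continuous_plus (V := R_NormedModule) f g x (Hf x) (Hg x)). Qed.

Lemma cont_opp f : cont f -> cont (fun x => - f x).
Proof. intros Hf x; apply (continuous_opp (V := R_NormedModule) f x (Hf x)). Qed.

Lemma cont_minus f g : cont f -> cont g -> cont (fun x => f x - g x).
Proof. intros Hf Hg; apply cont_plus; [exact Hf|now apply cont_opp]. Qed.

Lemma cont_mult f g : cont f -> cont g -> cont (fun x => f x * g x).
Proof. intros Hf Hg x; apply (continuous_mult (K := R_AbsRing) f g x (Hf x) (Hg x)). Qed.

Lemma cont_scal a f : cont f -> cont (fun x => a * f x).
Proof. intros Hf; apply cont_mult; [apply cont_const|exact Hf]. Qed.

Lemma cont_pow f n : cont f -> cont (fun x => f x ^ n).
Proof.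
intros Hf; induction n as [|n IH]; simpl; [apply cont_const|now apply cont_mult].
Qed.

Lemma cont_comp f g : cont f -> cont g -> cont (fun x => g (f x)).
Proof. intros Hf Hg x; apply continuous_comp; [apply Hf|apply Hg]. Qed.

Lemma cont_sin f : cont f -> cont (fun x => sin (f x)).
Proof.
intros Hf; apply cont_comp; [exact Hf|].
intro x; apply continuity_pt_filterlim, continuity_sin.
Qed.

Lemma cont_cos f : cont f -> cont (fun x => cos (f x)).
Proof.
intros Hf; apply cont_comp; [exact Hf|].
intro x; apply continuity_pt_filterlim, continuity_cos.
Qed.

Lemma cont_sqrt f : cont f -> cont (fun x => sqrt (f x)).
Proof.
intros Hf; apply cont_comp; [exact Hf|].
intro x; apply continuous_sqrt.
Qed.

Lemma cont_is_derive f f' : (forall x, is_derive f x (f' x)) -> cont f.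
Proof.
intros H x; apply (ex_derive_continuous (V := R_NormedModule)); eexists; apply H.
Qed.

Create HintDb cont.
#[export] Hint Resolve cont_const cont_id cont_plus cont_opp cont_minus cont_mult cont_pow
  cont_sin cont_cos cont_sqrt : cont.

Lemma ex_RInt_cont f a b : cont f -> ex_RInt f a b.
Proof. intros H; apply (ex_RInt_continuous (V := R_CompleteNormedModule)); intros; apply H. Qed.

Lemma RInt_plus_cont f g a b :
  cont f -> cont g -> RInt (fun x => f x + g x) a b = RInt f a b + RInt g a b.
Proof.
intros Hf Hg; apply (RInt_plus (V := R_CompleteNormedModule)); now apply ex_RInt_cont.
Qed.

Lemma RInt_scal_cont f k a b :
  cont f -> RInt (fun x => k * f x) a b = k * RInt f a b.
Proof.
intros Hf; apply (RInt_scal (V := R_CompleteNormedModule)); now apply ex_RInt_cont.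
Qed.

Lemma RInt_minus_cont f g a b :
  cont f -> cont g -> RInt (fun x => f x - g x) a b = RInt f a b - RInt g a b.
Proof.
intros Hf Hg; apply (RInt_minus (V := R_CompleteNormedModule)); now apply ex_RInt_cont.
Qed.

Lemma RInt_le_cont f g a b :
  a <= b -> cont f -> cont g -> (forall x, a <= x <= b -> f x <= g x) ->
  RInt f a b <= RInt g a b.
Proof.
intros Hab Hf Hg H; apply RInt_le; try now apply ex_RInt_cont.
- exact Hab.
- intros x Hx; apply H; lra.
Qed.

Lemma RInt_nonneg_cont f a b :
  a <= b -> cont f -> (forall x, a <= x <= b -> 0 <= f x) -> 0 <= RInt f a b.
Proof.
intros Hab Hf H; apply RInt_ge_0; [exact Hab|now apply ex_RInt_cont|].
intros x Hx; apply H; lra.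
Qed.

Lemma RInt_Chasles_cont f a b c :
  cont f -> RInt f a b + RInt f b c = RInt f a c.
Proof.
intros Hf; apply (RInt_Chasles (V := R_CompleteNormedModule)); now apply ex_RInt_cont.
Qed.

Lemma RInt_const_R (k a b : R) : RInt (fun _ => k) a b = (b - a) * k.
Proof. apply (RInt_const (V := R_CompleteNormedModule)). Qed.

Lemma RInt_derive_cont f f' a b :
  (forall x, is_derive f x (f' x)) -> cont f' -> RInt f' a b = f b - f a.
Proof.
intros Hf Hf'; apply is_RInt_unique.
apply (is_RInt_derive (V := R_CompleteNormedModule)); intros; [apply Hf|apply Hf'].
Qed.

Lemma RInt_shift f a b v : cont f -> RInt (fun x => f (x + v)) a b = RInt f (a + v) (b + v).
Proof.
intros Hf.
pose proof (RInt_comp_lin (V := R_CompleteNormedModule) f 1 v a b) as H.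
rewrite !Rmult_1_l in H; rewrite <- H by now apply ex_RInt_cont.
apply RInt_ext; intros x _; change scal with Rmult; simpl; now rewrite !Rmult_1_l.
Qed.

Definition real_periodic (f : R -> R) : Prop := forall x, f (x + 2 * PI) = f x.

Lemma RInt_period_start f v :
  cont f -> real_periodic f -> RInt f v (v + 2 * PI) = RInt f 0 (2 * PI).
Proof.
intros Hf Hp.
rewrite <- (RInt_Chasles_cont f v 0 (v + 2 * PI)), <- (RInt_Chasles_cont f 0 (2 * PI) (v + 2 * PI))
  by exact Hf.
replace (RInt f (2 * PI) (v + 2 * PI)) with (RInt f 0 v).
- rewrite <- (RInt_Chasles_cont f 0 0 v), <- (RInt_Chasles_cont f 0 v 0) by exact Hf.
  pose proof (RInt_Chasles_cont f 0 v 0 Hf) as h.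
  pose proof (RInt_Chasles_cont f 0 0 0 Hf) as h0.
  lra.
- transitivity (RInt (fun x => f (x + 2 * PI)) 0 v).
  + apply RInt_ext; intros x _; symmetry; apply Hp.
  + rewrite RInt_shift by exact Hf; f_equal; ring.
Qed.

Lemma RInt_period_shift f v :
  cont f -> real_periodic f -> RInt (fun x => f (x + v)) 0 (2 * PI) = RInt f 0 (2 * PI).
Proof.
intros Hf Hp; rewrite RInt_shift by exact Hf.
rewrite Rplus_0_l, (Rplus_comm (2 * PI)); now apply RInt_period_start.
Qed.

Lemma two_PI_pos : 0 < 2 * PI.
Proof. pose proof PI_RGT_0; lra. Qed.

(* From [0 <= int (h - mean)^2]. *)
Lemma RInt_square_le h a b :
  a <= b -> cont h -> RInt h a b ^ 2 <= (b - a) * RInt (fun x => h x ^ 2) a b.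
Proof.
intros Hab Hh.
destruct (Rle_lt_or_eq_dec a b Hab) as [Hlt| <-].
2:{ pose proof (RInt_Chasles_cont h a a a Hh); nra. }
set (m := RInt h a b / (b - a)).
assert (H : 0 <= RInt (fun x => (h x - m) ^ 2) a b).
{ apply RInt_nonneg_cont; auto with cont; intros; apply pow2_ge_0. }
rewrite (RInt_ext _ (fun x => (h x ^ 2 - (2 * m) * h x) + m ^ 2)) in H
  by (intros; simpl; ring).
rewrite RInt_plus_cont, RInt_minus_cont, RInt_scal_cont, RInt_const_R in H by auto with cont.
replace (RInt h a b) with (m * (b - a)) in * by (unfold m; field; lra).
nra.
Qed.

(** * Complex-valued integrals over a period and the characters *)

Definition Ccont (f : R -> C) : Prop :=
  cont (fun x => Re (f x)) /\ cont (fun x => Im (f x)).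

(** Defined componentwise so that the real integration lemmas apply; [RInt_cint] identifies it with
    the integral in [is_distr_pairing]. *)
Definition cint (f : R -> C) : C :=
  (RInt (fun x => Re (f x)) 0 (2 * PI), RInt (fun x => Im (f x)) 0 (2 * PI)).

Lemma Ccont_const (z : C) : Ccont (fun _ => z).
Proof. split; apply cont_const. Qed.

Lemma Ccont_plus f g : Ccont f -> Ccont g -> Ccont (fun x => (f x + g x)%C).
Proof. intros [h1 h2] [h3 h4]; split; simpl; auto with cont. Qed.

Lemma Ccont_opp f : Ccont f -> Ccont (fun x => (- f x)%C).
Proof. intros [h1 h2]; split; simpl; auto with cont. Qed.

Lemma Ccont_minus f g : Ccont f -> Ccont g -> Ccont (fun x => (f x - g x)%C).
Proof. intros hf hg; apply Ccont_plus; [exact hf|now apply Ccont_opp]. Qed.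

Lemma Ccont_mult f g : Ccont f -> Ccont g -> Ccont (fun x => (f x * g x)%C).
Proof. intros [h1 h2] [h3 h4]; split; simpl; apply cont_minus || apply cont_plus; now apply cont_mult. Qed.

Lemma Ccont_conj f : Ccont f -> Ccont (fun x => Cconj (f x)).
Proof. intros [h1 h2]; split; simpl; auto with cont. Qed.

Lemma Ccont_RtoC f : cont f -> Ccont (fun x => RtoC (f x)).
Proof. intros h; split; simpl; auto with cont. Qed.

Lemma Ccont_Cexpi (f : R -> R) : cont f -> Ccont (fun x => Cexpi (f x)).
Proof. intros h; split; simpl; auto with cont. Qed.

Lemma cont_Cmod f : Ccont f -> cont (fun x => Cmod (f x)).
Proof.
intros [h1 h2]; unfold Cmod; apply cont_sqrt, cont_plus; apply cont_pow; assumption.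
Qed.

#[export] Hint Resolve Ccont_const Ccont_plus Ccont_opp Ccont_minus Ccont_mult Ccont_conj
  Ccont_RtoC Ccont_Cexpi cont_Cmod : cont.

Lemma Ccont_symmetric_sum (f : Z -> R -> C) N :
  (forall l, Ccont (f l)) -> Ccont (fun x => symmetric_sum (fun l => f l x) N).
Proof.
intros H; induction N as [|N IH].
- replace (fun x => _) with (f 0%Z); [apply H|].
  apply functional_extensionality; intro; now rewrite symmetric_sum_0.
- replace (fun x => _) with (fun x => (symmetric_sum (fun l => f l x) N
    + f (Z.of_nat N + 1)%Z x + f (- (Z.of_nat N + 1))%Z x)%C).
  + auto with cont.
  + apply functional_extensionality; intro; now rewrite symmetric_sum_S.
Qed.
#[export] Hint Resolve Ccont_symmetric_sum : cont.

Lemma is_RInt_cint f :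
  Ccont f -> is_RInt (V := C_R_NormedModule) f 0 (2 * PI) (cint f).
Proof.
intros [h1 h2].
apply (is_RInt_fct_extend_pair (U := R_NormedModule) (V := R_NormedModule));
  apply (RInt_correct (V := R_CompleteNormedModule)); now apply ex_RInt_cont.
Qed.

Lemma RInt_cint f :
  Ccont f -> RInt (V := C_R_CompleteNormedModule) f 0 (2 * PI) = cint f.
Proof.
intros h; apply (is_RInt_unique (V := C_R_CompleteNormedModule)); now apply is_RInt_cint.
Qed.

Lemma cint_ext f g : (forall x, f x = g x) -> cint f = cint g.
Proof. intros H; f_equal; now apply functional_extensionality. Qed.

Lemma cint_plus f g :
  Ccont f -> Ccont g -> cint (fun x => (f x + g x)%C) = (cint f + cint g)%C.
Proof.
intros [h1 h2] [h3 h4]; apply injective_projections; simpl; now rewrite <- RInt_plus_cont.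
Qed.

Lemma cint_mult_l z f : Ccont f -> cint (fun x => (z * f x)%C) = (z * cint f)%C.
Proof.
intros [h1 h2]; apply injective_projections; simpl.
- rewrite RInt_minus_cont, !RInt_scal_cont; auto using cont_scal.
- rewrite RInt_plus_cont, !RInt_scal_cont; auto using cont_scal.
Qed.

Lemma cint_minus f g :
  Ccont f -> Ccont g -> cint (fun x => (f x - g x)%C) = (cint f - cint g)%C.
Proof.
intros [h1 h2] [h3 h4]; apply injective_projections; simpl;
  rewrite <- Rminus_def, <- RInt_minus_cont; auto.
Qed.

Lemma cint_symmetric_sum (f : Z -> R -> C) N :
  (forall l, Ccont (f l)) ->
  cint (fun x => symmetric_sum (fun l => f l x) N) = symmetric_sum (fun l => cint (f l)) N.
Proof.
intros H; induction N as [|N IH].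
- rewrite symmetric_sum_0; apply cint_ext; intro; now rewrite symmetric_sum_0.
- rewrite symmetric_sum_S, <- IH.
  rewrite <- !cint_plus by auto with cont.
  apply cint_ext; intro; now rewrite symmetric_sum_S.
Qed.

Lemma Cmod_cint_le f g :
  Ccont f -> cont g -> (forall x, 0 <= x <= 2 * PI -> Cmod (f x) <= g x) ->
  Cmod (cint f) <= RInt g 0 (2 * PI).
Proof.
intros Hf Hg H.
rewrite Cmod_norm.
apply (norm_RInt_le (V := C_R_NormedModule) f g 0 (2 * PI)).
- pose proof two_PI_pos; lra.
- intros x Hx; change (norm (f x)) with (@norm _ C_R_NormedModule (f x)).
  specialize (H x Hx); rewrite Cmod_norm in H; exact H.
- now apply is_RInt_cint.
- apply (RInt_correct (V := R_CompleteNormedModule)); now apply ex_RInt_cont.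
Qed.

Lemma Cmod_cint_le_const f A :
  Ccont f -> (forall x, Cmod (f x) <= A) -> Cmod (cint f) <= 2 * PI * A.
Proof.
intros Hf H; eapply Rle_trans; [apply (Cmod_cint_le f (fun _ => A)); auto with cont|].
rewrite RInt_const_R; apply Req_le; ring.
Qed.

Lemma cint_shift f v :
  Ccont f -> periodic_fun f -> cint (fun x => f (x + v)) = cint f.
Proof.
intros [h1 h2] Hp; apply injective_projections; simpl.
- apply (RInt_period_shift (fun x => Re (f x))); [exact h1|intro; now rewrite Hp].
- apply (RInt_period_shift (fun x => Im (f x))); [exact h2|intro; now rewrite Hp].
Qed.

Lemma Cexpi_plus a b : Cexpi (a + b) = (Cexpi a * Cexpi b)%C.
Proof.
apply injective_projections; simpl; [rewrite cos_plus|rewrite sin_plus]; ring.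
Qed.

Lemma Cexpi_0 : Cexpi 0 = RtoC 1.
Proof. unfold Cexpi; now rewrite cos_0, sin_0. Qed.

Lemma Cmod_Cexpi a : Cmod (Cexpi a) = 1.
Proof.
unfold Cmod; simpl.
replace (_ + _) with ((sin a)² + (cos a)²) by (unfold Rsqr; ring).
rewrite sin2_cos2; apply sqrt_1.
Qed.

Lemma Cexpi_conj a : Cconj (Cexpi a) = Cexpi (- a).
Proof. unfold Cexpi, Cconj; simpl; now rewrite cos_neg, sin_neg. Qed.

Lemma cos_shift_IZR (k : Z) (x : R) : cos (x + 2 * PI * IZR k) = cos x.
Proof.
assert (H : forall (n : nat) y, cos (y + 2 * PI * INR n) = cos y).
{ intros n y; rewrite <- (cos_period y n); f_equal; ring. }
destruct (Z_le_gt_dec 0 k) as [h|h].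
- replace k with (Z.of_nat (Z.to_nat k)) by lia; rewrite <- INR_IZR_INZ; apply H.
- rewrite <- (H (Z.to_nat (- k)) (x + _)); f_equal.
  rewrite INR_IZR_INZ, Z2Nat.id, opp_IZR by lia; ring.
Qed.

Lemma sin_shift_IZR (k : Z) (x : R) : sin (x + 2 * PI * IZR k) = sin x.
Proof.
rewrite <- !cos_shift; rewrite <- (cos_shift_IZR k (PI / 2 - (x + _))); f_equal; ring.
Qed.

Lemma Cexpi_shift_IZR (k : Z) (x : R) : Cexpi (x + 2 * PI * IZR k) = Cexpi x.
Proof. unfold Cexpi; now rewrite cos_shift_IZR, sin_shift_IZR. Qed.

Lemma Cexpi_IZR_periodic (l : Z) : periodic_fun (fun x => Cexpi (IZR l * x)).
Proof.
intro x; rewrite <- (Cexpi_shift_IZR l (IZR l * x)); f_equal; ring.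
Qed.

Lemma is_derive_sin_scal (a x : R) : is_derive (fun x => sin (a * x)) x (a * cos (a * x)).
Proof. auto_derive; [exact I|ring]. Qed.

Lemma is_derive_cos_scal (a x : R) : is_derive (fun x => cos (a * x)) x (- a * sin (a * x)).
Proof. auto_derive; [exact I|ring]. Qed.

Lemma cint_Cexpi_0 : cint (fun x => Cexpi (IZR 0 * x)) = RtoC (2 * PI).
Proof.
unfold cint; simpl.
rewrite (RInt_ext _ (fun _ => 1)), (RInt_ext (fun x => sin (0 * x)) (fun _ => 0)).
- rewrite !RInt_const_R; apply injective_projections; simpl; ring.
- intros x _; now rewrite Rmult_0_l, sin_0.
- intros x _; now rewrite Rmult_0_l, cos_0.
Qed.

Lemma cint_Cexpi_neq0 (l : Z) : l <> 0%Z -> cint (fun x => Cexpi (IZR l * x)) = RtoC 0.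
Proof.
intros Hl.
assert (Hl' : IZR l <> 0) by now apply not_0_IZR.
unfold cint; simpl; apply injective_projections; simpl.
- rewrite (RInt_derive_cont (fun x => / IZR l * sin (IZR l * x))).
  + replace (IZR l * (2 * PI)) with (0 + 2 * PI * IZR l) by ring.
    rewrite sin_shift_IZR, Rmult_0_r; ring.
  + intro x; auto_derive; [exact I|field; exact Hl'].
  + auto using cont_scal with cont.
- rewrite (RInt_derive_cont (fun x => - / IZR l * cos (IZR l * x))).
  + replace (IZR l * (2 * PI)) with (0 + 2 * PI * IZR l) by ring.
    rewrite cos_shift_IZR, Rmult_0_r; ring.
  + intro x; auto_derive; [exact I|field; exact Hl'].
  + auto using cont_scal with cont.
Qed.

(** * Smooth functions and a bump *)

Lemma is_derive_Rmult (f g : R -> R) (x a b : R) :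
  is_derive f x a -> is_derive g x b -> is_derive (fun y => f y * g y) x (a * g x + f x * b).
Proof.
intros Hf Hg; apply (is_derive_mult (K := R_AbsRing) f g x a b Hf Hg).
intros; apply Rmult_comm.
Qed.

(** The derivative is an existential witness rather than [Derive f], so that closure under products
    and compositions is a direct induction. By [smooth_cont_diff], [smooth] means [cont_diff n] for
    every [n]. *)
Fixpoint cont_diff (n : nat) (f : R -> R) : Prop :=
  match n with
  | O => cont f
  | S n' => exists f', (forall x, is_derive f x (f' x)) /\ cont_diff n' f'
  end.

Lemma cont_diff_cont n f : cont_diff n f -> cont f.
Proof.
destruct n as [|n]; [easy|intros [f' [H _]]]; now apply (cont_is_derive f f').
Qed.

Lemma cont_diff_pred n f : cont_diff (S n) f -> cont_diff n f.
Proof.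
revert f; induction n as [|n IH]; intros f H; [exact (cont_diff_cont _ _ H)|].
destruct H as [f' [H1 H2]]; exists f'; auto.
Qed.

Lemma cont_diff_const n a : cont_diff n (fun _ => a).
Proof.
revert a; induction n as [|n IH]; intros a; [apply cont_const|].
exists (fun _ => 0); split; [|apply IH].
intro x; apply (is_derive_const (V := R_NormedModule)).
Qed.

Lemma cont_diff_plus n f g : cont_diff n f -> cont_diff n g -> cont_diff n (fun x => f x + g x).
Proof.
revert f g; induction n as [|n IH]; intros f g; [apply cont_plus|].
intros [f' [Hf Hf']] [g' [Hg Hg']]; exists (fun x => f' x + g' x); split; [|now apply IH].
intro x; apply (is_derive_plus (V := R_NormedModule)); auto.
Qed.

Lemma cont_diff_mult n f g : cont_diff n f -> cont_diff n g -> cont_diff n (fun x => f x * g x).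
Proof.
revert f g; induction n as [|n IH]; intros f g; [apply cont_mult|].
intros Hf Hg; generalize (cont_diff_pred _ _ Hf) (cont_diff_pred _ _ Hg); intros Hfn Hgn.
destruct Hf as [f' [Hf Hf']], Hg as [g' [Hg Hg']].
exists (fun x => f' x * g x + f x * g' x); split; [|now apply cont_diff_plus; apply IH].
intro x; apply is_derive_Rmult; auto.
Qed.

Lemma cont_diff_scal n a f : cont_diff n f -> cont_diff n (fun x => a * f x).
Proof. intros H; apply cont_diff_mult; [apply cont_diff_const|exact H]. Qed.

Lemma cont_diff_minus n f g : cont_diff n f -> cont_diff n g -> cont_diff n (fun x => f x - g x).
Proof.
intros Hf Hg.
replace (fun x => f x - g x) with (fun x => f x + -1 * g x)
  by (apply functional_extensionality; intro; ring).
apply cont_diff_plus; [exact Hf|now apply cont_diff_scal].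
Qed.

Lemma cont_diff_comp n f h : cont_diff n f -> cont_diff n h -> cont_diff n (fun x => f (h x)).
Proof.
revert f h; induction n as [|n IH]; intros f h.
- intros Hf Hh; now apply cont_comp.
- intros [f' [Hf Hf']] Hh; generalize (cont_diff_pred _ _ Hh); intros Hhn.
  destruct Hh as [h' [Hh Hh']].
  exists (fun x => h' x * f' (h x)); split.
  + intro x; apply (is_derive_comp (V := R_NormedModule) f h); auto.
  + apply cont_diff_mult; auto.
Qed.

Lemma cont_diff_sin_cos n a b :
  cont_diff n (fun x => sin (a * x + b)) /\ cont_diff n (fun x => cos (a * x + b)).
Proof.
induction n as [|n [IHs IHc]]; [simpl; auto with cont|].
split.
- exists (fun x => a * cos (a * x + b)); split; [|now apply cont_diff_scal].
  intro x; auto_derive; [exact I|ring].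
- exists (fun x => - a * sin (a * x + b)); split; [|now apply cont_diff_scal].
  intro x; auto_derive; [exact I|ring].
Qed.

Lemma cont_diff_Derive n f :
  cont_diff (S n) f -> (forall x, ex_derive f x) /\ cont_diff n (Derive f).
Proof.
intros [f' [H1 H2]]; split.
- intro x; eexists; apply H1.
- replace (Derive f) with f'; [exact H2|].
  apply functional_extensionality; intro x; symmetry; apply is_derive_unique, H1.
Qed.

Lemma smooth_cont_diff f : smooth f <-> forall n, cont_diff n f.
Proof.
split.
- intros H n.
  assert (key : forall m, cont_diff n (Derive_n f m)).
  { induction n as [|n IH]; intro m.
    - intro x; apply (ex_derive_continuous (V := R_NormedModule)), (H (S m) x).
    - exists (Derive_n f (S m)); split; [|apply IH].
      intro x; apply Derive_correct, (H (S m) x). }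
  apply (key O).
- intros H m.
  assert (key : forall k, cont_diff k (Derive_n f m)).
  { induction m as [|m IH]; [exact H|].
    intro k; apply (cont_diff_Derive k (Derive_n f m)), IH. }
  destruct m as [|m]; [now simpl|].
  intro x.
  assert (key' : forall m k, cont_diff k (Derive_n f m)).
  { clear m key; induction m as [|m IH]; [exact H|].
    intro k; apply (cont_diff_Derive k (Derive_n f m)), IH. }
  apply (cont_diff_Derive O (Derive_n f m) (key' m 1%nat)).
Qed.

(* The derivatives of [exp (- 1 / t)] are combinations of these functions. *)
Definition flat (k : nat) (t : R) : R :=
  if Rle_dec t 0 then 0 else (/ t) ^ k * exp (- / t).

Lemma flat_nonpos k t : t <= 0 -> flat k t = 0.
Proof. intros H; unfold flat; now destruct (Rle_dec t 0). Qed.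

Lemma flat_pos k t : 0 < t -> flat k t = (/ t) ^ k * exp (- / t).
Proof. intros H; unfold flat; destruct (Rle_dec t 0); [lra|reflexivity]. Qed.

(** The inequality [z <= exp z] at [z = y / n], raised to the power [n]. *)
Lemma pow_le_exp (n : nat) (y : R) : 0 <= y -> y ^ n <= INR n ^ n * exp y.
Proof.
intros Hy; destruct n as [|n]; [simpl; rewrite Rmult_1_l; pose proof (exp_ineq1_le y); lra|].
assert (Hn : 0 < INR (S n)) by apply lt_0_INR, Nat.lt_0_succ.
set (z := y / INR (S n)).
assert (Hz : 0 <= z) by now apply Rle_mult_inv_pos.
replace y with (INR (S n) * z) by (unfold z; field; lra).
rewrite Rpow_mult_distr; apply Rmult_le_compat_l; [apply pow_le; lra|].
assert (E : forall m, exp (INR m * z) = exp z ^ m).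
{ induction m as [|m IH]; [simpl; now rewrite Rmult_0_l, exp_0|].
  rewrite S_INR, Rmult_plus_distr_r, exp_plus, IH, Rmult_1_l; simpl; ring. }
rewrite E; apply pow_incr; split; [exact Hz|].
pose proof (exp_ineq1_le z); lra.
Qed.

(** [pow_le_exp] at [1 / t] with exponent [k + 2]. Quadratic vanishing at 0 is what makes the
    derivative there exist and be 0. *)
Lemma flat_le_square k : exists A, 0 < A /\ forall t, 0 <= flat k t <= A * t ^ 2.
Proof.
exists (INR (k + 2) ^ (k + 2)); split.
- apply pow_lt, lt_0_INR; lia.
- intro t; destruct (Rle_dec t 0) as [h|h].
  + rewrite flat_nonpos by exact h; split; [lra|].
    apply Rmult_le_pos; [apply pow_le, pos_INR|apply pow2_ge_0].
  + assert (ht : 0 < t) by lra.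
    assert (hi : 0 < / t) by now apply Rinv_0_lt_compat.
    rewrite flat_pos by exact ht.
    split; [apply Rmult_le_pos; [apply pow_le; lra|apply Rlt_le, exp_pos]|].
    pose proof (pow_le_exp (k + 2) (/ t) (Rlt_le _ _ hi)) as H.
    rewrite pow_add in H.
    rewrite exp_Ropp.
    apply Rmult_le_reg_r with (exp (/ t)); [apply exp_pos|].
    rewrite Rmult_assoc, Rinv_l, Rmult_1_r by apply Rgt_not_eq, exp_pos.
    apply Rmult_le_reg_r with ((/ t) ^ 2); [now apply pow_lt|].
    eapply Rle_trans; [exact H|].
    apply Req_le; field; lra.
Qed.

Lemma is_derive_flat k t :
  is_derive (flat k) t (- INR k * flat (S k) t + flat (S (S k)) t).
Proof.
destruct (Rtotal_order t 0) as [h|[h|h]].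
- rewrite !flat_nonpos by lra.
  replace (- INR k * 0 + 0) with 0 by ring.
  apply (is_derive_ext_loc (fun _ => 0)).
  + apply (locally_interval _ t m_infty 0); simpl; [exact I|exact h|].
    intros y _ Hy; symmetry; apply flat_nonpos; simpl in Hy; lra.
  + apply (is_derive_const (V := R_NormedModule)).
- subst t; rewrite !flat_nonpos by lra.
  replace (- INR k * 0 + 0) with 0 by ring.
  destruct (flat_le_square k) as [A [HA H]].
  apply is_derive_Reals; intros eps He.
  assert (Hd : 0 < eps / A) by now apply Rdiv_lt_0_compat.
  exists (mkposreal _ Hd); intros t Ht Ht'; simpl in Ht'.
  rewrite Rplus_0_l, (flat_nonpos k 0), !Rminus_0_r by lra.
  destruct (H t) as [H1 H2].
  unfold Rdiv; rewrite Rabs_mult, Rabs_inv, (Rabs_pos_eq _ H1).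
  assert (h : 0 < Rabs t) by now apply Rabs_pos_lt.
  apply (Rlt_div_l (flat k t)); [exact h|].
  apply Rlt_div_r in Ht'; [|exact HA].
  rewrite <- pow2_abs in H2; nra.
- rewrite !flat_pos by exact h.
  apply (is_derive_ext_loc (fun t => (/ t) ^ k * exp (- / t))).
  + apply (locally_interval _ t 0 p_infty); simpl; [exact h|exact I|].
    intros y Hy _; symmetry; apply flat_pos; simpl in Hy; lra.
  + auto_derive; [repeat split; lra|].
    destruct k as [|k]; [simpl; field; lra|].
    rewrite S_INR; simpl pred; simpl pow; field; lra.
Qed.

Lemma cont_diff_flat n k : cont_diff n (flat k).
Proof.
revert k; induction n as [|n IH]; intro k.
- apply (cont_is_derive _ _ (is_derive_flat k)).
- exists (fun t => - INR k * flat (S k) t + flat (S (S k)) t); split; [apply is_derive_flat|].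
  apply cont_diff_plus; [apply cont_diff_scal|]; apply IH.
Qed.

Definition bump (s : R) : R := flat 0 (1 - s ^ 2).

Lemma cont_diff_bump n : cont_diff n bump.
Proof.
apply (cont_diff_comp n (flat 0) (fun s => 1 - s ^ 2)); [apply cont_diff_flat|].
apply cont_diff_minus; [apply cont_diff_const|].
assert (H : cont_diff n (fun s : R => s)).
{ destruct n as [|n]; [apply cont_id|].
  exists (fun _ => 1); split; [intro; apply (is_derive_id (K := R_AbsRing))|apply cont_diff_const]. }
replace (fun x : R => x ^ 2) with (fun x : R => x * x)
  by (apply functional_extensionality; intro; ring).
now apply cont_diff_mult.
Qed.

Lemma bump_range s : 0 <= bump s <= 1.
Proof.
unfold bump; destruct (Rle_dec (1 - s ^ 2) 0) as [h|h].
- rewrite flat_nonpos by exact h; lra.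
- rewrite flat_pos by lra; simpl pow at 1 3; rewrite !Rmult_1_l.
  split; [apply Rlt_le, exp_pos|].
  apply Rle_trans with (exp 0); [apply Rlt_le, exp_increasing|rewrite exp_0; lra].
  assert (0 < / (1 - s ^ 2)) by (apply Rinv_0_lt_compat; lra); lra.
Qed.

Lemma bump_eq0 s : 1 <= s ^ 2 -> bump s = 0.
Proof. intros; apply flat_nonpos; lra. Qed.

Lemma bump_ge s : s ^ 2 <= / 2 -> exp (-2) <= bump s.
Proof.
intros H; unfold bump; rewrite flat_pos by lra; simpl pow at 1; rewrite Rmult_1_l.
assert (h : / (1 - s ^ 2) <= 2).
{ rewrite <- (Rinv_inv 2); apply Rinv_le_contravar; lra. }
destruct (Rle_lt_or_eq_dec _ _ h) as [h'|h'].
- apply Rlt_le, exp_increasing; lra.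
- rewrite h'; apply Req_le; f_equal; lra.
Qed.

(** * The rescaled bump on the circle *)

(** Here every derivative up to order [n] is bounded, which makes the class closed under products.
    It supplies the bounds independent of [d] from which the powers of [1 / d] in
    [nth_derive_le_rescaled] are counted. *)
Fixpoint bounded_diff (n : nat) (f : R -> R) : Prop :=
  (exists A, forall x, Rabs (f x) <= A) /\
  match n with
  | O => cont f
  | S n' => exists f', (forall x, is_derive f x (f' x)) /\ bounded_diff n' f'
  end.

Lemma bounded_diff_bound n f : bounded_diff n f -> exists A, forall x, Rabs (f x) <= A.
Proof. destruct n; now intros [H _]. Qed.

Lemma bounded_diff_cont n f : bounded_diff n f -> cont f.
Proof.
destruct n as [|n]; [now intros [_ H]|intros [_ [f' [H _]]]]; now apply (cont_is_derive f f').
Qed.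

Lemma bounded_diff_pred n f : bounded_diff (S n) f -> bounded_diff n f.
Proof.
revert f; induction n as [|n IH]; intros f H.
- split; [exact (bounded_diff_bound _ _ H)|exact (bounded_diff_cont _ _ H)].
- destruct H as [HA [f' [H1 H2]]]; split; [exact HA|]; exists f'; auto.
Qed.

Lemma bounded_diff_plus n f g :
  bounded_diff n f -> bounded_diff n g -> bounded_diff n (fun x => f x + g x).
Proof.
revert f g; induction n as [|n IH]; intros f g [[A HA] Hf] [[B HB] Hg].
- split; [|now apply cont_plus].
  exists (A + B); intro x; eapply Rle_trans; [apply Rabs_triang|]; specialize (HA x); specialize (HB x); lra.
- split.
  + exists (A + B); intro x; eapply Rle_trans; [apply Rabs_triang|]; specialize (HA x); specialize (HB x); lra.
  + destruct Hf as [f' [Hf Hf']], Hg as [g' [Hg Hg']].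
    exists (fun x => f' x + g' x); split; [|now apply IH].
    intro x; apply (is_derive_plus (V := R_NormedModule)); auto.
Qed.

Lemma bounded_diff_mult n f g :
  bounded_diff n f -> bounded_diff n g -> bounded_diff n (fun x => f x * g x).
Proof.
assert (Hb : forall f g : R -> R, (exists A, forall x, Rabs (f x) <= A) ->
  (exists A, forall x, Rabs (g x) <= A) -> exists A, forall x, Rabs (f x * g x) <= A).
{ clear; intros f g [A HA] [B HB]; exists (A * B); intro x; rewrite Rabs_mult.
  apply Rmult_le_compat; auto using Rabs_pos. }
revert f g; induction n as [|n IH]; intros f g Hf Hg.
- destruct Hf, Hg; split; [now apply Hb|now apply cont_mult].
- split; [apply Hb; eapply bounded_diff_bound; eassumption|].
  generalize (bounded_diff_pred _ _ Hf) (bounded_diff_pred _ _ Hg); intros Hfn Hgn.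
  destruct Hf as [_ [f' [Hf Hf']]], Hg as [_ [g' [Hg Hg']]].
  exists (fun x => f' x * g x + f x * g' x); split; [|now apply bounded_diff_plus; apply IH].
  intro x; apply is_derive_Rmult; auto.
Qed.

Lemma bounded_diff_const n a : bounded_diff n (fun _ => a).
Proof.
revert a; induction n as [|n IH]; intros a; (split; [exists (Rabs a); intro; lra|]).
- apply cont_const.
- exists (fun _ => 0); split; [|apply IH].
  intro x; apply (is_derive_const (V := R_NormedModule)).
Qed.

Lemma bounded_diff_cos_half n : 
  bounded_diff n (fun x => cos (x / 2)) /\ bounded_diff n (fun x => sin (x / 2)).
Proof.
assert (Hb : (exists A, forall x, Rabs (cos (x / 2)) <= A) /\ (exists A, forall x, Rabs (sin (x / 2)) <= A)).
{ split; exists 1; intro x; apply Rabs_le; [apply COS_bound|apply SIN_bound]. }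
induction n as [|n [IHc IHs]].
- split; (split; [apply Hb|]); unfold Rdiv; auto with cont.
- split; (split; [apply Hb|]).
  + exists (fun x => - / 2 * sin (x / 2)); split.
    * intro x; auto_derive; [exact I|unfold Rdiv; ring].
    * now apply bounded_diff_mult; [apply bounded_diff_const|].
  + exists (fun x => / 2 * cos (x / 2)); split.
    * intro x; auto_derive; [exact I|unfold Rdiv; ring].
    * now apply bounded_diff_mult; [apply bounded_diff_const|].
Qed.

Lemma cont_bounded_on f a b : cont f -> a <= b -> exists A, forall x, a <= x <= b -> Rabs (f x) <= A.
Proof.
intros Hf Hab.
destruct (continuity_ab_maj (fun x => Rabs (f x)) a b Hab) as [M [HM _]].
- intros c _; apply continuity_pt_filterlim.
  apply (continuous_comp f Rabs); [apply Hf|apply continuous_Rabs].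
- exists (Rabs (f M)); exact HM.
Qed.

Lemma bounded_diff_of_compact_support n f :
  cont_diff n f -> (forall x, 1 < Rabs x -> f x = 0) -> bounded_diff n f.
Proof.
assert (Hb : forall f, cont f -> (forall x, 1 < Rabs x -> f x = 0) -> exists A, forall x, Rabs (f x) <= A).
{ clear; intros f Hf H0; destruct (cont_bounded_on f (-1) 1 Hf) as [A HA]; [lra|].
  exists A; intro x; destruct (Rle_dec (Rabs x) 1) as [h|h].
  - apply HA; now apply Rabs_le_between.
  - rewrite H0, Rabs_R0 by lra.
    eapply Rle_trans; [apply Rabs_pos|apply (HA 0); lra]. }
revert f; induction n as [|n IH]; intros f H H0.
- split; [now apply Hb|exact H].
- split; [apply Hb; [exact (cont_diff_cont _ _ H)|exact H0]|].
  destruct H as [f' [H1 H2]]; exists f'; split; [exact H1|apply IH; [exact H2|]].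
  intros x Hx.
  rewrite <- (is_derive_unique _ _ _ (H1 x)).
  apply is_derive_unique, (is_derive_ext_loc (fun _ => 0)).
  + assert (He : 0 < Rabs x - 1) by lra.
    exists (mkposreal _ He); intros y0 Hy; set (y := y0 : R) in *; symmetry; apply (H0 y).
    change (Rabs (y - x) < Rabs x - 1) in Hy.
    pose proof (Rabs_triang_inv x (x - y)) as h.
    replace (x - (x - y)) with y in h by (clear; ring).
    rewrite (Rabs_minus_sym x y) in h; lra.
  + apply (is_derive_const (V := R_NormedModule)).
Qed.

Lemma bounded_diff_bump n : bounded_diff n bump.
Proof.
apply bounded_diff_of_compact_support; [apply cont_diff_bump|].
intros x Hx; apply bump_eq0; rewrite <- pow2_abs; nra.
Qed.

Lemma bounded_diff_Derive f :
  (forall n, bounded_diff n f) ->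
  (forall x, is_derive f x (Derive f x)) /\ forall n, bounded_diff n (Derive f).
Proof.
intros H; split.
- intro x; destruct (H 1%nat) as [_ [f' [H1 _]]]; apply Derive_correct; eexists; apply H1.
- intro n; destruct (H (S n)) as [_ [f' [H1 H2]]].
  replace (Derive f) with f'; [exact H2|].
  apply functional_extensionality; intro x; symmetry; apply is_derive_unique, H1.
Qed.

(* Only the derivative of order [n] is bounded by [A]. *)
Fixpoint nth_derive_le (n : nat) (A : R) (f : R -> R) : Prop :=
  match n with
  | O => cont f /\ forall x, Rabs (f x) <= A
  | S n' => exists f', (forall x, is_derive f x (f' x)) /\ nth_derive_le n' A f'
  end.

Lemma nth_derive_le_cont n A f : nth_derive_le n A f -> cont f.
Proof.
destruct n as [|n]; [now intros [H _]|intros [f' [H _]]]; now apply (cont_is_derive f f').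
Qed.

Lemma nth_derive_le_scal_plus n A B a f g :
  nth_derive_le n A f -> nth_derive_le n B g ->
  nth_derive_le n (A + Rabs a * B) (fun x => f x + a * g x).
Proof.
revert f g; induction n as [|n IH]; intros f g.
- intros [Hf HA] [Hg HB]; split; [auto using cont_scal with cont|].
  intro x; eapply Rle_trans; [apply Rabs_triang|].
  apply Rplus_le_compat; [apply HA|]; rewrite Rabs_mult.
  apply Rmult_le_compat_l; [apply Rabs_pos|apply HB].
- intros [f' [Hf Hf']] [g' [Hg Hg']]; exists (fun x => f' x + a * g' x); split; [|now apply IH].
  intro x; apply (is_derive_plus (V := R_NormedModule)); [apply Hf|].
  apply is_derive_scal, Hg.
Qed.

Lemma nth_derive_le_weaken n A B f : A <= B -> nth_derive_le n A f -> nth_derive_le n B f.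
Proof.
revert f; induction n as [|n IH]; intros f HAB.
- intros [Hf HA]; split; [exact Hf|]; intro x; eapply Rle_trans; [apply HA|exact HAB].
- intros [f' [Hf Hf']]; exists f'; auto.
Qed.

(** The derivative of [p * g (sin (x / 2) / d)] is a product of the same shape with [p'] and [g],
    plus [1 / d] times one with [p * cos (x / 2) / 2] and [g']. The factor [p] is carried along so
    that the induction closes; [d <= 1] lets the lower power of [1 / d] be absorbed. *)
Lemma nth_derive_le_rescaled n :
  forall p g, (forall k, bounded_diff k p) -> (forall k, bounded_diff k g) ->
  exists A, 0 <= A /\ forall d, 0 < d <= 1 ->
    nth_derive_le n (A / d ^ n) (fun x => p x * g (sin (x / 2) / d)).
Proof.
induction n as [|n IH]; intros p g Hp Hg.
- destruct (bounded_diff_bound _ _ (Hp O)) as [A HA].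
  destruct (bounded_diff_bound _ _ (Hg O)) as [B HB].
  exists (A * B); split.
  { apply Rmult_le_pos; (eapply Rle_trans; [apply Rabs_pos|]); [apply (HA 0)|apply (HB 0)]. }
  intros d Hd; split.
  + apply cont_mult; [exact (bounded_diff_cont _ _ (Hp O))|].
    apply (cont_comp (fun x => sin (x / 2) / d)); [|exact (bounded_diff_cont _ _ (Hg O))].
    unfold Rdiv; auto with cont.
  + intro x; simpl; rewrite Rdiv_1_r, Rabs_mult.
    apply Rmult_le_compat; auto using Rabs_pos.
- destruct (bounded_diff_Derive p Hp) as [Hp1 Hp2].
  destruct (bounded_diff_Derive g Hg) as [Hg1 Hg2].
  destruct (IH (Derive p) g Hp2 Hg) as [A [HA0 HA]].
  destruct (IH (fun x => p x * (cos (x / 2) * / 2)) (Derive g)) as [B [HB0 HB]].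
  { intro k; apply bounded_diff_mult; [apply Hp|].
    apply bounded_diff_mult; [apply bounded_diff_cos_half|apply bounded_diff_const]. }
  { exact Hg2. }
  exists (A + B); split; [lra|]; intros d Hd.
  exists (fun x => Derive p x * g (sin (x / 2) / d)
    + / d * (p x * (cos (x / 2) * / 2) * Derive g (sin (x / 2) / d))); split.
  + intro x.
    assert (Hs : is_derive (fun x => sin (x / 2) / d) x (cos (x / 2) * / 2 / d)).
    { auto_derive; [exact I|unfold Rdiv; ring]. }
    assert (Hc : is_derive (fun x => g (sin (x / 2) / d)) x
      (cos (x / 2) * / 2 / d * Derive g (sin (x / 2) / d))).
    { apply (is_derive_comp (V := R_NormedModule) g (fun x => sin (x / 2) / d)); [apply Hg1|exact Hs]. }
    replace (_ + _) with (Derive p x * g (sin (x / 2) / d)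
      + p x * (cos (x / 2) * / 2 / d * Derive g (sin (x / 2) / d))) by (unfold Rdiv; ring).
    apply (is_derive_Rmult p (fun x => g (sin (x / 2) / d))); [apply Hp1|exact Hc].
  + eapply nth_derive_le_weaken; [|apply nth_derive_le_scal_plus; [apply HA|apply HB]; exact Hd].
    assert (h : 0 < / d) by (apply Rinv_0_lt_compat; lra).
    assert (h1 : 1 <= / d) by (rewrite <- Rinv_1; apply Rinv_le_contravar; lra).
    rewrite (Rabs_pos_eq (/ d)) by lra.
    unfold Rdiv; rewrite <- !pow_inv; simpl pow.
    assert (h2 : 0 <= A * (/ d) ^ n) by (apply Rmult_le_pos; [exact HA0|apply pow_le; lra]).
    nra.
Qed.

(* The absolute value of [sin (x / 2)] is comparable to the distance of [x] to [2 PI Z]. *)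
Definition circle_bump (d x : R) : R := bump (sin (x / 2) / d).

Lemma circle_bump_nth_derive n :
  exists A, 0 <= A /\ forall d, 0 < d <= 1 -> nth_derive_le n (A / d ^ n) (circle_bump d).
Proof.
destruct (nth_derive_le_rescaled n (fun _ => 1) bump) as [A [HA H]].
- intro; apply bounded_diff_const.
- apply bounded_diff_bump.
- exists A; split; [exact HA|]; intros d Hd.
  replace (circle_bump d) with (fun x => 1 * bump (sin (x / 2) / d)); [now apply H|].
  apply functional_extensionality; intro; apply Rmult_1_l.
Qed.

Lemma cont_diff_circle_bump n d y : cont_diff n (fun x => circle_bump d (x - y)).
Proof.
unfold circle_bump.
apply (cont_diff_comp n bump (fun x => sin ((x - y) / 2) / d)); [apply cont_diff_bump|].
replace (fun x => sin ((x - y) / 2) / d) with (fun x => / d * sin (/ 2 * x + - y / 2)).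
- apply cont_diff_scal, cont_diff_sin_cos.
- apply functional_extensionality; intro x; unfold Rdiv; rewrite Rmult_comm; f_equal; f_equal; field.
Qed.

(** [sin (x / 2)] only changes sign over a period, and [bump] is even. *)
Lemma circle_bump_periodic d : real_periodic (circle_bump d).
Proof.
intro x; unfold circle_bump, bump.
replace ((x + 2 * PI) / 2) with (x / 2 + PI) by field.
rewrite neg_sin; f_equal; unfold Rdiv; ring.
Qed.

Lemma circle_bump_range d x : 0 <= circle_bump d x <= 1.
Proof. apply bump_range. Qed.

Lemma circle_bump_eq0 d x : 0 < d -> d <= Rabs (sin (x / 2)) -> circle_bump d x = 0.
Proof.
intros Hd H; apply bump_eq0.
unfold Rdiv at 1; rewrite Rpow_mult_distr, pow_inv.
apply (Rle_div_r 1 (sin (x / 2) ^ 2)); [now apply pow_lt|].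
rewrite Rmult_1_l, <- (pow2_abs (sin _)); apply pow_incr; lra.
Qed.

Lemma circle_bump_ge d x : 0 < d -> 2 * Rabs (sin (x / 2)) <= d -> exp (-2) <= circle_bump d x.
Proof.
intros Hd H; apply bump_ge.
unfold Rdiv at 1; rewrite Rpow_mult_distr, pow_inv.
apply (Rle_div_l (sin (x / 2) ^ 2)); [now apply pow_lt|].
rewrite <- (pow2_abs (sin _)).
pose proof (Rabs_pos (sin (x / 2))); nra.
Qed.

Lemma sin_half_shift x (k : Z) : Rabs (sin ((x + 2 * PI * IZR k) / 2)) = Rabs (sin (x / 2)).
Proof.
apply Rsqr_eq_abs_0.
assert (H : forall y, (sin (y / 2))² = (1 - cos y) / 2).
{ intro y; replace (cos y) with (cos (2 * (y / 2))) by (f_equal; field).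
  rewrite cos_2a_sin; unfold Rsqr; field. }
now rewrite !H, cos_shift_IZR.
Qed.

Lemma sin_half_le x : Rabs (sin (x / 2)) <= Rabs x / 2.
Proof.
replace (Rabs x / 2) with (Rabs (x / 2)).
- generalize (x / 2); clear x; intro y.
  assert (H : forall y, 0 <= y -> Rabs (sin y) <= y).
  { intros z Hz; destruct (Rle_dec z PI) as [h|h].
    - rewrite Rabs_pos_eq by now apply sin_ge_0.
      destruct Hz as [Hz| <-]; [apply Rlt_le, sin_lt_x, Hz|rewrite sin_0; lra].
    - apply Rle_trans with 1; [apply Rabs_le, SIN_bound|].
      pose proof PI2_1; lra. }
  destruct (Rle_dec 0 y) as [h|h].
  + rewrite (Rabs_pos_eq y h); now apply H.
  + rewrite <- (Rabs_Ropp (sin y)), <- sin_neg, <- (Rabs_Ropp y), (Rabs_pos_eq (- y)) by lra.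
    apply H; lra.
- unfold Rdiv; rewrite Rabs_mult, (Rabs_pos_eq (/ 2)); lra.
Qed.

(** With [y = x / 2], the degree 7 Taylor lower bound of [sin y], minus [y / 2] and divided by [y],
    is a polynomial in [y ^ 2] that is nonnegative up to 3.02. The partial sum [13 / 15] of the
    alternating series for [PI / 4] bounds [PI] well enough for that range. *)
Lemma sin_half_ge x : Rabs x <= PI -> Rabs x / 4 <= Rabs (sin (x / 2)).
Proof.
assert (H : forall x, 0 <= x <= PI -> x / 4 <= sin (x / 2)).
{ clear; intros x Hx.
  assert (Hpi : PI <= 347 / 100).
  { pose proof (PI_ineq 1) as [_ h]; unfold tg_alt, PI_tg in h; simpl in h.
    replace (_ + _ + _) with (13 / 15) in h by field. lra. }
  pose proof (SIN (x / 2)) as h.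
  destruct h as [h _]; [lra|lra|].
  unfold sin_lb, sin_approx, sin_term in h; simpl in h.
  set (y := x / 2) in *.
  assert (hy : 0 <= y <= 1735 / 1000) by (unfold y; lra).
  replace (x / 4) with (y / 2) by (unfold y; field).
  eapply Rle_trans; [|exact h].
  assert (hz : 0 <= y ^ 2 <= 302 / 100) by nra.
  assert (h' : 0 <= / 2 - y ^ 2 / 6 + (y ^ 2) ^ 2 / 120 - (y ^ 2) ^ 3 / 5040).
  { revert hz; generalize (y ^ 2); intros z hz.
    assert (0 <= z ^ 2 * (302 / 100 - z)) by (apply Rmult_le_pos; [apply pow2_ge_0|lra]).
    nra. }
  nra. }
intros Hx; destruct (Rle_dec 0 x) as [h|h].
- rewrite (Rabs_pos_eq x) in * by exact h.
  eapply Rle_trans; [apply H; lra|apply Rle_abs].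
- rewrite <- (Rabs_Ropp x) in *; rewrite (Rabs_pos_eq (- x)) in * by lra.
  rewrite <- (Rabs_Ropp (sin _)), <- sin_neg.
  replace (- (x / 2)) with (- x / 2) by field.
  eapply Rle_trans; [apply H; lra|apply Rle_abs].
Qed.

Lemma period_reduce x : exists k : Z, Rabs (x + 2 * PI * IZR k) <= PI.
Proof.
pose proof two_PI_pos as h2.
destruct (archimed ((x - PI) / (2 * PI))) as [h3 h4].
set (j := up ((x - PI) / (2 * PI))) in *.
exists (- j)%Z; rewrite opp_IZR.
apply Rlt_div_l in h3; [|exact h2].
assert (h5 : IZR j <= (x - PI) / (2 * PI) + 1) by lra.
replace ((x - PI) / (2 * PI) + 1) with ((x + PI) / (2 * PI)) in h5 by (field; lra).
apply Rle_div_r in h5; [|exact h2].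
apply Rabs_le; lra.
Qed.

(** Origin of the radius [4 * d] of all neighbourhoods below: [circle_bump d] is nonzero only where
    [|sin (x / 2)| < d]. *)
Lemma near_period_of_sin_half_le x d :
  Rabs (sin (x / 2)) <= d -> exists k : Z, Rabs (x + 2 * PI * IZR k) <= 4 * d.
Proof.
intros H; destruct (period_reduce x) as [k Hk]; exists k.
pose proof (sin_half_ge _ Hk) as h; rewrite sin_half_shift in h; lra.
Qed.

(** * Fourier coefficients and Fourier inversion *)

Definition fourier (phi : R -> C) (m : Z) : C :=
  (RtoC (/ (2 * PI)) * cint (fun x => (phi x * Cexpi (IZR (- m) * x))%C))%C.

Lemma cint_eq_fourier phi l :
  cint (fun x => (Cexpi (IZR l * x) * phi x)%C) = (RtoC (2 * PI) * fourier phi (- l))%C.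
Proof.
unfold fourier; rewrite Cmult_assoc, <- RtoC_mult, Rinv_r, Cmult_1_l
  by (pose proof two_PI_pos; lra).
rewrite Z.opp_involutive; apply cint_ext; intro; apply Cmult_comm.
Qed.

Lemma fourier_plus f g l :
  Ccont f -> Ccont g -> fourier (fun x => (f x + g x)%C) l = (fourier f l + fourier g l)%C.
Proof.
intros Hf Hg; unfold fourier; rewrite <- Cmult_plus_distr_l, <- cint_plus
  by auto 10 with cont.
f_equal; apply cint_ext; intro; ring.
Qed.

Lemma fourier_mult_l z f l :
  Ccont f -> fourier (fun x => (z * f x)%C) l = (z * fourier f l)%C.
Proof.
intros Hf; unfold fourier.
rewrite (cint_ext _ (fun x => (z * (f x * Cexpi (IZR (- l) * x)))%C)) by (intro; ring).
rewrite cint_mult_l by auto 10 with cont; ring.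
Qed.

Lemma fourier_const z l :
  fourier (fun _ => z) l = if Z.eq_dec l 0 then z else RtoC 0.
Proof.
unfold fourier; rewrite cint_mult_l by auto 10 with cont.
destruct (Z.eq_dec l 0) as [->|h].
- rewrite Z.opp_0, cint_Cexpi_0, Cmult_comm, <- Cmult_assoc, <- RtoC_mult, Rinv_r, Cmult_1_r
    by (pose proof two_PI_pos; lra); reflexivity.
- rewrite cint_Cexpi_neq0 by lia; ring.
Qed.

Lemma fourier_shift f v l :
  Ccont f -> periodic_fun f ->
  fourier (fun x => f (x + v)) l = (Cexpi (IZR l * v) * fourier f l)%C.
Proof.
intros Hf Hp; unfold fourier.
rewrite <- (cint_shift (fun x => (f x * Cexpi (IZR (- l) * x))%C) v).
- assert (Hfv : Ccont (fun x => f (x + v))).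
  { destruct Hf as [h1 h2]; split.
    - apply (cont_comp (fun x => x + v) (fun x => Re (f x))); auto 10 with cont.
    - apply (cont_comp (fun x => x + v) (fun x => Im (f x))); auto 10 with cont. }
  assert (H : cint (fun x => (f (x + v)%R * Cexpi (IZR (- l) * x))%C) = (Cexpi (IZR l * v) *
    cint (fun x => f (x + v)%R * Cexpi (IZR (- l) * (x + v))))%C); [|rewrite H; ring].
  rewrite <- cint_mult_l by auto 10 with cont.
  apply cint_ext; intro x.
  replace (IZR (- l) * (x + v)) with (IZR (- l) * x + - (IZR l * v)) by (rewrite opp_IZR; ring).
  rewrite Cexpi_plus.
  transitivity (f (x + v)%R * Cexpi (IZR (- l) * x) * (Cexpi (IZR l * v) * Cexpi (- (IZR l * v))))%C; [|ring].
  rewrite <- Cexpi_plus, Rplus_opp_r, Cexpi_0; ring.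
- auto 10 with cont.
- intro x; now rewrite Hp, Cexpi_IZR_periodic.
Qed.

Lemma Cmod_fourier_le f A l : Ccont f -> (forall x, Cmod (f x) <= A) -> Cmod (fourier f l) <= A.
Proof.
intros Hf HA; unfold fourier; pose proof two_PI_pos as h.
rewrite Cmod_mult, Cmod_R, Rabs_inv, (Rabs_pos_eq (2 * PI)) by lra.
rewrite Rmult_comm; apply Rle_div_l; [exact h|].
rewrite Rmult_comm; apply Cmod_cint_le_const; [auto 10 with cont|].
intro x; rewrite Cmod_mult, Cmod_Cexpi, Rmult_1_r; apply HA.
Qed.

Lemma real_periodic_derive (f f' : R -> R) :
  real_periodic f -> (forall x, is_derive f x (f' x)) -> real_periodic f'.
Proof.
intros Hp Hf x.
rewrite <- (is_derive_unique _ _ _ (Hf x)), <- (is_derive_unique _ _ _ (Hf (x + 2 * PI))).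
symmetry; apply is_derive_unique.
apply (is_derive_ext (fun y => f (y + 2 * PI))); [exact Hp|].
rewrite <- (Rmult_1_l (Derive f (x + 2 * PI))).
apply (is_derive_comp (V := R_NormedModule) f (fun y => y + 2 * PI) x (Derive f (x + 2 * PI)) 1).
- apply Derive_correct; eexists; apply Hf.
- auto_derive; [exact I|ring].
Qed.

Lemma cint_by_parts (f f' : R -> R) (l : Z) :
  real_periodic f -> (forall x, is_derive f x (f' x)) -> cont f' ->
  cint (fun x => (RtoC (f' x) * Cexpi (IZR l * x))%C) =
  (- (RtoC (IZR l) * Ci) * cint (fun x => (RtoC (f x) * Cexpi (IZR l * x))%C))%C.
Proof.
intros Hp Hf Hf'.
pose proof (cont_is_derive _ _ Hf) as Hfc.
assert (H : cint (fun x => (RtoC (f' x) * Cexpi (IZR l * x)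
  + (RtoC (IZR l) * Ci) * (RtoC (f x) * Cexpi (IZR l * x)))%C) = RtoC 0).
{ apply injective_projections; simpl.
  - rewrite (RInt_ext _ (fun x => f' x * cos (IZR l * x) + f x * (- IZR l * sin (IZR l * x))))
      by (intros; simpl; ring).
    rewrite (RInt_derive_cont (fun x => f x * cos (IZR l * x))).
    + replace (IZR l * (2 * PI)) with (0 + 2 * PI * IZR l) by ring.
      rewrite cos_shift_IZR, Rmult_0_r; rewrite <- (Rplus_0_l (2 * PI)), Hp; ring.
    + intro x; apply (is_derive_Rmult f (fun x => cos (IZR l * x))); [apply Hf|apply is_derive_cos_scal].
    + auto 10 with cont.
  - rewrite (RInt_ext _ (fun x => f' x * sin (IZR l * x) + f x * (IZR l * cos (IZR l * x))))
      by (intros; simpl; ring).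
    rewrite (RInt_derive_cont (fun x => f x * sin (IZR l * x))).
    + replace (IZR l * (2 * PI)) with (0 + 2 * PI * IZR l) by ring.
      rewrite sin_shift_IZR, Rmult_0_r; rewrite <- (Rplus_0_l (2 * PI)), Hp; ring.
    + intro x; apply (is_derive_Rmult f (fun x => sin (IZR l * x))); [apply Hf|apply is_derive_sin_scal].
    + auto 10 with cont. }
rewrite cint_plus, cint_mult_l in H by auto 10 with cont.
revert H; generalize (cint (fun x => (RtoC (f' x) * Cexpi (IZR l * x))%C)).
generalize (cint (fun x => (RtoC (f x) * Cexpi (IZR l * x))%C)).
intros b a H.
replace a with ((a + RtoC (IZR l) * Ci * b) - RtoC (IZR l) * Ci * b)%C by ring.
rewrite H; ring.
Qed.

Lemma fourier_decay_real n A f (l : Z) :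
  real_periodic f -> nth_derive_le n A f ->
  Rabs (IZR l) ^ n * Cmod (fourier (fun x => RtoC (f x)) l) <= A.
Proof.
revert f; induction n as [|n IH]; intros f Hp H.
- destruct H as [Hf HA]; simpl; rewrite Rmult_1_l.
  apply Cmod_fourier_le; [auto 10 with cont|]; intro; rewrite Cmod_R; apply HA.
- destruct H as [f' [H1 H2]].
  specialize (IH f' (real_periodic_derive _ _ Hp H1) H2).
  unfold fourier in *.
  rewrite (cint_by_parts f f' (- l)) in IH by (eauto using nth_derive_le_cont).
  rewrite !Cmod_mult, Cmod_opp, Cmod_mult, (Cmod_R (IZR _)), Cmod_Ci, opp_IZR, Rabs_Ropp in IH.
  rewrite !Cmod_mult; simpl pow; rewrite opp_IZR; nra.
Qed.

Lemma real_periodic_IZR f (k : Z) x : real_periodic f -> f (x + 2 * PI * IZR k) = f x.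
Proof.
intros Hp.
assert (Hn : forall (n : nat) y, f (y + 2 * PI * INR n) = f y).
{ induction n as [|n IH]; intro y; [simpl; f_equal; ring|].
  transitivity (f (y + 2 * PI * INR n)); [|apply IH].
  rewrite <- (Hp (y + 2 * PI * INR n)), S_INR; f_equal; ring. }
destruct (Z_le_gt_dec 0 k) as [h|h].
- replace k with (Z.of_nat (Z.to_nat k)) by lia; rewrite <- INR_IZR_INZ; apply Hn.
- rewrite <- (Hn (Z.to_nat (- k)) (x + _)); f_equal.
  rewrite INR_IZR_INZ, Z2Nat.id, opp_IZR by lia; ring.
Qed.

Lemma periodic_bounded f : cont f -> real_periodic f -> exists A, forall x, Rabs (f x) <= A.
Proof.
intros Hf Hp; pose proof PI_RGT_0.
destruct (cont_bounded_on f (- PI) PI Hf) as [A HA]; [lra|].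
exists A; intro x; destruct (period_reduce x) as [k Hk].
rewrite <- (real_periodic_IZR f k x Hp); apply HA; now apply Rabs_le_between.
Qed.

Lemma cont_diff_nth_derive_le n f :
  cont_diff n f -> real_periodic f -> exists A, 0 <= A /\ nth_derive_le n A f.
Proof.
revert f; induction n as [|n IH]; intros f Hf Hp.
- destruct (periodic_bounded f Hf Hp) as [A HA]; exists A; split; [|now split].
  eapply Rle_trans; [apply Rabs_pos|apply (HA 0)].
- destruct Hf as [f' [H1 H2]].
  destruct (IH f' H2 (real_periodic_derive _ _ Hp H1)) as [A [HA0 HA]].
  exists A; split; [exact HA0|]; now exists f'.
Qed.

Lemma le_quartic_decay X A B y :
  X <= A -> Rabs y ^ 4 * X <= B -> 0 <= X -> X <= 2 * (A + B) / (1 + y ^ 2) ^ 2.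
Proof.
intros HA HB HX.
replace (Rabs y ^ 4) with (y ^ 4) in HB
  by (replace 4%nat with (2 * 2)%nat by lia; now rewrite !pow_mult, pow2_abs).
assert (h : 0 < (1 + y ^ 2) ^ 2) by (apply pow_lt; nra).
apply Rle_div_r; [exact h|].
assert ((1 + y ^ 2) ^ 2 <= 2 * (1 + y ^ 4)).
{ replace (y ^ 4) with ((y ^ 2) ^ 2) by ring; pose proof (pow2_ge_0 (y ^ 2 - 1)); lra. }
apply Rle_trans with (X * (2 * (1 + y ^ 4))); [now apply Rmult_le_compat_l|nra].
Qed.

Definition real_test (f : R -> R) : Prop := real_periodic f /\ forall n, cont_diff n f.

Lemma test_function_parts phi :
  test_function phi <-> real_test (fun x => Re (phi x)) /\ real_test (fun x => Im (phi x)).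
Proof.
split.
- intros [Hp [H1 H2]]; split; split; try (intro x; now rewrite Hp); now apply smooth_cont_diff.
- intros [[Hp1 H1] [Hp2 H2]]; split; [|split; now apply smooth_cont_diff].
  intro x; apply injective_projections; [apply Hp1|apply Hp2].
Qed.

Lemma test_Ccont phi : test_function phi -> Ccont phi.
Proof.
intros H; apply test_function_parts in H; destruct H as [[_ H1] [_ H2]].
split; [apply (H1 O)|apply (H2 O)].
Qed.

Lemma real_test_fourier_decay f :
  real_test f -> exists A, 0 <= A /\ forall l,
    Cmod (fourier (fun x => RtoC (f x)) l) <= A / (1 + IZR l ^ 2) ^ 2.
Proof.
intros [Hp H].
destruct (cont_diff_nth_derive_le 0 f (H O) Hp) as [A [HA0 HA]].
destruct (cont_diff_nth_derive_le 4 f (H 4%nat) Hp) as [B [HB0 HB]].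
exists (2 * (A + B)); split; [lra|]; intro l.
pose proof (fourier_decay_real _ _ _ l Hp HA) as h1; simpl in h1; rewrite Rmult_1_l in h1.
apply le_quartic_decay; [exact h1|now apply fourier_decay_real|apply Cmod_ge_0].
Qed.

Lemma fourier_parts phi l :
  Ccont phi ->
  fourier phi l = (fourier (fun x => RtoC (Re (phi x))) l
    + Ci * fourier (fun x => RtoC (Im (phi x))) l)%C.
Proof.
intros [H1 H2]; rewrite <- fourier_mult_l, <- fourier_plus by auto 10 with cont.
unfold fourier; f_equal; apply cint_ext; intro x; f_equal.
apply injective_projections; simpl; unfold Re, Im; ring.
Qed.

(** Of the two factors [1 + l ^ 2], one absorbs the polynomial growth in [l] of what the
    coefficients are multiplied with, the other keeps the sum convergent. *)
Lemma test_fourier_decay phi :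
  test_function phi -> exists A, 0 <= A /\ forall l,
    Cmod (fourier phi l) <= A / (1 + IZR l ^ 2) ^ 2.
Proof.
intros H; pose proof (test_Ccont _ H) as Hc.
apply test_function_parts in H; destruct H as [H1 H2].
destruct (real_test_fourier_decay _ H1) as [A [HA0 HA]].
destruct (real_test_fourier_decay _ H2) as [B [HB0 HB]].
exists (A + B); split; [lra|]; intro l.
rewrite fourier_parts by exact Hc.
eapply Rle_trans; [apply Cmod_triangle|].
rewrite Cmod_mult, Cmod_Ci, Rmult_1_l.
unfold Rdiv; rewrite Rmult_plus_distr_r; apply Rplus_le_compat; [apply HA|apply HB].
Qed.

Lemma quartic_le_quadratic A y : 0 <= A -> A / (1 + y ^ 2) ^ 2 <= A / (1 + y ^ 2).
Proof.
intros HA; apply Rmult_le_compat_l; [exact HA|].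
apply Rinv_le_contravar; nra.
Qed.

(** * Orthogonality, Bessel's inequality and the Riemann-Lebesgue lemma *)

Lemma energy_minus_component h l :
  Ccont h ->
  RInt (fun x => Cmod (h x - fourier h l * Cexpi (IZR l * x)) ^ 2) 0 (2 * PI)
    + 2 * PI * Cmod (fourier h l) ^ 2
  = RInt (fun x => Cmod (h x) ^ 2) 0 (2 * PI).
Proof.
intros Hh; set (a := fourier h l).
assert (Hint : 2 * PI * Re a = RInt (fun x => Re (h x * Cexpi (IZR (- l) * x))) 0 (2 * PI) /\
  2 * PI * Im a = RInt (fun x => Im (h x * Cexpi (IZR (- l) * x))) 0 (2 * PI)).
{ unfold a, fourier, cint; simpl; pose proof two_PI_pos; split; field; lra. }
destruct Hint as [Hr Hi].
destruct (Ccont_mult h (fun x => Cexpi (IZR (- l) * x)) Hh) as [hr hi]; [auto 10 with cont|].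
rewrite (RInt_ext _ (fun x => (Cmod (h x) ^ 2
  - (2 * Re a * Re (h x * Cexpi (IZR (- l) * x)) + 2 * Im a * Im (h x * Cexpi (IZR (- l) * x))))
  + Cmod a ^ 2)).
- rewrite RInt_plus_cont, RInt_minus_cont, RInt_plus_cont, !RInt_scal_cont, RInt_const_R, <- Hr, <- Hi, !Cmod2_alt
    by (auto 7 using cont_scal with cont).
  ring.
- intros x _; rewrite !Cmod2_alt.
  rewrite opp_IZR, Ropp_mult_distr_l_reverse.
  unfold Cexpi; rewrite cos_neg, sin_neg.
  pose proof (sin2_cos2 (IZR l * x)) as h2; unfold Rsqr in h2.
  unfold Re, Im; destruct (h x) as [u v], a as [p q]; simpl.
  set (s := sin _) in *; set (k := cos _) in *.
  replace (p * (p * 1) + q * (q * 1)) with ((p * p + q * q) * (s * s + k * k)) by (rewrite h2; ring).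
  ring.
Qed.

Lemma fourier_minus_component h z k l :
  Ccont h -> k <> l -> fourier (fun x => (h x - z * Cexpi (IZR l * x))%C) k = fourier h k.
Proof.
intros Hh Hkl; unfold fourier; f_equal.
transitivity (cint (fun x => (h x * Cexpi (IZR (- k) * x)
  - z * Cexpi (IZR (l - k) * x))%C)).
- apply cint_ext; intro x.
  replace (IZR (l - k) * x) with (IZR l * x + IZR (- k) * x)
    by (rewrite minus_IZR, opp_IZR; ring).
  rewrite Cexpi_plus; ring.
- rewrite cint_minus, cint_mult_l, cint_Cexpi_neq0 by (auto 10 with cont || lia); ring.
Qed.

(** The components along the characters are subtracted one at a time, each lowering the energy as in
    Pythagoras' theorem. The invariant also records that the coefficients beyond [N] are untouched,
    so that the next component to remove is still that of [g]. *)
Lemma bessel g N :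
  Ccont g ->
  real_symmetric_sum (fun l => 2 * PI * Cmod (fourier g l) ^ 2) N
    <= RInt (fun x => Cmod (g x) ^ 2) 0 (2 * PI).
Proof.
intros Hg.
assert (H : exists h, Ccont h /\
  (forall l, (Z.of_nat N < Z.abs l)%Z -> fourier h l = fourier g l) /\
  RInt (fun x => Cmod (h x) ^ 2) 0 (2 * PI)
    + real_symmetric_sum (fun l => 2 * PI * Cmod (fourier g l) ^ 2) N
  = RInt (fun x => Cmod (g x) ^ 2) 0 (2 * PI)).
{ induction N as [|N [h [H1 [H2 H3]]]].
  - exists (fun x => (g x - fourier g 0 * Cexpi (IZR 0 * x))%C).
    split; [auto 10 with cont|split].
    + intros l Hl; apply fourier_minus_component; [exact Hg|lia].
    + apply energy_minus_component, Hg.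
  - set (l1 := (Z.of_nat N + 1)%Z); set (l2 := (- l1)%Z).
    set (h1 := fun x => (h x - fourier h l1 * Cexpi (IZR l1 * x))%C).
    assert (Hh1 : Ccont h1) by (unfold h1; auto 10 with cont).
    exists (fun x => (h1 x - fourier h1 l2 * Cexpi (IZR l2 * x))%C).
    split; [auto 10 with cont|split].
    + intros l Hl; rewrite fourier_minus_component by (exact Hh1 || lia).
      unfold h1; rewrite fourier_minus_component by (exact H1 || lia).
      apply H2; lia.
    + pose proof (energy_minus_component h l1 H1) as E1.
      pose proof (energy_minus_component h1 l2 Hh1) as E2.
      assert (E3 : fourier h1 l2 = fourier g l2).
      { unfold h1; rewrite fourier_minus_component by (exact H1 || lia); apply H2; lia. }
      change (RInt (fun x => Cmod (h1 x) ^ 2) 0 (2 * PI) + 2 * PI * Cmod (fourier h l1) ^ 2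
        = RInt (fun x => Cmod (h x) ^ 2) 0 (2 * PI)) in E1.
      rewrite (H2 l1) in E1 by lia.
      cbn [real_symmetric_sum]; fold l1; fold l2; rewrite E3 in *.
      lra. }
destruct H as [h [H1 [_ H3]]].
assert (0 <= RInt (fun x => Cmod (h x) ^ 2) 0 (2 * PI)).
{ apply RInt_nonneg_cont; [pose proof two_PI_pos; lra|auto 10 with cont|intros; apply pow2_ge_0]. }
lra.
Qed.

(** By [bessel] the sums of [|fourier g l| ^ 2] increase and stay bounded, hence converge, so their
    increments tend to 0. *)
Lemma riemann_lebesgue g :
  Ccont g ->
  forall eps, 0 < eps -> exists N, forall l, (N <= Z.abs l)%Z -> Cmod (fourier g l) < eps.
Proof.
intros Hg eps He.
pose proof two_PI_pos as hpi.
set (w := fun l => 2 * PI * Cmod (fourier g l) ^ 2).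
assert (Hw : forall l, 0 <= w l).
{ intro l; apply Rmult_le_pos; [lra|apply pow2_ge_0]. }
assert (Hc : ex_finite_lim_seq (real_symmetric_sum w)).
{ apply (ex_finite_lim_seq_incr _ (RInt (fun x => Cmod (g x) ^ 2) 0 (2 * PI))).
  - intro n; apply real_symmetric_sum_mono; [exact Hw|lia].
  - intro n; now apply bessel. }
destruct Hc as [L HL].
assert (H0 : is_lim_seq (fun n => real_symmetric_sum w (S n) - real_symmetric_sum w n) 0).
{ replace 0 with (L - L) by ring; apply is_lim_seq_minus'; [|exact HL].
  now apply -> is_lim_seq_incr_1. }
assert (He2 : 0 < 2 * PI * eps ^ 2) by (apply Rmult_lt_0_compat; [exact hpi|now apply pow_lt]).
apply is_lim_seq_spec in H0; destruct (H0 (mkposreal _ He2)) as [N HN].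
exists (Z.of_nat N + 1)%Z; intros l Hl.
specialize (HN (Z.to_nat (Z.abs l - 1)) ltac:(lia)); cbn [real_symmetric_sum pos] in HN.
rewrite Z2Nat.id in HN by lia.
replace (Z.abs l - 1 + 1)%Z with (Z.abs l) in HN by lia.
apply Rabs_lt_between in HN; destruct HN as [_ HN].
assert (Hl' : w l < 2 * PI * eps ^ 2).
{ pose proof (Hw (Z.abs l)); pose proof (Hw (- Z.abs l)%Z).
  destruct (Z.abs_eq_or_opp l) as [h|h]; [rewrite h in *; lra|].
  replace l with (- Z.abs l)%Z by lia; lra. }
unfold w in Hl'; apply Rmult_lt_reg_l in Hl'; [|exact hpi].
pose proof (Cmod_ge_0 (fourier g l)); nra.
Qed.

(** * Pointwise Fourier inversion *)

Lemma C_lim_plus (u v : nat -> C) (y z : C) :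
  filterlim u eventually (locally y) -> filterlim v eventually (locally z) ->
  filterlim (fun n => (u n + v n)%C) eventually (locally (y + z)%C).
Proof.
rewrite !filterlim_C_eps; intros Hu Hv eps He.
destruct (Hu (eps / 2)) as [N HN]; [lra|]; destruct (Hv (eps / 2)) as [M HM]; [lra|].
exists (N + M)%nat; intros n Hn; specialize (HN n ltac:(lia)); specialize (HM n ltac:(lia)).
replace (u n + v n - (y + z))%C with ((u n - y) + (v n - z))%C by ring.
eapply Rle_lt_trans; [apply Cmod_triangle|lra].
Qed.

Lemma C_lim_mult_l (u : nat -> C) (a z : C) :
  filterlim u eventually (locally z) ->
  filterlim (fun n => (a * u n)%C) eventually (locally (a * z)%C).
Proof.
rewrite !filterlim_C_eps; intros Hu eps He.
pose proof (Cmod_ge_0 a) as Ha.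
destruct (Hu (eps / (Cmod a + 1))) as [N HN]; [apply Rdiv_lt_0_compat; lra|].
exists N; intros n Hn; specialize (HN n Hn).
replace (a * u n - a * z)%C with (a * (u n - z))%C by ring.
rewrite Cmod_mult.
apply Rlt_div_r in HN; [|lra].
pose proof (Cmod_ge_0 (u n - z)); nra.
Qed.

Lemma C_lim_ext (u v : nat -> C) (z : C) :
  (forall n, u n = v n) ->
  filterlim u eventually (locally z) -> filterlim v eventually (locally z).
Proof. intros H; apply filterlim_ext; exact H. Qed.

Lemma continuous_difference_quotient (f : R -> R) (t a : R) :
  is_derive f t a ->
  continuous (fun y => if Req_EM_T y t then a else (f y - f t) / (y - t)) t.
Proof.
intros Hf; apply is_derive_Reals in Hf.
apply (filterlim_locally (U := R_UniformSpace)); intros eps.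
destruct (Hf eps (cond_pos eps)) as [d Hd].
exists d; intros y Hy.
change (Rabs (y - t) < d) in Hy.
change (Rabs ((if Req_EM_T y t then a else (f y - f t) / (y - t))
  - (if Req_EM_T t t then a else (f t - f t) / (t - t))) < eps).
destruct (Req_EM_T t t) as [_|h]; [|now contradict h].
destruct (Req_EM_T y t) as [h|h].
- rewrite Rminus_diag_eq, Rabs_R0 by reflexivity; apply cond_pos.
- specialize (Hd (y - t) ltac:(lra) Hy).
  now rewrite Rplus_minus in Hd.
Qed.

(** L'Hopital's rule at a simple zero of [s]: near [t] the quotient [f / s] is the ratio of the two
    difference quotients, both continuous at [t] once completed by the derivatives. *)
Lemma continuous_quotient_at_zero (f s q : R -> R) (t a b : R) :
  f t = 0 -> s t = 0 -> is_derive f t a -> is_derive s t b -> b <> 0 ->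
  (forall y, s y <> 0 -> q y = f y / s y) -> q t = a / b -> continuous q t.
Proof.
intros Hft Hst Hf Hs Hb Hq Hqt.
pose proof (continuous_difference_quotient f t a Hf) as HF.
pose proof (continuous_difference_quotient s t b Hs) as HS.
set (F := fun y => if Req_EM_T y t then a else (f y - f t) / (y - t)) in *.
set (S := fun y => if Req_EM_T y t then b else (s y - s t) / (y - t)) in *.
assert (HSt : S t = b) by (unfold S; destruct (Req_EM_T t t) as [_|h]; [reflexivity|now contradict h]).
assert (HFt : F t = a) by (unfold F; destruct (Req_EM_T t t) as [_|h]; [reflexivity|now contradict h]).
apply (continuous_ext_loc q (fun y => F y * / S y)).
- assert (HSnear : locally t (fun y => S y <> 0)).
  { assert (Hb' : 0 < Rabs b) by now apply Rabs_pos_lt.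
    apply (proj1 (filterlim_locally (U := R_UniformSpace) _ _)) with (eps := mkposreal _ Hb') in HS.
    revert HS; apply filter_imp; intros y Hy H0.
    change (Rabs (S y - S t) < Rabs b) in Hy.
    rewrite H0, HSt, Rminus_0_l, Rabs_Ropp in Hy; lra. }
  revert HSnear; apply filter_imp; intros y Hy.
  destruct (Req_dec y t) as [->|h]; [now rewrite HFt, HSt, Hqt|].
  revert Hy; unfold F, S; destruct (Req_EM_T y t) as [h'|_]; [contradiction|].
  rewrite Hst, Hft, !Rminus_0_r; intros Hy.
  assert (Hsy : s y <> 0) by (intro h'; apply Hy; rewrite h'; unfold Rdiv; ring).
  rewrite Hq by exact Hsy.
  change (f y / (y - t) * / (s y / (y - t)) = f y / s y :> R); field; split; [exact Hsy|lra].
- apply (continuous_mult (K := R_AbsRing) F (fun y => / S y)); [exact HF|].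
  apply (continuous_comp S Rinv); [exact HS|].
  apply continuity_pt_filterlim, continuity_pt_inv; [apply continuity_pt_id|].
  now rewrite HSt.
Qed.

Lemma periodic_zeros f t : real_periodic f -> sin (t / 2) = 0 -> f t = f 0.
Proof.
intros Hp Ht; destruct (sin_eq_0_0 _ Ht) as [k Hk].
replace t with (0 + 2 * PI * IZR k) by lra; clear t Ht Hk.
now apply real_periodic_IZR.
Qed.

Lemma division_by_sin_half f :
  real_periodic f -> cont_diff 1 f -> f 0 = 0 ->
  exists q, cont q /\ forall t, f t = q t * sin (t / 2).
Proof.
intros Hp [f' [Hf Hf']] H0.
(* At the zeros of [sin (t / 2)], where [f] vanishes by periodicity, the value is the one prescribed
   by l'Hopital's rule: the denominator has derivative [cos (t / 2) / 2]. *)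
set (q := fun t => if Req_EM_T (sin (t / 2)) 0 then 2 * f' t / cos (t / 2) else f t / sin (t / 2)).
exists q; split.
- intro t; destruct (Req_EM_T (sin (t / 2)) 0) as [h|h].
  + assert (hc : cos (t / 2) <> 0).
    { intro hc; pose proof (sin2_cos2 (t / 2)) as h1; rewrite h, hc in h1; unfold Rsqr in h1; lra. }
    apply (continuous_quotient_at_zero f (fun t => sin (t / 2)) q t (f' t) (cos (t / 2) / 2)).
    * rewrite <- H0; now apply periodic_zeros.
    * exact h.
    * apply Hf.
    * auto_derive; [exact I|unfold Rdiv; ring].
    * lra.
    * intros y Hy; unfold q; now destruct (Req_EM_T (sin (y / 2)) 0).
    * unfold q; destruct (Req_EM_T (sin (t / 2)) 0); [field; exact hc|contradiction].
  + assert (hs : cont (fun t => sin (t / 2))) by (unfold Rdiv; auto 10 with cont).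
    apply (continuous_ext_loc q (fun y => f y * / sin (y / 2))).
    * assert (Hb : 0 < Rabs (sin (t / 2))) by now apply Rabs_pos_lt.
      pose proof (proj1 (filterlim_locally (U := R_UniformSpace) _ _) (hs t) (mkposreal _ Hb)) as Hl.
      revert Hl; apply filter_imp; intros y Hy.
      change (Rabs (sin (y / 2) - sin (t / 2)) < Rabs (sin (t / 2))) in Hy.
      unfold q; destruct (Req_EM_T (sin (y / 2)) 0) as [h'|h']; [|reflexivity].
      rewrite h' in Hy; unfold Rminus in Hy; rewrite Rplus_0_l, Rabs_Ropp in Hy; lra.
    * apply (continuous_mult (K := R_AbsRing) f (fun y => / sin (y / 2))).
      { apply (cont_is_derive f f' Hf). }
      apply (continuous_comp (fun y => sin (y / 2)) Rinv); [apply hs|].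
      apply continuity_pt_filterlim, continuity_pt_inv; [apply continuity_pt_id|exact h].
- intro t; unfold q; destruct (Req_EM_T (sin (t / 2)) 0) as [h|h].
  + rewrite h, Rmult_0_r, <- H0; now apply periodic_zeros.
  + field; exact h.
Qed.

(* Chernoff's argument: dividing by [e^{it} - 1] turns the symmetric partial sum at 0
   into a telescoping sum of Fourier coefficients of a continuous function. *)
Lemma fourier_inversion_at_zero f :
  real_periodic f -> cont_diff 1 f -> f 0 = 0 ->
  filterlim (symmetric_sum (fourier (fun x => RtoC (f x)))) eventually (locally (RtoC 0)).
Proof.
intros Hp Hf H0.
destruct (division_by_sin_half f Hp Hf H0) as [q [Hq Hfq]].
(* Since [e^{it} - 1 = 2 i sin (t/2) e^{it/2}], this is [f / (e^{it} - 1)]; the pair [(0, - / 2)] is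
   [1 / (2 i)]. *)
set (g := fun t => (RtoC (q t) * (((0, - / 2)%R : C) * Cexpi (- t / 2)))%C).
assert (Hg : Ccont g).
{ unfold g, Rdiv; apply Ccont_mult; auto 10 with cont. }
assert (Hfg : forall t, RtoC (f t) = (g t * (Cexpi (IZR 1 * t) - RtoC 1))%C).
{ intro t; unfold g; rewrite Hfq.
  rewrite Rmult_1_l.
  replace t with (t / 2 + t / 2) at 5 by field.
  replace (- t / 2) with (- (t / 2)) by field.
  generalize (t / 2); intro y.
  assert (E : (Cexpi (y + y) - RtoC 1)%C = (((0, 2) : C) * RtoC (sin y) * Cexpi y)%C).
  { pose proof (sin2_cos2 y) as h; unfold Rsqr in h.
    unfold Cexpi; rewrite cos_plus, sin_plus; apply injective_projections; simpl; lra. }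
  rewrite E, RtoC_mult.
  transitivity (RtoC (q t) * RtoC (sin y) * (((0, - / 2)%R : C) * ((0, 2) : C)) * (Cexpi (- y) * Cexpi y))%C; [|ring].
  rewrite <- Cexpi_plus, Rplus_opp_l, Cexpi_0.
  apply injective_projections; simpl; field. }
assert (Hd : forall l, fourier (fun x => RtoC (f x)) l = (fourier g (l - 1) - fourier g l)%C).
{ intro l.
  assert (H1 : fourier g (l - 1) = fourier (fun x => (g x * Cexpi (IZR 1 * x))%C) l).
  { unfold fourier; f_equal; apply cint_ext; intro x.
    rewrite <- Cmult_assoc, <- Cexpi_plus; do 2 f_equal.
    rewrite !opp_IZR, minus_IZR; ring. }
  rewrite H1.
  replace (_ - _)%C with (fourier (fun x => (g x * Cexpi (IZR 1 * x))%C) l + (- RtoC 1) * fourier g l)%C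
    by ring.
  rewrite <- fourier_mult_l, <- fourier_plus by auto 10 with cont.
  unfold fourier; f_equal; apply cint_ext; intro x; f_equal; rewrite Hfg; ring. }
apply (C_lim_ext (fun n => (fourier g (- (Z.of_nat n + 1)) + (- RtoC 1) * fourier g (Z.of_nat n))%C)).
- intro n; induction n as [|n IH].
  + rewrite symmetric_sum_0, Hd; simpl; ring.
  + rewrite symmetric_sum_S, <- IH, !Hd.
    replace (Z.of_nat n + 1 - 1)%Z with (Z.of_nat n) by lia.
    replace (- (Z.of_nat n + 1) - 1)%Z with (- (Z.of_nat (S n) + 1))%Z by lia.
    replace (Z.of_nat (S n)) with (Z.of_nat n + 1)%Z by lia.
    ring.
- replace (RtoC 0) with (RtoC 0 + (- RtoC 1) * RtoC 0)%C by ring.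
  apply C_lim_plus; [|apply C_lim_mult_l]; apply filterlim_C_eps; intros eps He;
    destruct (riemann_lebesgue g Hg eps He) as [N HN]; exists (Z.to_nat (Z.abs N)); intros n Hn;
    unfold Cminus; rewrite Copp_0, Cplus_0_r; apply HN; lia.
Qed.

(** Reduction to a function vanishing at 0, namely [f (. + x) - f x]: the translation multiplies the
    coefficients by [e^{ilx}], and the constant changes only the one at [l = 0]. *)
Lemma fourier_inversion_real f x :
  real_test f ->
  filterlim (symmetric_sum (fun l => (fourier (fun y => RtoC (f y)) l * Cexpi (IZR l * x))%C))
    eventually (locally (RtoC (f x))).
Proof.
intros [Hp Hf].
pose proof (Hf O : cont f) as Hc.
set (h := fun y => f (y + x) + - f x).
assert (Hsh : cont (fun y => f (y + x))) by (apply (cont_comp (fun y => y + x) f); auto with cont).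
assert (Hh : filterlim (symmetric_sum (fourier (fun y => RtoC (h y)))) eventually (locally (RtoC 0))).
{ apply fourier_inversion_at_zero.
  - intro y; unfold h; f_equal; rewrite <- (Hp (y + x)); f_equal; ring.
  - apply cont_diff_plus; [|apply cont_diff_const].
    apply (cont_diff_comp 1 f (fun y => y + x)); [apply Hf|].
    exists (fun _ => 1); split; [intro; auto_derive; [exact I|ring]|apply cont_diff_const].
  - unfold h; rewrite Rplus_0_l; ring. }
assert (Hd : forall l, fourier (fun y => RtoC (h y)) l =
  (fourier (fun y => RtoC (f y)) l * Cexpi (IZR l * x)
   + if Z.eq_dec l 0 then RtoC (- f x) else RtoC 0)%C).
{ intro l.
  rewrite <- (fourier_const (RtoC (- f x)) l), Cmult_comm.
  rewrite <- (fourier_shift (fun y => RtoC (f y)) x l), <- fourier_plus by (auto with cont || intro; now rewrite Hp).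
  unfold fourier; f_equal; apply cint_ext; intro y; unfold h; now rewrite RtoC_plus. }
replace (RtoC (f x)) with (RtoC 0 + RtoC (f x))%C by ring.
apply (C_lim_ext (fun n => (symmetric_sum (fourier (fun y => RtoC (h y))) n + RtoC (f x))%C)).
- intro n.
  rewrite (symmetric_sum_ext _ _ n (fun l _ => Hd l)), symmetric_sum_plus.
  rewrite (symmetric_sum_single (fun l => if Z.eq_dec l 0 then RtoC (- f x) else RtoC 0) 0%Z n).
  + simpl; rewrite RtoC_opp; ring.
  + intros l Hl; destruct (Z.eq_dec l 0); [contradiction|reflexivity].
  + lia.
- apply C_lim_plus; [exact Hh|apply filterlim_const].
Qed.

Lemma fourier_inversion phi A x N :
  test_function phi -> 0 <= A -> (forall l, Cmod (fourier phi l) <= A / (1 + IZR l ^ 2)) ->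
  Cmod (phi x - symmetric_sum (fun l => (fourier phi l * Cexpi (IZR l * x))%C) N)
    <= 4 * A / (INR N + 1).
Proof.
intros Ht HA Hd.
pose proof (test_Ccont _ Ht) as Hc.
apply test_function_parts in Ht; destruct Ht as [H1 H2].
apply (Cmod_le_of_lim (symmetric_sum (fun l => (fourier phi l * Cexpi (IZR l * x))%C)) _ _ _ N).
- replace (phi x) with (RtoC (Re (phi x)) + Ci * RtoC (Im (phi x)))%C
    by (apply injective_projections; simpl; unfold Re, Im; ring).
  apply (C_lim_ext (fun n =>
    (symmetric_sum (fun l => (fourier (fun y => RtoC (Re (phi y))) l * Cexpi (IZR l * x))%C) n
    + Ci * symmetric_sum (fun l => (fourier (fun y => RtoC (Im (phi y))) l * Cexpi (IZR l * x))%C) n)%C)).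
  + intro n; rewrite <- symmetric_sum_mult_l, <- symmetric_sum_plus.
    apply symmetric_sum_ext; intros l _; rewrite (fourier_parts phi) by exact Hc; ring.
  + apply C_lim_plus; [|apply C_lim_mult_l].
    * apply (fourier_inversion_real (fun y => Re (phi y))), H1.
    * apply (fourier_inversion_real (fun y => Im (phi y))), H2.
- intros M HM; apply Cmod_symmetric_sum_tail; [|exact HA|exact HM].
  intro l; rewrite Cmod_mult, Cmod_Cexpi, Rmult_1_r; apply Hd.
Qed.

(** * The distribution as a functional on test functions *)

Lemma test_mult f g : test_function f -> test_function g -> test_function (fun x => (f x * g x)%C).
Proof.
rewrite !test_function_parts; intros [[h1 h2] [h3 h4]] [[h5 h6] [h7 h8]]; unfold real_periodic in *.
split; split; intro x; simpl.
- now rewrite h1, h3, h5, h7.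
- apply (cont_diff_minus x); apply cont_diff_mult; auto.
- now rewrite h1, h3, h5, h7.
- apply (cont_diff_plus x); apply cont_diff_mult; auto.
Qed.

Lemma test_Cexpi (m : Z) : test_function (fun x => Cexpi (IZR m * x)).
Proof.
rewrite test_function_parts; split; split.
- intro x; exact (f_equal Re (Cexpi_IZR_periodic m x)).
- intro n; simpl.
  replace (fun x => cos (IZR m * x)) with (fun x => cos (IZR m * x + 0))
    by (apply functional_extensionality; intro; now rewrite Rplus_0_r).
  apply cont_diff_sin_cos.
- intro x; exact (f_equal Im (Cexpi_IZR_periodic m x)).
- intro n; simpl.
  replace (fun x => sin (IZR m * x)) with (fun x => sin (IZR m * x + 0))
    by (apply functional_extensionality; intro; now rewrite Rplus_0_r).
  apply cont_diff_sin_cos.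
Qed.

Lemma test_circle_bump d y : test_function (fun x => RtoC (circle_bump d (x - y))).
Proof.
rewrite test_function_parts; split; split; simpl.
- intro x; rewrite <- (circle_bump_periodic d (x - y)); f_equal; ring.
- intro; apply cont_diff_circle_bump.
- now intro.
- intro; apply cont_diff_const.
Qed.

Lemma fourier_mult_Cexpi f m l :
  fourier (fun x => (f x * Cexpi (IZR m * x))%C) l = fourier f (l - m).
Proof.
unfold fourier; f_equal; apply cint_ext; intro x.
rewrite <- Cmult_assoc, <- Cexpi_plus; do 2 f_equal.
rewrite !opp_IZR, minus_IZR; ring.
Qed.

Lemma fourier_Cexpi m l :
  fourier (fun x => Cexpi (IZR m * x)) l = if Z.eq_dec l m then RtoC 1 else RtoC 0.
Proof.
transitivity (fourier (fun x => (RtoC 1 * Cexpi (IZR m * x))%C) l).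
- unfold fourier; f_equal; apply cint_ext; intro; now rewrite Cmult_1_l.
- rewrite (fourier_mult_Cexpi (fun _ => RtoC 1)), fourier_const.
  destruct (Z.eq_dec (l - m) 0), (Z.eq_dec l m); (reflexivity || lia).
Qed.

Lemma fourier_bump_shift d y l :
  fourier (fun x => RtoC (circle_bump d (x - y))) l =
  (fourier (fun x => RtoC (circle_bump d x)) l * Cexpi (IZR (- l) * y))%C.
Proof.
assert (Hc : cont (circle_bump d)).
{ replace (circle_bump d) with (fun x => circle_bump d (x - 0)).
  - apply (cont_diff_circle_bump 0).
  - apply functional_extensionality; intro; f_equal; ring. }
pose proof (fourier_shift (fun x => RtoC (circle_bump d x)) (- y) l) as H.
replace (IZR (- l) * y) with (IZR l * - y) by (rewrite opp_IZR; ring).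
rewrite Cmult_comm; apply H; [auto with cont|].
intro x; now rewrite circle_bump_periodic.
Qed.

Lemma C_lim_symmetric_sum (f : Z -> nat -> C) (z : Z -> C) N :
  (forall m, filterlim (f m) eventually (locally (z m))) ->
  filterlim (fun J => symmetric_sum (fun m => f m J) N) eventually (locally (symmetric_sum z N)).
Proof.
intros H; induction N as [|N IH].
- rewrite symmetric_sum_0; apply (C_lim_ext (f 0%Z)); [|apply H].
  intro; now rewrite symmetric_sum_0.
- rewrite symmetric_sum_S.
  eapply C_lim_ext; [intro J; symmetry; apply symmetric_sum_S|].
  apply C_lim_plus; [apply C_lim_plus; [exact IH|]|]; apply H.
Qed.

Definition pairing_sum (c : Z -> C) (phi : R -> C) : nat -> C :=
  symmetric_sum (fun l => (c l * (RtoC (2 * PI) * fourier phi (- l)))%C).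

(** Choice makes the pairing a total function of [phi]. [pairing_unique] identifies it as soon as a
    limit is known, and for bounded [c] a limit exists for every test function by
    [test_pairing_converges]. *)
Definition pairing (c : Z -> C) (phi : R -> C) : C :=
  epsilon (inhabits (RtoC 0)) (is_distr_pairing c phi).

Lemma is_distr_pairing_sum c phi z :
  Ccont phi ->
  is_distr_pairing c phi z <-> filterlim (pairing_sum c phi) eventually (locally z).
Proof.
intros H; unfold is_distr_pairing, pairing_sum.
assert (E : (fun l => (c l * RInt (V := C_R_CompleteNormedModule)
   (fun x => (Cexpi (IZR l * x) * phi x)%C) 0 (2 * PI))%C)
  = (fun l => (c l * (RtoC (2 * PI) * fourier phi (- l)))%C)).
{ apply functional_extensionality; intro l; rewrite RInt_cint by auto 10 with cont.
  now rewrite cint_eq_fourier. }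
rewrite E; reflexivity.
Qed.

Lemma pairing_unique c phi z : is_distr_pairing c phi z -> pairing c phi = z.
Proof.
intros H; unfold pairing.
pose proof (epsilon_spec (inhabits (RtoC 0)) _ (ex_intro _ z H)) as H'.
exact (C_lim_unique _ _ _ H' H).
Qed.

Lemma peetre (l m : R) : 1 + l ^ 2 <= 2 * (1 + (l + m) ^ 2) * (1 + m ^ 2).
Proof.
pose proof (pow2_ge_0 (l + 2 * m)); pose proof (pow2_ge_0 ((l + m) * m)).
replace (2 * (1 + (l + m) ^ 2) * (1 + m ^ 2))
  with (2 + 2 * (l + m) ^ 2 + 2 * m ^ 2 + 2 * ((l + m) * m) ^ 2) by ring.
nra.
Qed.

Lemma quadratic_shift_le A (l m : R) :
  0 <= A -> A / (1 + (l + m) ^ 2) <= 2 * A * (1 + m ^ 2) / (1 + l ^ 2).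
Proof.
intros HA; pose proof (peetre l m) as h.
pose proof (pow2_ge_0 l); pose proof (pow2_ge_0 (l + m)).
apply -> Rle_div_r; [|lra].
apply Rle_trans with (A / (1 + (l + m) ^ 2) * (2 * (1 + (l + m) ^ 2) * (1 + m ^ 2))).
- apply Rmult_le_compat_l; [apply Rle_mult_inv_pos; lra|exact h].
- apply Req_le; field; lra.
Qed.

(** * The pairing with a bounded sequence of coefficients *)

Section Pairing.

Variables (c : Z -> C) (B : R).
Hypothesis Hc : forall l, Cmod (c l) <= B.

Let HB : 0 <= B.
Proof. eapply Rle_trans; [apply Cmod_ge_0|apply (Hc 0%Z)]. Qed.

Lemma pairing_term_le phi A l :
  (forall l, Cmod (fourier phi l) <= A / (1 + IZR l ^ 2)) ->
  Cmod (c l * (RtoC (2 * PI) * fourier phi (- l)))%C <= 2 * PI * B * A / (1 + IZR l ^ 2).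
Proof.
intros H; specialize (H (- l)%Z).
rewrite opp_IZR in H; replace ((- IZR l) ^ 2) with (IZR l ^ 2) in H by ring.
rewrite !Cmod_mult, Cmod_R, Rabs_pos_eq by (pose proof two_PI_pos; lra).
pose proof two_PI_pos.
replace (2 * PI * B * A / (1 + IZR l ^ 2)) with (B * (2 * PI * (A / (1 + IZR l ^ 2)))) by (unfold Rdiv; ring).
apply Rmult_le_compat; [apply Cmod_ge_0| |apply Hc|].
- apply Rmult_le_pos; [lra|apply Cmod_ge_0].
- apply Rmult_le_compat_l; lra.
Qed.

Lemma pairing_sum_converges phi A :
  Ccont phi -> 0 <= A -> (forall l, Cmod (fourier phi l) <= A / (1 + IZR l ^ 2)) ->
  filterlim (pairing_sum c phi) eventually (locally (pairing c phi)).
Proof.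
intros Hphi HA H.
destruct (symmetric_sum_converges (fun l => (c l * (RtoC (2 * PI) * fourier phi (- l)))%C) (2 * PI * B * A))
  as [z Hz].
- intro l; now apply pairing_term_le.
- pose proof two_PI_pos; pose proof HB.
  apply Rmult_le_pos; [apply Rmult_le_pos; lra|exact HA].
- apply is_distr_pairing_sum; [exact Hphi|].
  apply (is_distr_pairing_sum c phi z Hphi) in Hz.
  now rewrite (pairing_unique c phi z Hz).
Qed.

Lemma test_fourier_decay2 phi :
  test_function phi -> exists A, 0 <= A /\ forall l, Cmod (fourier phi l) <= A / (1 + IZR l ^ 2).
Proof.
intros H; destruct (test_fourier_decay phi H) as [A [HA0 HA]]; exists A; split; [exact HA0|].
intro l; eapply Rle_trans; [apply HA|now apply quartic_le_quadratic].
Qed.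

Lemma test_pairing_converges phi :
  test_function phi -> filterlim (pairing_sum c phi) eventually (locally (pairing c phi)).
Proof.
intros H; destruct (test_fourier_decay2 phi H) as [A [HA0 HA]].
apply (pairing_sum_converges phi A); [now apply test_Ccont|exact HA0|exact HA].
Qed.

Lemma test_is_distr_pairing phi : test_function phi -> is_distr_pairing c phi (pairing c phi).
Proof.
intros H; apply is_distr_pairing_sum; [now apply test_Ccont|now apply test_pairing_converges].
Qed.

Lemma pairing_Cexpi m : pairing c (fun x => Cexpi (IZR m * x)) = (RtoC (2 * PI) * c (- m)%Z)%C.
Proof.
apply pairing_unique, is_distr_pairing_sum; [auto with cont|].
apply filterlim_C_eps; intros eps He; exists (Z.to_nat (Z.abs m)); intros n Hn.
unfold pairing_sum; rewrite (symmetric_sum_single _ (- m)%Z n).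
- rewrite Z.opp_involutive, fourier_Cexpi.
  destruct (Z.eq_dec m m) as [_|h]; [|now contradict h].
  replace (_ - _)%C with (RtoC 0) by ring; now rewrite Cmod_0.
- intros l Hl; rewrite fourier_Cexpi; destruct (Z.eq_dec (- l) m); [lia|ring].
- lia.
Qed.

Lemma pairing_eq0 phi : (forall x, phi x = RtoC 0) -> pairing c phi = RtoC 0.
Proof.
intros H.
assert (H0 : phi = fun _ => RtoC 0) by (apply functional_extensionality; exact H).
apply pairing_unique, is_distr_pairing_sum; [rewrite H0; auto with cont|].
apply filterlim_C_eps; intros eps He; exists O; intros n _.
unfold pairing_sum; rewrite symmetric_sum_eq0.
- unfold Cminus; now rewrite Cplus_opp_r, Cmod_0.
- intros l _; rewrite H0, fourier_const; destruct (Z.eq_dec (- l) 0); ring.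
Qed.

(** By Peetre's inequality, modulating [chi] by [e^{imx}] costs a factor [2 (1 + m ^ 2)] in the
    decay of its coefficients. The bound is uniform in the truncation [J], and its quadratic growth
    in [m] is weaker than the quartic decay of the coefficients of a test function. *)
Lemma pairing_sum_mult_Cexpi_le chi A :
  0 <= A -> (forall l, Cmod (fourier chi l) <= A / (1 + IZR l ^ 2)) ->
  forall m J, Cmod (pairing_sum c (fun x => (chi x * Cexpi (IZR m * x))%C) J)
    <= 20 * PI * B * A * (1 + IZR m ^ 2).
Proof.
intros HA H m J.
eapply Rle_trans; [apply Cmod_symmetric_sum|].
pose proof two_PI_pos; pose proof HB.
replace (20 * PI * B * A * (1 + IZR m ^ 2)) with (5 * (2 * PI * B * (2 * A * (1 + IZR m ^ 2)))) by ring.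
pose proof (pow2_ge_0 (IZR m)).
apply real_symmetric_sum_bound.
- intro l.
  apply (pairing_term_le _ (2 * A * (1 + IZR m ^ 2))).
  clear l; intro l; rewrite fourier_mult_Cexpi.
  eapply Rle_trans; [apply H|].
  pose proof (quadratic_shift_le A (IZR l) (- IZR m) HA) as h.
  rewrite minus_IZR; unfold Rminus.
  replace ((- IZR m) ^ 2) with (IZR m ^ 2) in h by ring; exact h.
- apply Rmult_le_pos; [apply Rmult_le_pos; lra|apply Rmult_le_pos; lra].
Qed.

Lemma fourier_symmetric_sum (f : Z -> R -> C) N l :
  (forall m, Ccont (f m)) ->
  fourier (fun x => symmetric_sum (fun m => f m x) N) l = symmetric_sum (fun m => fourier (f m) l) N.
Proof.
intros H; unfold fourier.
rewrite symmetric_sum_mult_l, <- cint_symmetric_sum by auto 10 with cont.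
f_equal; apply cint_ext; intro x.
rewrite Cmult_comm, <- symmetric_sum_mult_l.
apply symmetric_sum_ext; intros; ring.
Qed.

Lemma test_bounded phi : test_function phi -> exists A, 0 <= A /\ forall x, Cmod (phi x) <= A.
Proof.
intros H; apply test_function_parts in H; destruct H as [[h1 h2] [h3 h4]].
destruct (periodic_bounded _ (h2 O) h1) as [A HA], (periodic_bounded _ (h4 O) h3) as [A' HA'].
assert (h0 : 0 <= A) by (eapply Rle_trans; [apply Rabs_pos|apply (HA 0)]).
assert (h0' : 0 <= A') by (eapply Rle_trans; [apply Rabs_pos|apply (HA' 0)]).
exists (A + A'); split; [lra|]; intro x.
replace (phi x) with (RtoC (Re (phi x)) + Ci * RtoC (Im (phi x)))%C
  by (apply injective_projections; simpl; unfold Re, Im; ring).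
eapply Rle_trans; [apply Cmod_triangle|].
rewrite Cmod_mult, Cmod_Ci, !Cmod_R, Rmult_1_l.
apply Rplus_le_compat; auto.
Qed.

(** Expanding [phi] in its Fourier series inside the pairing exchanges two limits. For the pairing
    truncated at [J] the expansion is Fourier inversion in finitely many integrals; its tail beyond
    [M] is bounded uniformly in [J], so [J] may tend to infinity afterwards. The constant [D] does
    not depend on [phi], whose only trace is [A]. *)
Lemma pairing_expansion chi :
  test_function chi -> exists D, 0 <= D /\ forall phi A,
    test_function phi -> 0 <= A ->
    (forall l, Cmod (fourier phi l) <= A / (1 + IZR l ^ 2) ^ 2) ->
    forall M, Cmod (pairing c (fun x => (chi x * phi x)%C)
      - symmetric_sum (fun m => (fourier phi m * pairing c (fun x => (chi x * Cexpi (IZR m * x))%C))%C) M)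
      <= A * D / (INR M + 1).
Proof.
intros Hchi.
destruct (test_fourier_decay2 chi Hchi) as [A0 [HA0 HchiA]].
destruct (test_bounded chi Hchi) as [X [HX HchiX]].
pose proof (test_Ccont _ Hchi) as Hchic.
pose proof HB as HB'; pose proof two_PI_pos as Hpi.
set (D := 20 * PI * B * A0).
assert (HD : 0 <= D) by (unfold D; apply Rmult_le_pos; [apply Rmult_le_pos|]; lra).
exists (4 * D); split; [lra|].
intros phi A Hphi HA Hdec M.
pose proof (test_Ccont _ Hphi) as Hphic.
set (e := fun m x => (chi x * Cexpi (IZR m * x))%C).
assert (He : forall m, Ccont (e m)) by (intro; unfold e; auto 10 with cont).
assert (Hfin : forall J, Cmod (pairing_sum c (fun x => (chi x * phi x)%C) J
  - symmetric_sum (fun m => (fourier phi m * pairing_sum c (e m) J)%C) M) <= A * (4 * D) / (INR M + 1)).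
{ intro J.
  assert (Hlim : filterlim (symmetric_sum (fun m => (fourier phi m * pairing_sum c (e m) J)%C))
    eventually (locally (pairing_sum c (fun x => (chi x * phi x)%C) J))).
  { apply (C_lim_of_rate _ _ ((2 * INR J + 1) * (B * (2 * PI * (X * (4 * A)))))); intro M'.
    replace (symmetric_sum (fun m => (fourier phi m * pairing_sum c (e m) J)%C) M')
      with (pairing_sum c (fun x => (chi x * symmetric_sum (fun m => (fourier phi m * Cexpi (IZR m * x))%C) M')%C) J).
    - unfold pairing_sum; rewrite <- symmetric_sum_minus.
      eapply Rle_trans; [apply Cmod_symmetric_sum|].
      eapply Rle_trans; [apply (real_symmetric_sum_le _ (fun _ => B * (2 * PI * (X * (4 * A / (INR M' + 1))))))|].
      + intros l _.
        replace (_ - _)%C with (c l * (RtoC (2 * PI) * fourier (fun x => (chi x *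
          (symmetric_sum (fun m => (fourier phi m * Cexpi (IZR m * x))%C) M' - phi x))%C) (- l)))%C.
        * rewrite !Cmod_mult, Cmod_R, Rabs_pos_eq by lra.
          apply Rmult_le_compat; [apply Cmod_ge_0| |apply Hc|].
          { apply Rmult_le_pos; [lra|apply Cmod_ge_0]. }
          apply Rmult_le_compat_l; [lra|].
          apply Cmod_fourier_le; [auto 10 with cont|].
          intro x; rewrite Cmod_mult.
          apply Rmult_le_compat; [apply Cmod_ge_0|apply Cmod_ge_0|apply HchiX|].
          rewrite <- Cmod_opp, Copp_minus_distr.
          apply fourier_inversion; [exact Hphi|exact HA|].
          intro; eapply Rle_trans; [apply Hdec|now apply quartic_le_quadratic].
        * set (s := fun x => symmetric_sum (fun m => (fourier phi m * Cexpi (IZR m * x))%C) M').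
          assert (Hs : Ccont s) by (unfold s; auto 10 with cont).
          change (c l * (RtoC (2 * PI) * fourier (fun x => (chi x * (s x - phi x))%C) (- l))
            = c l * (RtoC (2 * PI) * fourier (fun x => (chi x * s x)%C) (- l))
              - c l * (RtoC (2 * PI) * fourier (fun x => (chi x * phi x)%C) (- l)))%C.
          assert (E : fourier (fun x => (chi x * s x)%C) (- l) =
            (fourier (fun x => (chi x * (s x - phi x))%C) (- l) + fourier (fun x => (chi x * phi x)%C) (- l))%C).
          { rewrite <- fourier_plus by auto 10 with cont.
            unfold fourier; f_equal; apply cint_ext; intro; ring. }
          rewrite E; ring.
      + rewrite real_symmetric_sum_const; apply Req_le; unfold Rdiv; ring.
    - unfold pairing_sum.
      transitivity (symmetric_sum (fun l => symmetric_sum (fun m =>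
        (fourier phi m * (c l * (RtoC (2 * PI) * fourier (e m) (- l))))%C) M') J).
      + apply symmetric_sum_ext; intros l _.
        transitivity (c l * (RtoC (2 * PI) * symmetric_sum (fun m => (fourier phi m * fourier (e m) (- l))%C) M'))%C.
        * do 2 f_equal.
          rewrite (symmetric_sum_ext _ (fun m => fourier (fun x => (fourier phi m * e m x)%C) (- l)))
            by (intros; now rewrite fourier_mult_l).
          rewrite <- fourier_symmetric_sum by auto 10 with cont.
          unfold fourier at 1 3; f_equal; apply cint_ext; intro x; f_equal.
          rewrite <- symmetric_sum_mult_l; apply symmetric_sum_ext; intros; unfold e; ring.
        * rewrite <- !symmetric_sum_mult_l; apply symmetric_sum_ext; intros; ring.
      + rewrite symmetric_sum_swap; apply symmetric_sum_ext; intros m _.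
        now rewrite symmetric_sum_mult_l. }
  apply (Cmod_le_of_lim _ _ _ _ M Hlim).
  intros M' HM'.
  replace (A * (4 * D)) with (4 * (A * D)) by ring.
  apply Cmod_symmetric_sum_tail; [|now apply Rmult_le_pos|exact HM'].
  intro m; rewrite Cmod_mult.
  pose proof (pairing_sum_mult_Cexpi_le chi A0 HA0 HchiA m J) as h; fold D in h.
  specialize (Hdec m).
  assert (hm : 0 < 1 + IZR m ^ 2) by (pose proof (pow2_ge_0 (IZR m)); lra).
  apply Rle_trans with (A / (1 + IZR m ^ 2) ^ 2 * (D * (1 + IZR m ^ 2))).
  - apply Rmult_le_compat; [apply Cmod_ge_0|apply Cmod_ge_0|exact Hdec|exact h].
  - apply Req_le; field; lra. }
(* Only now does [J] tend to infinity, with the order [M] of the sum over [m] fixed. *)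
apply (Cmod_le_of_lim (fun J => (pairing_sum c (fun x => (chi x * phi x)%C) J
  - symmetric_sum (fun m => (fourier phi m * pairing_sum c (e m) J)%C) M
  + symmetric_sum (fun m => (fourier phi m * pairing c (e m))%C) M)%C) _ _ _ O).
- assert (Hsum : filterlim (fun J => symmetric_sum (fun m => (fourier phi m * pairing_sum c (e m) J)%C) M)
    eventually (locally (symmetric_sum (fun m => (fourier phi m * pairing c (e m))%C) M))).
  { apply C_lim_symmetric_sum; intro m.
    apply C_lim_mult_l, test_pairing_converges, test_mult; [exact Hchi|apply test_Cexpi]. }
  pose proof (test_pairing_converges _ (test_mult _ _ Hchi Hphi)) as H1.
  pose proof (C_lim_plus _ _ _ _ H1 (C_lim_mult_l _ (- RtoC 1)%C _ Hsum)) as H2.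
  pose proof (C_lim_plus _ _ _ _ H2 (filterlim_const (F := eventually)
    (symmetric_sum (fun m => (fourier phi m * pairing c (e m))%C) M))) as H3.
  replace (pairing c (fun x => (chi x * phi x)%C)) with
    (pairing c (fun x => (chi x * phi x)%C) + - RtoC 1 * symmetric_sum (fun m => (fourier phi m * pairing c (e m))%C) M
      + symmetric_sum (fun m => (fourier phi m * pairing c (e m))%C) M)%C by ring.
  revert H3; apply C_lim_ext; intro J; ring.
- intros J _.
  eapply Rle_trans; [|apply (Hfin J)]; apply Req_le; f_equal; unfold e; ring.
Qed.

End Pairing.

(** * Mass of the bump *)

Lemma cont_circle_bump d : cont (circle_bump d).
Proof.
replace (circle_bump d) with (fun x => circle_bump d (x - 0)).
- apply (cont_diff_circle_bump 0).
- apply functional_extensionality; intro; f_equal; ring.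
Qed.
#[export] Hint Resolve cont_circle_bump : cont.

Lemma PI_gt_3 : 3 < PI.
Proof. pose proof PI2_3_2; lra. Qed.

Lemma RInt_circle_bump_le d :
  0 < d -> 4 * d <= PI -> RInt (circle_bump d) 0 (2 * PI) <= 8 * d.
Proof.
intros Hd Hd4.
pose proof PI_gt_3 as hpi.
rewrite <- (RInt_period_start _ (- PI)) by (auto with cont || apply circle_bump_periodic).
replace (- PI + 2 * PI) with PI by ring.
rewrite <- (RInt_Chasles_cont _ (- PI) (- (4 * d)) PI), <- (RInt_Chasles_cont _ (- (4 * d)) (4 * d) PI)
  by auto with cont.
assert (H0 : forall x, 4 * d <= Rabs x <= PI -> circle_bump d x = 0).
{ intros x Hx; apply circle_bump_eq0; [exact Hd|].
  pose proof (sin_half_ge x); lra. }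
assert (H1 : RInt (circle_bump d) (- PI) (- (4 * d)) <= 0).
{ eapply Rle_trans; [apply (RInt_le_cont _ (fun _ => 0)); auto with cont; try lra|].
  - intros x Hx; rewrite H0; [lra|]; rewrite Rabs_left by lra; lra.
  - rewrite RInt_const_R; lra. }
assert (H2 : RInt (circle_bump d) (4 * d) PI <= 0).
{ eapply Rle_trans; [apply (RInt_le_cont _ (fun _ => 0)); auto with cont; try lra|].
  - intros x Hx; rewrite H0; [lra|]; rewrite Rabs_pos_eq by lra; lra.
  - rewrite RInt_const_R; lra. }
assert (H3 : RInt (circle_bump d) (- (4 * d)) (4 * d) <= 8 * d).
{ eapply Rle_trans; [apply (RInt_le_cont _ (fun _ => 1)); auto with cont; try lra|].
  - intros x _; apply circle_bump_range.
  - rewrite RInt_const_R; lra. }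
lra.
Qed.

Lemma RInt_circle_bump_ge d : 0 < d <= 1 -> exp (-2) * d <= RInt (circle_bump d) 0 (2 * PI).
Proof.
intros Hd; pose proof PI_gt_3 as hpi.
rewrite <- (RInt_Chasles_cont _ 0 d (2 * PI)) by auto with cont.
assert (H1 : exp (-2) * d <= RInt (circle_bump d) 0 d).
{ eapply Rle_trans; [|apply (RInt_le_cont (fun _ => exp (-2)) (circle_bump d)); auto with cont; try lra].
  - rewrite RInt_const_R; lra.
  - intros x Hx; apply circle_bump_ge; [lra|].
    pose proof (sin_half_le x); rewrite (Rabs_pos_eq x) in *; lra. }
assert (H2 : 0 <= RInt (circle_bump d) d (2 * PI)).
{ apply RInt_nonneg_cont; [lra|auto with cont|intros; apply circle_bump_range]. }
lra.
Qed.

Lemma cos_ge_half y : Rabs y <= 1 -> / 2 <= cos y.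
Proof.
intros H; pose proof PI_gt_3.
assert (E : cos y = cos (Rabs y)).
{ unfold Rabs; destruct (Rcase_abs y); [now rewrite cos_neg|reflexivity]. }
rewrite E; replace (/ 2) with (1 / 2) by field; rewrite <- cos_PI3.
pose proof (Rabs_pos y).
apply cos_decr_1; lra.
Qed.

Definition bump_coef (d : R) (m : Z) : C := fourier (fun x => RtoC (circle_bump d x)) m.

(** The bump is nonzero only within [4 * d] of [2 PI Z], where [|m| d <= 1/4] keeps the phase [m x]
    within distance 1 of [2 PI Z] and hence its cosine above [1/2]. *)
Lemma bump_coef_Re_ge d m :
  0 < d <= 1 -> Rabs (IZR m) * d <= / 4 -> exp (-2) * d <= 4 * PI * Re (bump_coef d m).
Proof.
intros Hd Hm; pose proof two_PI_pos as hpi.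
assert (E : 2 * PI * Re (bump_coef d m) = RInt (fun x => circle_bump d x * cos (IZR m * x)) 0 (2 * PI)).
{ unfold bump_coef, fourier, cint; simpl.
  rewrite (RInt_ext (fun x => circle_bump d x * cos (IZR (- m) * x) - 0 * sin (IZR (- m) * x))
    (fun x => circle_bump d x * cos (IZR m * x))).
  - field; lra.
  - intros x _; rewrite opp_IZR, Ropp_mult_distr_l_reverse, cos_neg, Rmult_0_l; apply Rminus_0_r. }
assert (H : / 2 * RInt (circle_bump d) 0 (2 * PI)
  <= RInt (fun x => circle_bump d x * cos (IZR m * x)) 0 (2 * PI)).
{ rewrite <- RInt_scal_cont by auto with cont.
  apply RInt_le_cont; [lra|auto using cont_scal with cont|auto with cont|].
  intros x _; pose proof (circle_bump_range d x) as hb.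
  destruct (Rle_lt_dec d (Rabs (sin (x / 2)))) as [h|h].
  - rewrite circle_bump_eq0 by lra; lra.
  - destruct (near_period_of_sin_half_le x d) as [k Hk]; [lra|].
    assert (hc : / 2 <= cos (IZR m * x)).
    { rewrite <- (cos_shift_IZR (m * k)), mult_IZR.
      replace (IZR m * x + 2 * PI * (IZR m * IZR k)) with (IZR m * (x + 2 * PI * IZR k)) by ring.
      apply cos_ge_half; rewrite Rabs_mult.
      pose proof (Rabs_pos (IZR m)); nra. }
    nra. }
pose proof (RInt_circle_bump_ge d Hd); lra.
Qed.

Lemma bump_coef_le d m : 0 < d -> 4 * d <= PI -> Cmod (bump_coef d m) <= 2 * d.
Proof.
intros Hd Hd4; unfold bump_coef, fourier; pose proof PI_gt_3 as hpi.
rewrite Cmod_mult, Cmod_R, Rabs_inv, (Rabs_pos_eq (2 * PI)) by lra.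
assert (h : Cmod (cint (fun x => (RtoC (circle_bump d x) * Cexpi (IZR (- m) * x))%C)) <= 8 * d).
{ eapply Rle_trans; [|apply RInt_circle_bump_le; eassumption].
  apply Cmod_cint_le; auto with cont.
  intros x _; rewrite Cmod_mult, Cmod_Cexpi, Cmod_R, Rabs_pos_eq by apply circle_bump_range; lra. }
apply Rmult_le_reg_l with (2 * PI); [lra|].
rewrite <- Rmult_assoc, Rinv_r, Rmult_1_l by lra; nra.
Qed.

Lemma bump_coef_decay n :
  exists A, 0 <= A /\ forall d m, 0 < d <= 1 -> Rabs (IZR m) ^ n * Cmod (bump_coef d m) <= A / d ^ n.
Proof.
destruct (circle_bump_nth_derive n) as [A [HA H]]; exists A; split; [exact HA|].
intros d m Hd; apply fourier_decay_real; [apply circle_bump_periodic|now apply H].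
Qed.

Lemma bump_coef_energy d N :
  0 < d -> 4 * d <= PI -> real_symmetric_sum (fun m => Cmod (bump_coef d m) ^ 2) N <= 2 * d.
Proof.
intros Hd Hd4; pose proof PI_gt_3 as hpi.
pose proof (bessel (fun x => RtoC (circle_bump d x)) N ltac:(auto with cont)) as H.
rewrite real_symmetric_sum_scal in H.
assert (h : RInt (fun x => Cmod (RtoC (circle_bump d x)) ^ 2) 0 (2 * PI) <= 8 * d).
{ eapply Rle_trans; [|apply RInt_circle_bump_le; eassumption].
  apply RInt_le_cont; auto with cont; [lra|].
  intros x _; pose proof (circle_bump_range d x).
  rewrite Cmod_R, Rabs_pos_eq by lra; nra. }
fold (bump_coef d) in H.
apply Rmult_le_reg_l with (2 * PI); [lra|].
eapply Rle_trans; [exact H|]; nra.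
Qed.

(** * Local vanishing implies global vanishing *)

(** Discards the truncation errors: an estimate proved for partial sums of every order [M] passes to
    the limit. *)
Lemma le_0_of_le_div a A : (forall M : nat, a <= A / (INR M + 1)) -> a <= 0.
Proof.
intros H; destruct (Rle_dec a 0) as [h|h]; [exact h|exfalso].
assert (ha : 0 < a) by lra.
destruct (nfloor_ex (Rabs A / a)) as [N [_ HN]].
{ apply Rle_mult_inv_pos; [apply Rabs_pos|exact ha]. }
specialize (H N).
pose proof (pos_INR N).
assert (h1 : Rabs A / (INR N + 1) < a) by (apply Rdiv_lt_swap; lra).
assert (h2 : A / (INR N + 1) <= Rabs A / (INR N + 1)).
{ apply Rmult_le_compat_r; [apply Rlt_le, Rinv_0_lt_compat; lra|apply Rle_abs]. }
lra.
Qed.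

Lemma Cmod_le_0 z : Cmod z <= 0 -> z = RtoC 0.
Proof. intros H; apply Cmod_eq_0; pose proof (Cmod_ge_0 z); lra. Qed.

Definition exp_poly (a : Z -> C) (N : nat) (x : R) : C :=
  symmetric_sum (fun m => (a m * Cexpi (IZR (- m) * x))%C) N.

Lemma Ccont_exp_poly a N : Ccont (exp_poly a N).
Proof. unfold exp_poly; auto 10 with cont. Qed.
#[export] Hint Resolve Ccont_exp_poly : cont.

Lemma cint_exp_poly_Cexpi a N k :
  (Z.abs k <= Z.of_nat N)%Z ->
  cint (fun x => (exp_poly a N x * Cexpi (IZR k * x))%C) = (RtoC (2 * PI) * a k)%C.
Proof.
intros Hk.
transitivity (cint (fun x => symmetric_sum (fun m => (a m * Cexpi (IZR (k - m) * x))%C) N)).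
- apply cint_ext; intro x; unfold exp_poly.
  rewrite Cmult_comm, <- symmetric_sum_mult_l; apply symmetric_sum_ext; intros m _.
  replace (IZR (k - m) * x) with (IZR (- m) * x + IZR k * x) by (rewrite minus_IZR, opp_IZR; ring).
  rewrite Cexpi_plus; ring.
- rewrite (cint_symmetric_sum (fun m x => (a m * Cexpi (IZR (k - m) * x))%C)) by auto with cont.
  rewrite (symmetric_sum_single _ k).
  + rewrite cint_mult_l, Z.sub_diag, cint_Cexpi_0 by auto with cont; ring.
  + intros l Hl; rewrite cint_mult_l, cint_Cexpi_neq0 by (auto with cont || lia); ring.
  + exact Hk.
Qed.

(** This is [2 PI] times the Fourier coefficient of [chi T] at frequency [- m], as [pairing_Cexpi]
    shows for [chi = 1]; hence the minus sign in the exponent of [exp_poly], and the factors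
    [2 * PI] in comparisons with [trig_partial_sum]. *)
Definition localized_coef (c : Z -> C) (chi : R -> C) (m : Z) : C :=
  pairing c (fun x => (chi x * Cexpi (IZR m * x))%C).

(* The pairings with [phi * circle_bump d (. - x)] are the values at [x] of a trigonometric
   series whose constant term is a positive multiple of the pairing with [phi]. *)
Lemma bump_pairing_series c B phi d :
  (forall l, Cmod (c l) <= B) -> test_function phi ->
  exists A, 0 <= A /\ forall M x,
    Cmod (pairing c (fun y => (phi y * RtoC (circle_bump d (y - x)))%C)
      - exp_poly (fun m => (bump_coef d m * localized_coef c phi m)%C) M x) <= A / (INR M + 1).
Proof.
intros Hc Hphi.
destruct (pairing_expansion c B Hc phi Hphi) as [D [HD HDexp]].
destruct (test_fourier_decay _ (test_circle_bump d 0)) as [A [HA0 HA]].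
exists (A * D); split; [now apply Rmult_le_pos|]; intros M x.
assert (hdec : forall l, Cmod (fourier (fun y => RtoC (circle_bump d (y - x))) l) <= A / (1 + IZR l ^ 2) ^ 2).
{ intro l; specialize (HA l); rewrite fourier_bump_shift, Rmult_0_r, Cexpi_0, Cmult_1_r in HA.
  rewrite fourier_bump_shift, Cmod_mult, Cmod_Cexpi, Rmult_1_r; exact HA. }
eapply Rle_trans; [|exact (HDexp _ A (test_circle_bump d x) HA0 hdec M)].
apply Req_le; do 2 f_equal; apply symmetric_sum_ext; intros m _.
rewrite fourier_bump_shift; fold (bump_coef d m); unfold localized_coef; ring.
Qed.

(** Averaging over translates of one bump takes the place of a partition of unity. If all localized
    pairings vanish, the trigonometric series in the center [x] is zero, and integrating it over a
    period isolates the constant term: the mean of the bump, which is nonzero, times the pairing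
    with [phi]. *)
Lemma pairing_eq0_of_bumps c B phi d :
  (forall l, Cmod (c l) <= B) -> test_function phi -> 0 < d <= 1 ->
  (forall x, 0 <= x <= 2 * PI ->
    pairing c (fun y => (phi y * RtoC (circle_bump d (y - x)))%C) = RtoC 0) ->
  pairing c phi = RtoC 0.
Proof.
intros Hc Hphi Hd H.
pose proof two_PI_pos as hpi.
destruct (bump_pairing_series c B phi d Hc Hphi) as [A [HA0 HA]].
set (p := localized_coef c phi) in *.
set (S := exp_poly (fun m => (bump_coef d m * p m)%C)) in *.
assert (HS : forall M x, 0 <= x <= 2 * PI -> Cmod (S M x) <= A / (INR M + 1)).
{ intros M x Hx; specialize (HA M x); rewrite H in HA by exact Hx.
  rewrite <- Cmod_opp; eapply Rle_trans; [|exact HA]; apply Req_le; f_equal; ring. }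
assert (H0 : (bump_coef d 0 * p 0%Z)%C = RtoC 0).
{ apply Cmod_le_0, (le_0_of_le_div _ A); intro M.
  apply Rmult_le_reg_l with (2 * PI); [exact hpi|].
  assert (h : Cmod (cint (fun x => (S M x * Cexpi (IZR 0 * x))%C)) <= RInt (fun _ => A / (INR M + 1)) 0 (2 * PI)).
  { apply Cmod_cint_le; [unfold S; auto 10 with cont|auto with cont|].
    intros x Hx; rewrite Cmod_mult, Cmod_Cexpi, Rmult_1_r; now apply HS. }
  unfold S in h; rewrite cint_exp_poly_Cexpi, RInt_const_R, Cmod_mult, Cmod_R, Rabs_pos_eq in h by (lra || lia); lra. }
assert (Hb : bump_coef d 0 <> RtoC 0).
{ intro h; pose proof (bump_coef_Re_ge d 0 Hd) as h'.
  rewrite Rabs_R0, Rmult_0_l, h in h'; simpl in h'.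
  pose proof (exp_pos (-2)); specialize (h' ltac:(lra)); nra. }
assert (Hp : p 0%Z = RtoC 0).
{ apply NNPP; intro h; exact (Cmult_neq_0 _ _ Hb h H0). }
rewrite <- Hp; unfold p, localized_coef; f_equal; apply functional_extensionality; intro x.
now rewrite Rmult_0_l, Cexpi_0, Cmult_1_r.
Qed.

Lemma sin_lipschitz a b : Rabs (sin a - sin b) <= Rabs (a - b).
Proof.
rewrite form4, !Rabs_mult, (Rabs_pos_eq 2) by lra.
pose proof (sin_half_le (a - b)).
assert (h : Rabs (cos ((a + b) / 2)) <= 1) by apply Rabs_le, COS_bound.
pose proof (Rabs_pos (sin ((a - b) / 2))); pose proof (Rabs_pos (cos ((a + b) / 2))); nra.
Qed.

(** The product vanishes where [|sin| >= d], and the sine is Lipschitz, so this persists near any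
    point where [|sin| > d]; passing to the closure only turns [< d] into [<= d]. *)
Lemma fun_support_bump f d x y :
  0 < d -> fun_support (fun z => (f z * RtoC (circle_bump d (z - x)))%C) y ->
  Rabs (sin ((y - x) / 2)) <= d.
Proof.
intros Hd H; apply Rnot_lt_le; intro h.
assert (He : 0 < Rabs (sin ((y - x) / 2)) - d) by lra.
destruct (H (mkposreal _ He)) as [z [Hz Hfz]].
change (Rabs (z - y) < Rabs (sin ((y - x) / 2)) - d) in Hz.
apply Hfz; rewrite circle_bump_eq0; [ring|exact Hd|].
pose proof (sin_lipschitz ((y - x) / 2) ((z - x) / 2)) as h1.
replace ((y - x) / 2 - (z - x) / 2) with (- ((z - y) / 2)) in h1 by field.
rewrite Rabs_Ropp in h1; unfold Rdiv in h1 at 3; rewrite Rabs_mult, (Rabs_pos_eq (/ 2)) in h1 by lra.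
pose proof (Rabs_triang_inv (sin ((y - x) / 2)) (sin ((z - x) / 2))).
pose proof (Rabs_pos (z - y)); lra.
Qed.

Lemma periodic_set_IZR (U : R -> Prop) (k : Z) x : periodic_set U -> U (x + 2 * PI * IZR k) <-> U x.
Proof.
intros HU.
assert (Hn : forall (n : nat) y, U (y + 2 * PI * INR n) <-> U y).
{ induction n as [|n IH]; intro y; [simpl; now rewrite Rmult_0_r, Rplus_0_r|].
  rewrite <- (IH y), <- (HU (y + 2 * PI * INR n)), S_INR.
  replace (y + 2 * PI * (INR n + 1)) with (y + 2 * PI * INR n + 2 * PI) by ring; reflexivity. }
destruct (Z_le_gt_dec 0 k) as [h|h].
- replace k with (Z.of_nat (Z.to_nat k)) by lia; rewrite <- INR_IZR_INZ; apply Hn.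
- rewrite <- (Hn (Z.to_nat (- k)) (x + _)).
  rewrite INR_IZR_INZ, Z2Nat.id, opp_IZR by lia.
  replace (x + 2 * PI * IZR k + 2 * PI * - IZR k) with x by ring; reflexivity.
Qed.

Lemma distr_support_IZR c (k : Z) x : distr_support c x -> distr_support c (x + 2 * PI * IZR k).
Proof.
intros H [U [H1 [H2 [H3 H4]]]]; apply H; exists U.
apply (periodic_set_IZR U k x H2) in H4; auto.
Qed.

Lemma period_representative x : exists k : Z, 0 <= x + 2 * PI * IZR k <= 2 * PI.
Proof.
destruct (period_reduce (x - PI)) as [k Hk]; exists k.
apply Rabs_le_between in Hk; lra.
Qed.

(** Every point of the circle has a neighbourhood on which [phi] is zero or the distribution
    vanishes. By compactness a single bump radius fits all of them, and [pairing_eq0_of_bumps]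
    glues. *)
Lemma pairing_eq0_off_support c B phi :
  (forall l, Cmod (c l) <= B) -> test_function phi ->
  (forall y, fun_support phi y -> ~ distr_support c y) -> pairing c phi = RtoC 0.
Proof.
intros Hc Hphi H.
pose proof PI_gt_3 as hpi.
assert (Hloc : forall t, exists rho : posreal,
  (forall y, Rabs (y - t) < 2 * rho -> phi y = RtoC 0) \/
  exists U, open U /\ periodic_set U /\ distr_vanishes_on c U /\
    forall y, Rabs (y - t) < 2 * rho -> U y).
{ intro t; destruct (classic (fun_support phi t)) as [h|h].
  - specialize (H t h); apply NNPP in H; destruct H as [U [H1 [H2 [H3 H4]]]].
    destruct (H1 t H4) as [eps Heps].
    exists (pos_div_2 eps); right; exists U.
    split; [exact H1|split; [exact H2|split; [exact H3|]]].
    intros y Hy; apply Heps; change (Rabs (y - t) < eps); simpl in Hy; lra.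
  - apply not_all_ex_not in h; destruct h as [eps Heps].
    exists (pos_div_2 eps); left; intros y Hy.
    apply NNPP; intro hy; apply Heps; exists y; split; [|exact hy].
    change (Rabs (y - t) < eps); simpl in Hy; lra. }
pose (delta := fun t => proj1_sig (constructive_indefinite_description _ (Hloc t))).
assert (Hdelta : forall t, (forall y, Rabs (y - t) < 2 * delta t -> phi y = RtoC 0) \/
  exists U, open U /\ periodic_set U /\ distr_vanishes_on c U /\
    forall y, Rabs (y - t) < 2 * delta t -> U y).
{ intro t; exact (proj2_sig (constructive_indefinite_description _ (Hloc t))). }
(* A Lebesgue number: each [x] is within [delta t] of some [t] with [r <= delta t], so a bump of
   reach [4 * d < r] around [x] stays within [2 * delta t] of [t]. This is why [Hloc] works with
   twice the radius. *)
destruct (compactness_value_1d 0 (2 * PI) delta) as [r Hr].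
pose proof (cond_pos r) as hr.
set (d := Rmin 1 (r / 8)).
assert (Hd : 0 < d <= 1) by (unfold d, Rmin; destruct (Rle_dec 1 (r / 8)); lra).
assert (Hdr : 4 * d < r) by (unfold d, Rmin; destruct (Rle_dec 1 (r / 8)); lra).
apply (pairing_eq0_of_bumps c B phi d Hc Hphi Hd).
intros x Hx.
destruct (NNPP _ (Hr x Hx)) as [t [_ [Hxt Hrt]]].
destruct (Hdelta t) as [h|[U [H1 [H2 [H3 H4]]]]].
- apply pairing_eq0; intro y.
  destruct (Rle_lt_dec d (Rabs (sin ((y - x) / 2)))) as [h'|h'].
  + rewrite circle_bump_eq0; [ring|lra|exact h'].
  + destruct (near_period_of_sin_half_le (y - x) d) as [k Hk]; [lra|].
    assert (E : phi y = RtoC 0).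
    { destruct Hphi as [Hp _].
      rewrite <- (h (y + 2 * PI * IZR k)).
      - symmetry; apply injective_projections.
        + apply (real_periodic_IZR (fun x => fst (phi x))); intro z; now rewrite Hp.
        + apply (real_periodic_IZR (fun x => snd (phi x))); intro z; now rewrite Hp.
      - replace (y + 2 * PI * IZR k - t) with ((y - x + 2 * PI * IZR k) + (x - t)) by ring.
        eapply Rle_lt_trans; [apply Rabs_triang|lra]. }
    rewrite E; ring.
- apply pairing_unique, H3; [apply test_mult; [exact Hphi|apply test_circle_bump]|].
  intros y Hy; apply fun_support_bump in Hy; [|lra].
  destruct (near_period_of_sin_half_le (y - x) d) as [k Hk]; [lra|].
  apply (periodic_set_IZR U k y H2), H4.
  replace (y + 2 * PI * IZR k - t) with ((y - x + 2 * PI * IZR k) + (x - t)) by ring.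
  eapply Rle_lt_trans; [apply Rabs_triang|lra].
Qed.

(** * Localization *)

Lemma nested_intervals (a b : nat -> R) :
  (forall n, a n <= a (S n)) -> (forall n, b (S n) <= b n) -> (forall n, a n <= b n) ->
  exists z, forall n, a n <= z <= b n.
Proof.
intros Ha Hb Hab.
assert (Hai : forall n m, (n <= m)%nat -> a n <= a m).
{ induction 1 as [|m _ IH]; [lra|]; specialize (Ha m); lra. }
assert (Hbi : forall n m, (n <= m)%nat -> b m <= b n).
{ induction 1 as [|m _ IH]; [lra|]; specialize (Hb m); lra. }
destruct (completeness (fun x => exists n, x = a n)) as [z [Hz1 Hz2]].
- exists (b O); intros x [n ->]; specialize (Hab n); specialize (Hbi O n ltac:(lia)); lra.
- now exists (a O), O.
- exists z; intro n; split.
  + apply Hz1; now exists n.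
  + apply Hz2; intros x [m ->].
    specialize (Hab (n + m)%nat); specialize (Hbi n (n + m)%nat ltac:(lia));
      specialize (Hai m (n + m)%nat ltac:(lia)); lra.
Qed.

(* A Baire category argument. *)
Lemma pointwise_bounded_locally_bounded (u : nat -> R -> R) (K : R -> Prop) p0 :
  (forall k, cont (u k)) -> (forall x, exists A, forall k, u k x <= A) -> K p0 ->
  exists p r A, K p /\ 0 < r /\ forall x, K x -> Rabs (x - p) < r -> forall k, u k x <= A.
Proof.
intros Hu Hb Hp0; apply NNPP; intro Hno.
(* A state is a ball centered in [K]. The step [n] passes to a closed ball inside it on which some
   [u k] exceeds [n], which is possible because no such ball carries a uniform bound on [K]. *)
set (ST := {s : R * R | K (fst s) /\ 0 < snd s}).
assert (Hstep : forall (n : nat) (s : ST), exists s' : ST,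
  Rabs (fst (proj1_sig s') - fst (proj1_sig s)) + snd (proj1_sig s') <= snd (proj1_sig s) /\
  exists k, forall y, Rabs (y - fst (proj1_sig s')) <= snd (proj1_sig s') -> INR n < u k y).
{ intros n [[p r] [Hp Hr]]; simpl in *.
  assert (h : exists x k, K x /\ Rabs (x - p) < r /\ INR n < u k x).
  { apply NNPP; intro h; apply Hno; exists p, r, (INR n); repeat split; auto.
    intros x Hx Hxr k; apply Rnot_lt_le; intro h'; apply h; now exists x, k. }
  destruct h as [x [k [Hx [Hxr Hk]]]].
  assert (He : 0 < u k x - INR n) by lra.
  destruct (proj1 (filterlim_locally (U := R_UniformSpace) _ _) (Hu k x) (mkposreal _ He)) as [e He'].
  pose proof (cond_pos e) as hep.
  set (r' := Rmin (r - Rabs (x - p)) (e / 2)).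
  assert (Hr' : 0 < r' /\ r' <= r - Rabs (x - p) /\ r' < e).
  { unfold r', Rmin; destruct (Rle_dec (r - Rabs (x - p)) (e / 2)); lra. }
  exists (exist _ (x, r') (conj Hx (proj1 Hr'))); simpl; split; [lra|].
  exists k; intros y Hy.
  assert (h : Rabs (u k y - u k x) < u k x - INR n).
  { apply (He' y); change (Rabs (y - x) < e); lra. }
  apply Rabs_lt_between in h; lra. }
pose (next := fun n s => proj1_sig (constructive_indefinite_description _ (Hstep n s))).
assert (Hnext : forall n s, Rabs (fst (proj1_sig (next n s)) - fst (proj1_sig s)) + snd (proj1_sig (next n s))
    <= snd (proj1_sig s) /\
  exists k, forall y, Rabs (y - fst (proj1_sig (next n s))) <= snd (proj1_sig (next n s)) -> INR n < u k y).
{ intros n s; exact (proj2_sig (constructive_indefinite_description _ (Hstep n s))). }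
pose (s0 := exist _ (p0, 1) (conj Hp0 Rlt_0_1) : ST).
pose (s := fix s n := match n with O => s0 | S n' => next n' (s n') end).
destruct (nested_intervals (fun n => fst (proj1_sig (s n)) - snd (proj1_sig (s n)))
  (fun n => fst (proj1_sig (s n)) + snd (proj1_sig (s n)))) as [z Hz].
- intro n; simpl; destruct (Hnext n (s n)) as [h _].
  pose proof (Rle_abs (- (fst (proj1_sig (next n (s n))) - fst (proj1_sig (s n))))) as h'.
  rewrite Rabs_Ropp in h'; lra.
- intro n; simpl; destruct (Hnext n (s n)) as [h _].
  pose proof (Rle_abs (fst (proj1_sig (next n (s n))) - fst (proj1_sig (s n)))); lra.
- intro n; destruct (proj2_sig (s n)) as [_ h]; lra.
(* The common point of the balls violates the pointwise bound. *)
- destruct (Hb z) as [A HA].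
  destruct (nfloor_ex (Rabs A) (Rabs_pos A)) as [n [_ Hn]].
  destruct (Hnext (S n) (s (S n))) as [_ [k Hk]].
  specialize (Hz (S (S n))); simpl in Hz.
  specialize (Hk z); specialize (HA k).
  rewrite S_INR in Hk.
  pose proof (Rle_abs A).
  assert (h : INR n + 1 < u k z) by (apply Hk, Rabs_le_between'; simpl; lra).
  lra.
Qed.

Lemma test_ext_pairing c f g : (forall x, f x = g x) -> pairing c f = pairing c g.
Proof. intros H; f_equal; now apply functional_extensionality. Qed.

Lemma pairing_mult_eq0 c B chi phi :
  (forall l, Cmod (c l) <= B) -> test_function chi -> test_function phi ->
  (forall m, pairing c (fun x => (chi x * Cexpi (IZR m * x))%C) = RtoC 0) ->
  pairing c (fun x => (chi x * phi x)%C) = RtoC 0.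
Proof.
intros Hc Hchi Hphi H.
destruct (pairing_expansion c B Hc chi Hchi) as [D [HD HDexp]].
destruct (test_fourier_decay _ Hphi) as [A [HA0 HA]].
apply Cmod_le_0, (le_0_of_le_div _ (A * D)); intro M.
specialize (HDexp phi A Hphi HA0 HA M).
rewrite symmetric_sum_eq0 in HDexp by (intros m _; rewrite H; ring).
eapply Rle_trans; [|exact HDexp]; apply Req_le; f_equal; ring.
Qed.

(** Otherwise all coefficients of all bumps near [p] vanish, hence so do all pairings with a bump
    times a test function, and [pairing_eq0_of_bumps] shows that the distribution vanishes near [p],
    which then lies outside the support. *)
Lemma exists_nonzero_localization c B p r :
  (forall l, Cmod (c l) <= B) -> distr_support c p -> 0 < r ->
  exists d x0 m, 0 < d /\ 4 * d + Rabs (x0 - p) < r /\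
    pairing c (fun x => (RtoC (circle_bump d (x - x0)) * Cexpi (IZR m * x))%C) <> RtoC 0.
Proof.
intros Hc Hp Hr; apply NNPP; intro Hno; apply Hp.
(* Then [4 * d < r / 4]: a bump that meets the [r / 4]-neighbourhood of [p] is centered within
   [r / 2] of it, and [4 * d + r / 2 < r]. *)
set (d := Rmin 1 (r / 17)).
assert (Hd : 0 < d <= 1 /\ 17 * d <= r) by (unfold d, Rmin; destruct (Rle_dec 1 (r / 17)); lra).
exists (fun y => exists k : Z, Rabs (y + 2 * PI * IZR k - p) < r / 4); split; [|split; [|split]].
- intros y [k Hk].
  assert (He : 0 < r / 4 - Rabs (y + 2 * PI * IZR k - p)) by lra.
  exists (mkposreal _ He); intros z Hz; exists k.
  change (Rabs (z - y) < r / 4 - Rabs (y + 2 * PI * IZR k - p)) in Hz.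
  apply Rle_lt_trans with (Rabs (z - y) + Rabs (y + 2 * PI * IZR k - p)); [|lra].
  eapply Rle_trans; [|apply Rabs_triang]; apply Req_le; f_equal.
  change (z + 2 * PI * IZR k - p = z - y + (y + 2 * PI * IZR k - p) :> R); ring.
- intro y; split; intros [k Hk].
  + exists (k + 1)%Z; rewrite plus_IZR.
    now replace (y + 2 * PI * (IZR k + 1) - p) with (y + 2 * PI + 2 * PI * IZR k - p) by ring.
  + exists (k - 1)%Z; rewrite minus_IZR.
    now replace (y + 2 * PI + 2 * PI * (IZR k - 1) - p) with (y + 2 * PI * IZR k - p) by ring.
- intros phi Hphi Hsupp.
  assert (E : pairing c phi = RtoC 0).
  { apply (pairing_eq0_of_bumps c B phi d Hc Hphi (proj1 Hd)).
    intros x _.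
    destruct (classic (exists k : Z, Rabs (x + 2 * PI * IZR k - p) < r / 2)) as [[k Hk]|h].
    - rewrite (test_ext_pairing c _ (fun y => (RtoC (circle_bump d (y - (x + 2 * PI * IZR k))) * phi y)%C)).
      + apply (pairing_mult_eq0 c B); [exact Hc|apply test_circle_bump|exact Hphi|].
        intro m; apply NNPP; intro h; apply Hno.
        exists d, (x + 2 * PI * IZR k), m; repeat split; [lra|lra|exact h].
      + intro y; rewrite Cmult_comm; do 2 f_equal.
        rewrite <- (real_periodic_IZR (circle_bump d) k (y - (x + 2 * PI * IZR k)) (circle_bump_periodic d)).
        f_equal; ring.
    - apply pairing_eq0; intro y; apply NNPP; intro hy.
      assert (hphi : phi y <> RtoC 0) by (intro h'; apply hy; rewrite h'; ring).
      destruct (Hsupp y) as [k Hk].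
      { intro eps; exists y; split; [apply ball_center|exact hphi]. }
      destruct (Rle_lt_dec d (Rabs (sin ((y - x) / 2)))) as [h'|h'].
      { apply hy; rewrite circle_bump_eq0; [ring|lra|exact h']. }
      destruct (near_period_of_sin_half_le (y - x) d) as [j Hj]; [lra|].
      apply h; exists (k - j)%Z; rewrite minus_IZR.
      replace (x + 2 * PI * (IZR k - IZR j) - p)
        with ((y + 2 * PI * IZR k - p) - (y - x + 2 * PI * IZR j)) by ring.
      unfold Rminus at 1; eapply Rle_lt_trans; [apply Rabs_triang|].
      rewrite Rabs_Ropp; lra. }
  rewrite <- E; now apply (test_is_distr_pairing c B).
- exists 0%Z; rewrite Rmult_0_r, Rplus_0_r, Rminus_diag_eq, Rabs_R0 by reflexivity; lra.
Qed.

(** [pairing_expansion] with the roles exchanged: the character is the fixed factor and [chi] is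
    expanded. The outcome is the convolution of the coefficients of [chi] with those of the
    distribution. *)
Lemma localized_coef_limit c B chi m :
  (forall l, Cmod (c l) <= B) -> test_function chi ->
  filterlim (symmetric_sum (fun j => (fourier chi j * (RtoC (2 * PI) * c (- m - j)%Z))%C))
    eventually (locally (localized_coef c chi m)).
Proof.
intros Hc Hchi.
destruct (pairing_expansion c B Hc _ (test_Cexpi m)) as [D [HD HDexp]].
destruct (test_fourier_decay _ Hchi) as [A [HA0 HA]].
apply (C_lim_of_rate _ _ (A * D)); intro M.
specialize (HDexp chi A Hchi HA0 HA M).
rewrite <- Cmod_opp, Copp_minus_distr.
eapply Rle_trans; [|exact HDexp]; apply Req_le; do 2 f_equal.
- apply test_ext_pairing; intro; ring.
- apply symmetric_sum_ext; intros j _; f_equal.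
  replace (- m - j)%Z with (- (m + j))%Z by lia.
  rewrite <- (pairing_Cexpi c); apply test_ext_pairing; intro x.
  rewrite <- Cexpi_plus; f_equal; rewrite plus_IZR; ring.
Qed.

Lemma localized_coef_bounded c B chi :
  (forall l, Cmod (c l) <= B) -> test_function chi ->
  exists A, forall m, Cmod (localized_coef c chi m) <= A.
Proof.
intros Hc Hchi.
pose proof two_PI_pos as hpi.
assert (HB : 0 <= B) by (eapply Rle_trans; [apply Cmod_ge_0|apply (Hc 0%Z)]).
destruct (test_fourier_decay2 _ Hchi) as [A [HA0 HA]].
exists (5 * (A * (2 * PI * B))); intro m.
replace (localized_coef c chi m) with (localized_coef c chi m - RtoC 0)%C by ring.
apply (Cmod_le_of_lim _ _ _ _ O (localized_coef_limit c B chi m Hc Hchi)); intros n _.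
unfold Cminus; rewrite Copp_0, Cplus_0_r.
eapply Rle_trans; [apply Cmod_symmetric_sum|].
apply real_symmetric_sum_bound; [|apply Rmult_le_pos; [lra|apply Rmult_le_pos; lra]].
intro l; rewrite !Cmod_mult, Cmod_R, (Rabs_pos_eq (2 * PI)) by lra.
replace (A * (2 * PI * B) / (1 + IZR l ^ 2)) with (A / (1 + IZR l ^ 2) * (2 * PI * B)) by (unfold Rdiv; ring).
apply Rmult_le_compat; [apply Cmod_ge_0| |apply HA|].
- apply Rmult_le_pos; [lra|apply Cmod_ge_0].
- apply Rmult_le_compat_l; [lra|apply Hc].
Qed.

(* Rajchman's formal multiplication: multiplying the coefficients by [chi] commutes
   with taking partial sums, up to a bounded error. *)
Lemma localized_partial_sum_close c B chi :
  (forall l, Cmod (c l) <= B) -> test_function chi ->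
  exists A, forall n x,
    Cmod (exp_poly (localized_coef c chi) n x - RtoC (2 * PI) * (chi x * trig_partial_sum c n x)) <= A.
Proof.
intros Hc Hchi.
pose proof two_PI_pos as hpi.
assert (HB : 0 <= B) by (eapply Rle_trans; [apply Cmod_ge_0|apply (Hc 0%Z)]).
destruct (test_fourier_decay _ Hchi) as [A [HA0 HA]].
exists (5 * (4 * PI * B * A)); intros n x.
set (a := fun m => (c (- m)%Z * Cexpi (IZR (- m) * x))%C).
assert (Ha : symmetric_sum a n = trig_partial_sum c n x).
{ unfold a, trig_partial_sum.
  exact (symmetric_sum_opp_index (fun l => (c l * Cexpi (IZR l * x))%C) n). }
set (chiM := symmetric_sum (fun j => (fourier chi j * Cexpi (IZR j * x))%C)).
set (dM := fun m => symmetric_sum (fun j => (fourier chi j * (RtoC (2 * PI) * c (- m - j)%Z))%C)).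
assert (Hlim : filterlim (fun M => (symmetric_sum (fun m => (Cexpi (IZR (- m) * x) * dM m M)%C) n
   + (- (RtoC (2 * PI) * trig_partial_sum c n x)) * chiM M)%C) eventually
  (locally (symmetric_sum (fun m => (Cexpi (IZR (- m) * x) * localized_coef c chi m)%C) n
   + (- (RtoC (2 * PI) * trig_partial_sum c n x)) * chi x)%C)).
{ apply C_lim_plus.
  - apply (C_lim_symmetric_sum (fun m M => (Cexpi (IZR (- m) * x) * dM m M)%C)).
    intro m; apply C_lim_mult_l, (localized_coef_limit c B); assumption.
  - apply C_lim_mult_l, (C_lim_of_rate _ _ (4 * A)); intro M.
    rewrite <- Cmod_opp, Copp_minus_distr; apply fourier_inversion; [exact Hchi|exact HA0|].
    intro l; eapply Rle_trans; [apply HA|now apply quartic_le_quadratic]. }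
replace (exp_poly (localized_coef c chi) n x - RtoC (2 * PI) * (chi x * trig_partial_sum c n x))%C with
  (symmetric_sum (fun m => (Cexpi (IZR (- m) * x) * localized_coef c chi m)%C) n
   + (- (RtoC (2 * PI) * trig_partial_sum c n x)) * chi x - RtoC 0)%C.
2:{ unfold exp_poly.
  rewrite (symmetric_sum_ext _ (fun m => (localized_coef c chi m * Cexpi (IZR (- m) * x))%C))
    by (intros; ring); ring. }
apply (Cmod_le_of_lim _ _ _ _ O Hlim); intros M _.
(* After the sums over [m] and [j] are exchanged, each frequency [j] of [chi] contributes a partial
   sum with indices shifted by [j] minus the unshifted one. This is at most [2 |j| B] whatever [n]
   is, and the decay of [fourier chi j] makes the sum over [j] bounded. *)
replace (_ - RtoC 0)%C with (symmetric_sum (fun j => (RtoC (2 * PI) * (fourier chi j * (Cexpi (IZR j * x)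
  * (symmetric_sum (fun m => a (m + j)%Z) n - symmetric_sum a n))))%C) M).
- eapply Rle_trans; [apply Cmod_symmetric_sum|].
  apply real_symmetric_sum_bound; [|apply Rmult_le_pos; [apply Rmult_le_pos|]; lra].
  intro j; rewrite !Cmod_mult, Cmod_R, Cmod_Cexpi, Rmult_1_l, (Rabs_pos_eq (2 * PI)) by lra.
  assert (Hs : Cmod (symmetric_sum (fun m => a (m + j)%Z) n - symmetric_sum a n) <= 2 * Rabs (IZR j) * B).
  { apply symmetric_sum_shift; intro l; unfold a; rewrite Cmod_mult, Cmod_Cexpi, Rmult_1_r; apply Hc. }
  specialize (HA j).
  pose proof (pow2_ge_0 (IZR j)) as hj.
  assert (hj' : Rabs (IZR j) <= 1 + IZR j ^ 2).
  { rewrite <- (pow2_abs (IZR j)); pose proof (pow2_ge_0 (Rabs (IZR j) - 1)); nra. }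
  apply Rle_trans with (2 * PI * (A / (1 + IZR j ^ 2) ^ 2 * (2 * (1 + IZR j ^ 2) * B))).
  + apply Rmult_le_compat_l; [lra|].
    apply Rmult_le_compat; [apply Cmod_ge_0|apply Cmod_ge_0|exact HA|].
    eapply Rle_trans; [exact Hs|]; nra.
  + apply Req_le; field; lra.
- rewrite <- Ha.
  unfold Cminus at 2; rewrite Copp_0, Cplus_0_r.
  replace (symmetric_sum (fun m => (Cexpi (IZR (- m) * x) * dM m M)%C) n) with
    (symmetric_sum (fun j => (RtoC (2 * PI) * (fourier chi j * (Cexpi (IZR j * x)
      * symmetric_sum (fun m => a (m + j)%Z) n)))%C) M).
  + unfold chiM; rewrite <- symmetric_sum_mult_l, <- symmetric_sum_plus.
    apply symmetric_sum_ext; intros; ring.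
  + transitivity (symmetric_sum (fun j => symmetric_sum (fun m =>
      (Cexpi (IZR (- m) * x) * (fourier chi j * (RtoC (2 * PI) * c (- m - j)%Z)))%C) n) M).
    * apply symmetric_sum_ext; intros j _.
      transitivity ((RtoC (2 * PI) * fourier chi j * Cexpi (IZR j * x)) * symmetric_sum (fun m => a (m + j)%Z) n)%C; [ring|].
      rewrite <- symmetric_sum_mult_l; apply symmetric_sum_ext; intros m _; unfold a.
      replace (- (m + j))%Z with (- m - j)%Z by lia.
      replace (IZR (- m) * x) with (IZR j * x + IZR (- m - j) * x) by (rewrite minus_IZR; ring).
      rewrite Cexpi_plus; ring.
    * rewrite symmetric_sum_swap; apply symmetric_sum_ext; intros m _.
      now rewrite symmetric_sum_mult_l.
Qed.

(** * Energy of partial sums near the support *)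

Lemma cint_RtoC f : cont f -> cint (fun x => RtoC (f x)) = RtoC (RInt f 0 (2 * PI)).
Proof.
intros Hf; unfold cint; simpl; rewrite RInt_const_R, Rmult_0_r; reflexivity.
Qed.

Lemma cint_exp_poly_conj a b M n :
  (n <= M)%nat ->
  cint (fun x => (exp_poly a M x * Cconj (exp_poly b n x))%C) =
  (RtoC (2 * PI) * symmetric_sum (fun m => (a m * Cconj (b m))%C) n)%C.
Proof.
intros HnM.
transitivity (cint (fun x => symmetric_sum (fun m => (Cconj (b m) * (exp_poly a M x * Cexpi (IZR m * x)))%C) n)).
- apply cint_ext; intro x; unfold exp_poly at 2.
  rewrite symmetric_sum_conj, <- symmetric_sum_mult_l.
  apply symmetric_sum_ext; intros m _.
  rewrite Cmult_conj, Cexpi_conj, opp_IZR.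
  replace (- (- IZR m * x)) with (IZR m * x) by ring; ring.
- rewrite (cint_symmetric_sum (fun m x => (Cconj (b m) * (exp_poly a M x * Cexpi (IZR m * x)))%C)) by auto 10 with cont.
  rewrite <- symmetric_sum_mult_l; apply symmetric_sum_ext; intros m Hm.
  rewrite cint_mult_l, cint_exp_poly_Cexpi by (auto 10 with cont || lia); ring.
Qed.

Lemma RInt_exp_poly_square a n :
  RInt (fun x => Cmod (exp_poly a n x) ^ 2) 0 (2 * PI) =
  2 * PI * real_symmetric_sum (fun m => Cmod (a m) ^ 2) n.
Proof.
apply RtoC_inj; rewrite <- cint_RtoC by auto 10 with cont.
rewrite RtoC_mult, <- symmetric_sum_RtoC.
rewrite (symmetric_sum_ext _ (fun m => (a m * Cconj (a m))%C)) by (intros; apply Cmod2_conj).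
rewrite <- (cint_exp_poly_conj a a n n) by lia.
apply cint_ext; intro; apply Cmod2_conj.
Qed.

Lemma Cmod_exp_poly_le a n x : Cmod (exp_poly a n x) <= real_symmetric_sum (fun m => Cmod (a m)) n.
Proof.
eapply Rle_trans; [apply Cmod_symmetric_sum|].
apply real_symmetric_sum_le; intros l _; rewrite Cmod_mult, Cmod_Cexpi; lra.
Qed.

Definition derive_coef (a : Z -> C) (m : Z) : C := (a m * (- (RtoC (IZR m) * Ci)))%C.

Lemma is_derive_exp_poly a n x :
  is_derive (fun y => Re (exp_poly a n y)) x (Re (exp_poly (derive_coef a) n x)) /\
  is_derive (fun y => Im (exp_poly a n y)) x (Im (exp_poly (derive_coef a) n x)).
Proof.
assert (Hterm : forall m,
  is_derive (fun y => Re (a m * Cexpi (IZR (- m) * y))) x (Re (derive_coef a m * Cexpi (IZR (- m) * x))) /\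
  is_derive (fun y => Im (a m * Cexpi (IZR (- m) * y))) x (Im (derive_coef a m * Cexpi (IZR (- m) * x)))).
{ intro m; unfold derive_coef, Re, Im; destruct (a m) as [p q]; rewrite opp_IZR; simpl.
  split; auto_derive; try exact I; ring. }
unfold exp_poly; induction n as [|n [IHr IHi]].
- rewrite symmetric_sum_0; split.
  + apply (is_derive_ext (fun y => Re (a 0%Z * Cexpi (IZR (- 0) * y)))); [intro; now rewrite symmetric_sum_0|apply Hterm].
  + apply (is_derive_ext (fun y => Im (a 0%Z * Cexpi (IZR (- 0) * y)))); [intro; now rewrite symmetric_sum_0|apply Hterm].
- rewrite symmetric_sum_S; split.
  + eapply is_derive_ext; [intro y; symmetry; rewrite symmetric_sum_S; simpl; reflexivity|].
    apply (is_derive_plus (V := R_NormedModule)); [apply (is_derive_plus (V := R_NormedModule))|];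
      [exact IHr|apply Hterm|apply Hterm].
  + eapply is_derive_ext; [intro y; symmetry; rewrite symmetric_sum_S; simpl; reflexivity|].
    apply (is_derive_plus (V := R_NormedModule)); [apply (is_derive_plus (V := R_NormedModule))|];
      [exact IHi|apply Hterm|apply Hterm].
Qed.

Lemma derive_coef_energy a n :
  real_symmetric_sum (fun m => Cmod (derive_coef a m) ^ 2) n
    <= INR n ^ 2 * real_symmetric_sum (fun m => Cmod (a m) ^ 2) n.
Proof.
rewrite <- real_symmetric_sum_scal; apply real_symmetric_sum_le; intros m Hm.
unfold derive_coef; rewrite Cmod_mult, Cmod_opp, Cmod_mult, Cmod_R, Cmod_Ci, Rmult_1_r.
rewrite Rpow_mult_distr, Rmult_comm; apply Rmult_le_compat_r; [apply pow2_ge_0|].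
apply pow_incr; split; [apply Rabs_pos|].
rewrite <- abs_IZR, INR_IZR_INZ; now apply IZR_le.
Qed.

Lemma cont_exp_poly_parts a n :
  cont (fun x => Re (exp_poly a n x)) /\ cont (fun x => Im (exp_poly a n x)).
Proof. apply Ccont_exp_poly. Qed.

(** * Control by the derivative near the support, and weights of arcs *)

Definition window (g : R -> R) (h x : R) : R := RInt g (x - h) (x + h).

Lemma window_nonneg g h x : cont g -> (forall y, 0 <= g y) -> 0 <= h -> 0 <= window g h x.
Proof. intros Hg Hpos Hh; apply RInt_nonneg_cont; [lra|exact Hg|intros; apply Hpos]. Qed.

(** Cauchy-Schwarz on the segment between [x] and [y]. It is enlarged to a window centered at [x],
    so that the bound no longer mentions [y], a point of the support varying with [x], and can be
    integrated in [x]. *)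
Lemma window_increment (f f' : R -> R) h x y :
  (forall z, is_derive f z (f' z)) -> cont f' -> Rabs (x - y) <= h ->
  (f x - f y) ^ 2 <= h * window (fun z => f' z ^ 2) h x.
Proof.
intros Hf Hf' Hxy.
set (g := fun z => f' z ^ 2).
assert (Hg : cont g) by (unfold g; auto with cont).
assert (Hpos : forall z, 0 <= g z) by (intro; apply pow2_ge_0).
assert (key : forall a b, a <= b -> b - a <= h -> x - h <= a -> b <= x + h ->
  (f b - f a) ^ 2 <= h * window g h x).
{ intros a b Hab Hh Ha Hb.
  rewrite <- (RInt_derive_cont f f') by assumption.
  eapply Rle_trans; [now apply RInt_square_le|].
  fold g; unfold window.
  assert (h1 : RInt g a b <= RInt g (x - h) (x + h)).
  { rewrite <- (RInt_Chasles_cont g (x - h) a), <- (RInt_Chasles_cont g a b (x + h)) by exact Hg.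
    pose proof (RInt_nonneg_cont g (x - h) a Ha Hg ltac:(auto)).
    pose proof (RInt_nonneg_cont g b (x + h) Hb Hg ltac:(auto)); lra. }
  pose proof (RInt_nonneg_cont g a b Hab Hg ltac:(auto)).
  apply Rmult_le_compat; lra. }
apply Rabs_le_between in Hxy.
destruct (Rle_dec y x) as [H|H].
- apply key; lra.
- replace ((f x - f y) ^ 2) with ((f y - f x) ^ 2) by ring; apply key; lra.
Qed.

(** Fubini's theorem, obtained from a primitive: the window is [Phi (x + h) - Phi (x - h)], its
    integral telescopes to two integrals of length [2 * h], and [Phi] grows by the integral of [g]
    over each period. *)
Lemma RInt_window g h :
  cont g -> real_periodic g ->
  cont (window g h) /\ RInt (window g h) 0 (2 * PI) = 2 * h * RInt g 0 (2 * PI).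
Proof.
intros Hg Hp.
set (Phi := fun x => RInt g 0 x).
assert (HPhi : forall x, is_derive Phi x (g x)).
{ intro x; apply (is_derive_RInt g Phi 0).
  - exists (mkposreal _ Rlt_0_1); intros y _; apply (RInt_correct (V := R_CompleteNormedModule)), ex_RInt_cont, Hg.
  - apply Hg. }
pose proof (cont_is_derive _ _ HPhi) as Hc.
assert (E : window g h = fun x => Phi (x + h) - Phi (x + - h)).
{ apply functional_extensionality; intro x; unfold window, Phi.
  rewrite <- (RInt_Chasles_cont g 0 (x - h) (x + h)) by exact Hg.
  assert (h0 : forall u v : R, v = u + v - u) by (intros; ring); apply h0. }
assert (Hs : forall v, cont (fun x => Phi (x + v))).
{ intro v; apply (cont_comp (fun x => x + v) Phi); auto with cont. }
rewrite E; split; [auto with cont|].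
rewrite RInt_minus_cont, !RInt_shift by auto.
replace (0 + h) with h by ring; replace (0 + - h) with (- h) by ring.
rewrite <- (RInt_Chasles_cont Phi h (2 * PI + - h) (2 * PI + h)),
  <- (RInt_Chasles_cont Phi (- h) h (2 * PI + - h)) by exact Hc.
assert (H : RInt Phi (2 * PI + - h) (2 * PI + h) = 2 * h * RInt g 0 (2 * PI) + RInt Phi (- h) h).
{ replace (2 * PI + - h) with (- h + 2 * PI) by ring; replace (2 * PI + h) with (h + 2 * PI) by ring.
  rewrite <- RInt_shift by exact Hc.
  rewrite (RInt_ext _ (fun x => RInt g 0 (2 * PI) + Phi x)).
  - rewrite RInt_plus_cont, RInt_const_R by auto with cont; f_equal; ring.
  - intros x _; unfold Phi.
    rewrite <- (RInt_Chasles_cont g 0 x (x + 2 * PI)) by exact Hg.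
    rewrite RInt_period_start by assumption; apply Rplus_comm. }
rewrite H; assert (h0 : forall u v w : R, u + (w + v) - (v + u) = w) by (intros; ring); apply h0.
Qed.

(** A continuous majorant of the indicator of the [4 * d]-neighbourhood of the arcs
    [[a i, a i + d]]. Points of that neighbourhood are within [5 * d] of [a i], where a bump of
    scale [10 * d] is at least [exp (-2)]; the factor [exp 2] brings this up to 1. *)
Fixpoint arc_weight (a : nat -> R) (d : R) (m : nat) (x : R) : R :=
  match m with
  | O => 0
  | S m' => arc_weight a d m' x + exp 2 * circle_bump (10 * d) (x + - a m')
  end.

Lemma cont_bump_shift d y : cont (fun x => circle_bump d (x + y)).
Proof. apply (cont_comp (fun x => x + y) (circle_bump d)); auto with cont. Qed.

Lemma cont_arc_weight a d m : cont (arc_weight a d m).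
Proof.
induction m as [|m IH]; simpl; [apply cont_const|].
apply cont_plus; [exact IH|apply cont_scal, cont_bump_shift].
Qed.
#[export] Hint Resolve cont_arc_weight : cont.

Lemma arc_weight_nonneg a d m x : 0 <= arc_weight a d m x.
Proof.
induction m as [|m IH]; simpl; [lra|].
pose proof (circle_bump_range (10 * d) (x + - a m)); pose proof (exp_pos 2); nra.
Qed.

Lemma RInt_arc_weight a d m :
  0 < d -> 40 * d <= PI -> RInt (arc_weight a d m) 0 (2 * PI) <= 80 * exp 2 * (INR m * d).
Proof.
intros Hd Hd'; induction m as [|m IH].
- cbn [arc_weight]; rewrite RInt_const_R; simpl; lra.
- cbn [arc_weight]; rewrite RInt_plus_cont, RInt_scal_cont, S_INR
    by auto using cont_scal, cont_bump_shift with cont.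
  rewrite RInt_period_shift by (auto with cont || apply circle_bump_periodic).
  pose proof (RInt_circle_bump_le (10 * d) ltac:(lra) ltac:(lra)).
  pose proof (exp_pos 2); nra.
Qed.

Lemma arc_weight_ge_1 a d m i (k : Z) x :
  0 < d -> (i < m)%nat -> - (4 * d) <= x + 2 * PI * IZR k - a i <= 5 * d -> 1 <= arc_weight a d m x.
Proof.
intros Hd Hi Hx; induction m as [|m IH]; [lia|cbn [arc_weight]].
pose proof (exp_pos 2) as he.
destruct (Nat.eq_dec i m) as [->|h].
- pose proof (arc_weight_nonneg a d m x).
  assert (hb : exp (-2) <= circle_bump (10 * d) (x + - a m)).
  { apply circle_bump_ge; [lra|].
    rewrite <- (sin_half_shift _ k).
    pose proof (sin_half_le (x + - a m + 2 * PI * IZR k)) as h.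
    assert (Rabs (x + - a m + 2 * PI * IZR k) <= 5 * d) by (apply Rabs_le; lra).
    lra. }
  assert (E : exp 2 * exp (-2) = 1).
  { rewrite <- exp_plus; replace (2 + -2) with 0 by ring; apply exp_0. }
  nra.
- specialize (IH ltac:(lia)).
  pose proof (circle_bump_range (10 * d) (x + - a m)); nra.
Qed.

(** * The two energy bounds for a localized distribution *)

Section Energy.

Variables (c : Z -> C) (B : R) (chi : R -> C).
Hypothesis Hc : forall l, Cmod (c l) <= B.
Hypothesis Hchi : test_function chi.

Let a := localized_coef c chi.
Let energy n := real_symmetric_sum (fun m => Cmod (a m) ^ 2) n.
(** Partial sums of the mollified localized distribution, called [u] in the overview; the order of
    truncation is the remaining argument of [exp_poly]. *)
Let smoothed d := exp_poly (fun m => (bump_coef d m * a m)%C).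

(* The untruncated series at [x] is the pairing with a test function supported in the
   [4 * d]-neighbourhood of [x]. *)
Lemma smoothed_near_support d :
  0 < d -> exists A, 0 <= A /\ forall M x,
    Cmod (smoothed d M x) <= A / (INR M + 1) \/
    exists y, distr_support c y /\ Rabs (x - y) <= 4 * d.
Proof.
intros Hd.
destruct (bump_pairing_series c B chi d Hc Hchi) as [A [HA0 HA]].
exists A; split; [exact HA0|]; intros M x.
destruct (classic (exists y, distr_support c y /\ Rabs (x - y) <= 4 * d)) as [h|h]; [now right|left].
specialize (HA M x).
rewrite (pairing_eq0_off_support c B) in HA.
- rewrite <- Cmod_opp; eapply Rle_trans; [|exact HA]; apply Req_le; f_equal; unfold smoothed, a; ring.
- exact Hc.
- apply test_mult; [exact Hchi|apply test_circle_bump].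
- intros y Hy HK; apply h.
  apply fun_support_bump in Hy; [|exact Hd].
  destruct (near_period_of_sin_half_le _ _ Hy) as [k Hk].
  exists (y + 2 * PI * IZR k); split; [now apply distr_support_IZR|].
  rewrite Rabs_minus_sym.
  now replace (y + 2 * PI * IZR k - x) with (y - x + 2 * PI * IZR k) by ring.
Qed.

(** Cauchy-Schwarz with weight [t] in place of square roots. The majorant [H] of [|q| ^ 2] is needed
    only near the support; elsewhere [smoothed] is [O(1 / (M + 1))] and the crude bound [Q]
    suffices. The constant [A] depends on neither [M] nor [t], so the last term disappears as [M]
    grows. *)
Lemma duality_bound d (q : R -> C) (H : R -> R) (Q : R) :
  0 < d -> Ccont q -> cont H -> (forall x, 0 <= H x) -> (forall x, Cmod (q x) <= Q) ->
  (forall x y, distr_support c y -> Rabs (x - y) <= 4 * d -> Cmod (q x) ^ 2 <= H x) ->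
  exists A, forall M t, 0 < t ->
    Cmod (cint (fun x => (smoothed d M x * q x)%C)) <=
      t * (PI * real_symmetric_sum (fun m => Cmod (bump_coef d m * a m) ^ 2) M)
      + RInt H 0 (2 * PI) / (2 * t) + A / (INR M + 1).
Proof.
intros Hd Hq HH HHpos HQ Hnear.
pose proof two_PI_pos as hpi.
destruct (smoothed_near_support d Hd) as [A [HA0 HA]].
assert (HQ0 : 0 <= Q) by (eapply Rle_trans; [apply Cmod_ge_0|apply (HQ 0)]).
exists (2 * PI * (A * Q)); intros M t Ht.
pose proof (pos_INR M) as hM.
assert (hAM : 0 <= A / (INR M + 1)) by (apply Rle_mult_inv_pos; lra).
assert (Hs : Ccont (smoothed d M)) by (unfold smoothed; auto with cont).
eapply Rle_trans.
- apply (Cmod_cint_le _ (fun x => (t / 2 * Cmod (smoothed d M x) ^ 2 + / (2 * t) * H x) + A / (INR M + 1) * Q)).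
  + auto with cont.
  + auto 10 using cont_scal with cont.
  + intros x _; rewrite Cmod_mult.
    pose proof (Cmod_ge_0 (smoothed d M x)) as h1; pose proof (Cmod_ge_0 (q x)) as h2.
    specialize (HQ x); specialize (HHpos x).
    assert (ht : 0 < / (2 * t)) by (apply Rinv_0_lt_compat; lra).
    assert (hH : 0 <= / (2 * t) * H x) by (apply Rmult_le_pos; lra).
    assert (hS : 0 <= t / 2 * Cmod (smoothed d M x) ^ 2).
    { apply Rmult_le_pos; [lra|apply pow2_ge_0]. }
    destruct (HA M x) as [h|[y [hy1 hy2]]].
    * assert (Cmod (smoothed d M x) * Cmod (q x) <= A / (INR M + 1) * Q) by (apply Rmult_le_compat; lra).
      lra.
    * specialize (Hnear x y hy1 hy2).
      assert (h3 : / (2 * t) * Cmod (q x) ^ 2 <= / (2 * t) * H x) by (apply Rmult_le_compat_l; lra).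
      assert (h4 : 0 <= A / (INR M + 1) * Q) by now apply Rmult_le_pos.
      (* AM-GM *)
      assert (h5 : Cmod (smoothed d M x) * Cmod (q x)
        <= t / 2 * Cmod (smoothed d M x) ^ 2 + / (2 * t) * Cmod (q x) ^ 2).
      { assert (h6 : 0 <= / (2 * t) * (t * Cmod (smoothed d M x) - Cmod (q x)) ^ 2).
        { apply Rmult_le_pos; [lra|apply pow2_ge_0]. }
        replace (/ (2 * t) * (t * Cmod (smoothed d M x) - Cmod (q x)) ^ 2)
          with (t / 2 * Cmod (smoothed d M x) ^ 2 + / (2 * t) * Cmod (q x) ^ 2
            - Cmod (smoothed d M x) * Cmod (q x)) in h6 by (field; lra).
        lra. }
      lra.
- rewrite !RInt_plus_cont, !RInt_scal_cont, RInt_const_R by auto 10 using cont_scal with cont.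
  unfold smoothed; rewrite RInt_exp_poly_square.
  apply Req_le; field; lra.
Qed.

Lemma coef_energy_bound A n :
  (forall m, Cmod (a m) <= A) -> energy n <= A ^ 2 * (2 * INR n + 1).
Proof.
intros HA; unfold energy.
eapply Rle_trans; [apply (real_symmetric_sum_le _ (fun _ => A ^ 2))|].
- intros m _; apply pow_incr; split; [apply Cmod_ge_0|apply HA].
- rewrite real_symmetric_sum_const; lra.
Qed.

(** Parseval for the bump, of order [d], with the [a m] bounded individually. It serves the upper
    bound of the energy; [smoothed_energy_tail] serves the lower one. *)
Lemma smoothed_energy_le A d M :
  (forall m, Cmod (a m) <= A) -> 0 < d -> 4 * d <= PI ->
  real_symmetric_sum (fun m => Cmod (bump_coef d m * a m) ^ 2) M <= A ^ 2 * (2 * d).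
Proof.
intros HA Hd Hd'.
eapply Rle_trans; [apply (real_symmetric_sum_le _ (fun m => A ^ 2 * Cmod (bump_coef d m) ^ 2))|].
- intros m _; rewrite Cmod_mult, Rpow_mult_distr, Rmult_comm.
  apply Rmult_le_compat_r; [apply pow2_ge_0|].
  apply pow_incr; split; [apply Cmod_ge_0|apply HA].
- rewrite real_symmetric_sum_scal; apply Rmult_le_compat_l; [apply pow2_ge_0|].
  now apply bump_coef_energy.
Qed.

Lemma covered_near d m : 0 < d -> 40 * d <= PI -> covered_by (distr_support c) d m ->
  exists W, cont W /\ (forall x, 0 <= W x) /\
    RInt W 0 (2 * PI) <= 80 * exp 2 * (INR m * d) /\
    forall x y, distr_support c y -> Rabs (x - y) <= 4 * d -> 1 <= W x.
Proof.
intros Hd Hd' [b Hb]; exists (arc_weight b d m); split; [apply cont_arc_weight|].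
split; [apply arc_weight_nonneg|split].
- now apply RInt_arc_weight.
- intros x y Hy Hxy; destruct (Hb y Hy) as [i [k [Hi Hik]]].
  apply Rabs_le_between in Hxy.
  apply (arc_weight_ge_1 b d m i k x Hd Hi); lra.
Qed.

(** The pairing of [u] with the conjugate of the [n]-th partial sum is [2 PI] times the sum of
    [b_m |a_m| ^ 2] over [|m| <= n]. The condition [INR n * d <= / 4] makes [bump_coef_Re_ge]
    available for all these [m], which yields the left-hand side; the right-hand side is
    [duality_bound]. *)
Lemma energy_upper_raw A A0 n d m t :
  (forall l, Cmod (a l) <= A) -> (forall y, distr_support c y -> Cmod (exp_poly a n y) <= A0) ->
  0 < d <= 1 -> 40 * d <= PI -> INR n * d <= / 4 -> covered_by (distr_support c) d m -> 0 < t ->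
  exp (-2) / 2 * (d * energy n) <=
    t * (PI * (A ^ 2 * (2 * d)))
    + (2 * A0 ^ 2 * (80 * exp 2 * (INR m * d)) + 128 * PI * (d ^ 2 * INR n ^ 2 * energy n)) / (2 * t).
Proof.
intros HA HA0 Hd Hd' Hnd Hcov Ht.
pose proof two_PI_pos as hpi.
destruct (covered_near d m (proj1 Hd) Hd' Hcov) as [W [HW [HWpos [HWint HW1]]]].
set (S := exp_poly a n); set (S' := exp_poly (derive_coef a) n).
assert (HS : Ccont S) by (unfold S; auto with cont).
destruct (cont_exp_poly_parts (derive_coef a) n) as [Hr' Hi']; fold S' in Hr', Hi'.
set (gr := fun z => Re (S' z) ^ 2); set (gi := fun z => Im (S' z) ^ 2).
assert (Hgr : cont gr) by (unfold gr; auto with cont).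
assert (Hgi : cont gi) by (unfold gi; auto with cont).
assert (HS'p : periodic_fun S').
{ intro x; unfold S', exp_poly; apply symmetric_sum_ext; intros l _.
  now rewrite Cexpi_IZR_periodic. }
assert (Hgrp : real_periodic gr) by (intro x; unfold gr; now rewrite HS'p).
assert (Hgip : real_periodic gi) by (intro x; unfold gi; now rewrite HS'p).
destruct (RInt_window gr (4 * d) Hgr Hgrp) as [Hwr Hwri].
destruct (RInt_window gi (4 * d) Hgi Hgip) as [Hwi Hwii].
assert (Hwrpos : forall x, 0 <= window gr (4 * d) x).
{ intro; apply window_nonneg; [exact Hgr|intro; apply pow2_ge_0|lra]. }
assert (Hwipos : forall x, 0 <= window gi (4 * d) x).
{ intro; apply window_nonneg; [exact Hgi|intro; apply pow2_ge_0|lra]. }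
(* From [|S x| ^ 2 <= 2 |S y| ^ 2 + 2 |S x - S y| ^ 2] with [y] in the support and
   [|x - y| <= 4 * d]: the weight [W] is at least 1 there, and [window_increment] bounds the second
   term with [h = 4 * d]. *)
set (H := fun x => 2 * A0 ^ 2 * W x + 8 * d * (window gr (4 * d) x + window gi (4 * d) x)).
assert (HH : cont H) by (unfold H; auto using cont_scal with cont).
assert (HHint : RInt H 0 (2 * PI) <=
  2 * A0 ^ 2 * (80 * exp 2 * (INR m * d)) + 128 * PI * (d ^ 2 * INR n ^ 2 * energy n)).
{ unfold H; rewrite RInt_plus_cont, !RInt_scal_cont, RInt_plus_cont, Hwri, Hwii
    by auto using cont_scal with cont.
  pose proof (derive_coef_energy a n) as hE; fold (energy n) in hE.
  pose proof (RInt_exp_poly_square (derive_coef a) n) as hP; fold S' in hP.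
  rewrite (RInt_ext _ (fun x => gr x + gi x)) in hP by (intros; apply Cmod2_alt).
  rewrite RInt_plus_cont in hP by assumption.
  apply Rplus_le_compat.
  - apply Rmult_le_compat_l; [pose proof (pow2_ge_0 A0); lra|exact HWint].
  - replace (8 * d * (2 * (4 * d) * RInt gr 0 (2 * PI) + 2 * (4 * d) * RInt gi 0 (2 * PI)))
      with (64 * d ^ 2 * (RInt gr 0 (2 * PI) + RInt gi 0 (2 * PI))) by ring.
    rewrite hP.
    apply Rle_trans with (64 * d ^ 2 * (2 * PI * (INR n ^ 2 * energy n))); [|lra].
    apply Rmult_le_compat_l; [pose proof (pow2_ge_0 d); lra|].
    apply Rmult_le_compat_l; lra. }
assert (Hnear : forall x y, distr_support c y -> Rabs (x - y) <= 4 * d -> Cmod (Cconj (S x)) ^ 2 <= H x).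
{ intros x y Hy Hxy; rewrite Cmod_conj; unfold H.
  specialize (HW1 x y Hy Hxy); specialize (HA0 y Hy); fold S in HA0.
  pose proof (window_increment (fun z => Re (S z)) (fun z => Re (S' z)) (4 * d) x y
    (fun z => proj1 (is_derive_exp_poly a n z)) Hr' Hxy) as h1.
  pose proof (window_increment (fun z => Im (S z)) (fun z => Im (S' z)) (4 * d) x y
    (fun z => proj2 (is_derive_exp_poly a n z)) Hi' Hxy) as h2.
  cbv beta in h1, h2; fold gr in h1; fold gi in h2.
  assert (h3 : Cmod (S y) ^ 2 <= A0 ^ 2) by (apply pow_incr; split; [apply Cmod_ge_0|exact HA0]).
  rewrite Cmod2_alt in h3; rewrite Cmod2_alt.
  pose proof (pow2_ge_0 A0).
  assert (h4 : 2 * A0 ^ 2 <= 2 * A0 ^ 2 * W x) by nra.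
  pose proof (pow2_ge_0 (Re (S x) - 2 * Re (S y))); pose proof (pow2_ge_0 (Im (S x) - 2 * Im (S y))).
  lra. }
destruct (duality_bound d (fun x => Cconj (S x)) H (real_symmetric_sum (fun m => Cmod (a m)) n))
  as [A' HA']; auto with cont.
{ lra. }
{ intro x; unfold H; specialize (HWpos x); specialize (Hwrpos x); specialize (Hwipos x).
  pose proof (pow2_ge_0 A0).
  apply Rplus_le_le_0_compat; apply Rmult_le_pos; lra. }
{ intro x; rewrite Cmod_conj; apply Cmod_exp_poly_le. }
match goal with |- ?L <= ?U => assert (Hdiff : L - U <= 0); [|lra] end.
apply (le_0_of_le_div _ (Rabs A')); intro M.
(* An order of at least [n], so that the pairing sees every frequency of [S]. *)
specialize (HA' (M + n)%nat t Ht).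
unfold smoothed, S in HA'.
rewrite cint_exp_poly_conj in HA' by lia.
assert (hlow : exp (-2) / 2 * (d * energy n) <=
  Cmod (RtoC (2 * PI) * symmetric_sum (fun l => (bump_coef d l * a l * Cconj (a l))%C) n)).
{ rewrite Cmod_mult, Cmod_R, Rabs_pos_eq by lra.
  apply Rle_trans with (2 * PI * Re (symmetric_sum (fun l => (bump_coef d l * a l * Cconj (a l))%C) n)).
  - rewrite symmetric_sum_Re.
    replace (exp (-2) / 2 * (d * energy n)) with (2 * PI * (exp (-2) * d / (4 * PI) * energy n))
      by (field; lra).
    apply Rmult_le_compat_l; [lra|].
    unfold energy; rewrite <- real_symmetric_sum_scal.
    apply real_symmetric_sum_le; intros l Hl.
    replace (Re (bump_coef d l * a l * Cconj (a l))) with (Re (bump_coef d l) * Cmod (a l) ^ 2).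
    + apply Rmult_le_compat_r; [apply pow2_ge_0|].
      apply Rle_div_l; [lra|].
      rewrite (Rmult_comm (Re _)); apply bump_coef_Re_ge; [exact Hd|].
      eapply Rle_trans; [|exact Hnd]; apply Rmult_le_compat_r; [lra|].
      rewrite <- abs_IZR, INR_IZR_INZ; now apply IZR_le.
    + rewrite <- Cmult_assoc, <- Cmod2_conj; simpl; ring.
  - apply Rmult_le_compat_l; [lra|].
    eapply Rle_trans; [apply Rle_abs|apply re_le_Cmod]. }
pose proof (smoothed_energy_le A d (M + n)%nat HA (proj1 Hd) ltac:(lra)) as hse.
assert (hmid : t * (PI * real_symmetric_sum (fun m => Cmod (bump_coef d m * a m) ^ 2) (M + n))
  <= t * (PI * (A ^ 2 * (2 * d)))).
{ apply Rmult_le_compat_l; [lra|]; apply Rmult_le_compat_l; [lra|exact hse]. }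
assert (hH : RInt H 0 (2 * PI) / (2 * t) <=
  (2 * A0 ^ 2 * (80 * exp 2 * (INR m * d)) + 128 * PI * (d ^ 2 * INR n ^ 2 * energy n)) / (2 * t)).
{ apply Rmult_le_compat_r; [apply Rlt_le, Rinv_0_lt_compat; lra|exact HHint]. }
assert (hA' : A' / (INR (M + n) + 1) <= Rabs A' / (INR M + 1)).
{ pose proof (pos_INR M); pose proof (pos_INR n).
  apply Rle_trans with (Rabs A' / (INR (M + n) + 1)).
  - apply Rmult_le_compat_r; [apply Rlt_le, Rinv_0_lt_compat; rewrite plus_INR; lra|apply Rle_abs].
  - apply Rmult_le_compat_l; [apply Rabs_pos|].
    apply Rinv_le_contravar; rewrite ?plus_INR; lra. }
lra.
Qed.

(** Divided by [d], the raw estimate reads [k E <= C0 (t + X / t)] with [X = m + d n ^ 2 E]; a [t]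
    proportional to [E] absorbs the first term into the left-hand side. [C1] must be uniform in [n],
    [d] and [m], since [d] is later chosen in terms of [n] and [E]. *)
Lemma energy_upper A A0 :
  (forall l, Cmod (a l) <= A) ->
  exists C1, 0 < C1 /\ forall n d m,
    (forall y, distr_support c y -> Cmod (exp_poly a n y) <= A0) ->
    0 < d <= 1 -> 40 * d <= PI -> INR n * d <= / 4 -> covered_by (distr_support c) d m ->
    0 < energy n -> energy n ^ 2 <= C1 * (INR m + d * INR n ^ 2 * energy n).
Proof.
intros HA.
pose proof two_PI_pos as hpi; pose proof (exp_pos 2) as he2; pose proof (exp_pos (-2)) as he.
set (k := exp (-2) / 2).
set (C0 := 1 + PI * (A ^ 2 * 2) + A0 ^ 2 * (80 * exp 2) + 64 * PI).
pose proof (pow2_ge_0 A) as hA2; pose proof (pow2_ge_0 A0) as hA02.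
assert (h1 : 0 <= PI * (A ^ 2 * 2)) by (apply Rmult_le_pos; lra).
assert (h2 : 0 <= A0 ^ 2 * (80 * exp 2)) by (apply Rmult_le_pos; lra).
assert (hC0 : 0 < C0) by (unfold C0; lra).
assert (hk : 0 < k) by (unfold k; lra).
exists (4 * (C0 / k) ^ 2); split.
{ apply Rmult_lt_0_compat; [lra|]; apply pow_lt, Rdiv_lt_0_compat; assumption. }
intros n d m HA0 Hd Hd' Hnd Hcov HE.
set (E := energy n) in *.
set (X := INR m + d * INR n ^ 2 * E).
pose proof (pos_INR m) as hm; pose proof (pow2_ge_0 (INR n)) as hn.
assert (hdE : 0 <= d * INR n ^ 2 * E) by (apply Rmult_le_pos; [apply Rmult_le_pos; lra|lra]).
assert (hX : 0 <= X) by (unfold X; lra).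
(* optimal choice of the AM-GM parameter *)
set (t := E * k / (2 * C0)).
assert (Ht : 0 < t) by (unfold t; apply Rdiv_lt_0_compat; [now apply Rmult_lt_0_compat|lra]).
pose proof (energy_upper_raw A A0 n d m t HA HA0 Hd Hd' Hnd Hcov Ht) as h.
fold E in h; fold k in h.
assert (h' : k * (d * E) <= d * (C0 * t + C0 * X / t)).
{ eapply Rle_trans; [exact h|].
  replace (t * (PI * (A ^ 2 * (2 * d)))) with (d * (PI * (A ^ 2 * 2) * t)) by ring.
  replace ((2 * A0 ^ 2 * (80 * exp 2 * (INR m * d)) + 128 * PI * (d ^ 2 * INR n ^ 2 * E)) / (2 * t))
    with (d * ((A0 ^ 2 * (80 * exp 2) * INR m + 64 * PI * (d * INR n ^ 2 * E)) / t)) by (field; lra).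
  rewrite <- Rmult_plus_distr_l; apply Rmult_le_compat_l; [lra|].
  apply Rplus_le_compat; [apply Rmult_le_compat_r; [lra|unfold C0; lra]|].
  apply Rmult_le_compat_r; [apply Rlt_le, Rinv_0_lt_compat; lra|].
  unfold X; rewrite Rmult_plus_distr_l; apply Rplus_le_compat; apply Rmult_le_compat_r; unfold C0; lra. }
assert (h'' : k * E <= C0 * t + C0 * X / t).
{ apply Rmult_le_reg_l with d; [lra|]; lra. }
replace (C0 * t) with (k * E / 2) in h'' by (unfold t; field; lra).
replace (C0 * X / t) with (2 * C0 ^ 2 * X / (k * E)) in h'' by (unfold t; field; lra).
assert (hkE : 0 < k * E) by now apply Rmult_lt_0_compat.
assert (h3 : k * E / 2 <= 2 * C0 ^ 2 * X / (k * E)) by lra.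
apply (Rmult_le_compat_r (k * E)) in h3; [|lra].
replace (2 * C0 ^ 2 * X / (k * E) * (k * E)) with (2 * C0 ^ 2 * X) in h3 by (field; lra).
apply Rmult_le_reg_l with (k ^ 2 / 2); [apply Rdiv_lt_0_compat; [now apply pow_lt|lra]|].
fold X; replace (k ^ 2 / 2 * (4 * (C0 / k) ^ 2 * X)) with (2 * C0 ^ 2 * X) by (field; lra).
eapply Rle_trans; [|exact h3]; apply Req_le; field.
Qed.

Lemma real_symmetric_sum_restrict (f : Z -> R) n M :
  (forall l, 0 <= f l) ->
  real_symmetric_sum (fun l => if Z_le_gt_dec (Z.abs l) (Z.of_nat n) then f l else 0) M
    <= real_symmetric_sum f n.
Proof.
intros Hf; destruct (Nat.le_gt_cases M n) as [h|h].
- eapply Rle_trans; [|apply (real_symmetric_sum_mono f M n Hf h)].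
  apply real_symmetric_sum_le; intros l _; specialize (Hf l).
  destruct (Z_le_gt_dec (Z.abs l) (Z.of_nat n)); lra.
- apply Nat.lt_le_incl in h; induction h as [|M h IH].
  + apply real_symmetric_sum_le; intros l _; specialize (Hf l).
    destruct (Z_le_gt_dec (Z.abs l) (Z.of_nat n)); lra.
  + cbn [real_symmetric_sum].
    destruct (Z_le_gt_dec (Z.abs (Z.of_nat M + 1)) (Z.of_nat n)); [lia|].
    destruct (Z_le_gt_dec (Z.abs (- (Z.of_nat M + 1))) (Z.of_nat n)); [lia|].
    lra.
Qed.

(** From [q + 1] integrations by parts, [|l| |b_l| d ^ 2 (|l| d) ^ q <= A d]. The hypothesis on [n]
    and [d] removes the extra factor for [|l| > n], so the tail has the same order [d ^ 2] as a
    single coefficient. With equality, [d = n ^ (- q / (q + 2))], which is the power [n^{-1+eps}] of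
    the overview. *)
Lemma bump_coef_tail q :
  exists A, 0 <= A /\ forall d n l, 0 < d <= 1 -> 1 <= d ^ 2 * (INR n * d) ^ q ->
    (Z.of_nat n < Z.abs l)%Z -> Cmod (bump_coef d l) ^ 2 <= A * d ^ 2 / (1 + IZR l ^ 2).
Proof.
destruct (bump_coef_decay (S q)) as [A [HA0 HA]].
exists (2 * A ^ 2); split; [pose proof (pow2_ge_0 A); lra|].
intros d n l Hd Hn Hl.
specialize (HA d l Hd).
set (y := Rabs (IZR l)) in *.
assert (hy : INR n <= y).
{ unfold y; rewrite <- abs_IZR, INR_IZR_INZ; apply IZR_le; lia. }
assert (hy1 : 1 <= y).
{ unfold y; rewrite <- abs_IZR; apply IZR_le; lia. }
pose proof (pos_INR n) as hn0.
pose proof (Cmod_ge_0 (bump_coef d l)) as hb.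
assert (h1 : (INR n * d) ^ q <= (y * d) ^ q).
{ apply pow_incr; split; [apply Rmult_le_pos; lra|apply Rmult_le_compat_r; lra]. }
assert (h2 : 1 <= d ^ 2 * (y * d) ^ q).
{ eapply Rle_trans; [exact Hn|]; apply Rmult_le_compat_l; [apply pow2_ge_0|exact h1]. }
assert (h3 : y * Cmod (bump_coef d l) <= A * d).
{ apply Rle_trans with (y * Cmod (bump_coef d l) * (d ^ 2 * (y * d) ^ q)).
  - rewrite <- (Rmult_1_r (y * _)) at 1; apply Rmult_le_compat_l; [apply Rmult_le_pos; lra|exact h2].
  - replace (y * Cmod (bump_coef d l) * (d ^ 2 * (y * d) ^ q))
      with (d * (d ^ S q * (y ^ S q * Cmod (bump_coef d l)))) by (rewrite Rpow_mult_distr; simpl; ring).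
    rewrite (Rmult_comm A); apply Rmult_le_compat_l; [lra|].
    rewrite Rmult_comm; apply Rle_div_r; [apply pow_lt; lra|exact HA]. }
assert (h4 : (y * Cmod (bump_coef d l)) ^ 2 <= (A * d) ^ 2).
{ apply pow_incr; split; [apply Rmult_le_pos; lra|exact h3]. }
assert (hl : IZR l ^ 2 = y ^ 2) by (unfold y; now rewrite pow2_abs).
rewrite hl.
apply -> Rle_div_r; [|pose proof (pow2_ge_0 y); lra].
rewrite !Rpow_mult_distr in h4.
assert (1 <= y ^ 2) by nra.
pose proof (pow2_ge_0 (Cmod (bump_coef d l))).
nra.
Qed.

(** Frequencies up to [n] contribute through [|b_l| <= 2 d], those beyond through [bump_coef_tail]
    and the boundedness of [a]. *)
Lemma smoothed_energy_tail A q :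
  (forall m, Cmod (a m) <= A) ->
  exists T, 0 <= T /\ forall d n M, 0 < d <= 1 -> 4 * d <= PI -> 1 <= d ^ 2 * (INR n * d) ^ q ->
    real_symmetric_sum (fun m => Cmod (bump_coef d m * a m) ^ 2) M <= d ^ 2 * (4 * energy n + T).
Proof.
intros HA; destruct (bump_coef_tail q) as [A1 [HA10 HA1]].
exists (5 * (A ^ 2 * A1)); pose proof (pow2_ge_0 A) as hA; split.
{ apply Rmult_le_pos; [lra|now apply Rmult_le_pos]. }
intros d n M Hd Hd' Hn.
pose proof (pow2_ge_0 d) as hd.
eapply Rle_trans.
- apply (real_symmetric_sum_le _ (fun l =>
    (4 * d ^ 2) * (if Z_le_gt_dec (Z.abs l) (Z.of_nat n) then Cmod (a l) ^ 2 else 0)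
    + A ^ 2 * A1 * d ^ 2 / (1 + IZR l ^ 2))).
  intros l _; rewrite Cmod_mult, Rpow_mult_distr.
  pose proof (pow2_ge_0 (IZR l)) as hl.
  assert (h0 : 0 <= A ^ 2 * A1 * d ^ 2 / (1 + IZR l ^ 2)).
  { apply Rle_mult_inv_pos; [apply Rmult_le_pos; [now apply Rmult_le_pos|exact hd]|lra]. }
  destruct (Z_le_gt_dec (Z.abs l) (Z.of_nat n)) as [h|h].
  + assert (h1 : Cmod (bump_coef d l) ^ 2 <= (2 * d) ^ 2).
    { apply pow_incr; split; [apply Cmod_ge_0|apply bump_coef_le; lra]. }
    assert (h2 : Cmod (bump_coef d l) ^ 2 * Cmod (a l) ^ 2 <= (2 * d) ^ 2 * Cmod (a l) ^ 2).
    { apply Rmult_le_compat_r; [apply pow2_ge_0|exact h1]. }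
    lra.
  + rewrite Rmult_0_r, Rplus_0_l.
    replace (A ^ 2 * A1 * d ^ 2 / (1 + IZR l ^ 2)) with (A1 * d ^ 2 / (1 + IZR l ^ 2) * A ^ 2)
      by (unfold Rdiv; ring).
    apply Rmult_le_compat; [apply pow2_ge_0|apply pow2_ge_0|apply (HA1 d n); auto; lia|].
    apply pow_incr; split; [apply Cmod_ge_0|apply HA].
- rewrite real_symmetric_sum_plus, real_symmetric_sum_scal.
  assert (h1 : real_symmetric_sum (fun l => if Z_le_gt_dec (Z.abs l) (Z.of_nat n) then Cmod (a l) ^ 2 else 0) M
    <= energy n).
  { apply (real_symmetric_sum_restrict (fun l => Cmod (a l) ^ 2)); intro; apply pow2_ge_0. }
  assert (h2 : real_symmetric_sum (fun l => A ^ 2 * A1 * d ^ 2 / (1 + IZR l ^ 2)) M <= 5 * (A ^ 2 * A1 * d ^ 2)).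
  { apply real_symmetric_sum_bound; [intro; lra|].
    apply Rmult_le_pos; [now apply Rmult_le_pos|exact hd]. }
  assert (h3 : 4 * d ^ 2 * real_symmetric_sum (fun l => if Z_le_gt_dec (Z.abs l) (Z.of_nat n) then Cmod (a l) ^ 2 else 0) M
    <= 4 * d ^ 2 * energy n) by (apply Rmult_le_compat_l; [lra|exact h1]).
  lra.
Qed.

(** Pairing [u] with [e^{i m0 x}] gives [2 PI b_{m0} a_{m0}], of order at least [d], while
    [duality_bound] with the weight [W] alone bounds it in terms of [d ^ 2 (E + 1)] and [m d]. *)
Lemma energy_lower A m0 q :
  (forall l, Cmod (a l) <= A) -> a m0 <> RtoC 0 ->
  exists C2, 0 < C2 /\ forall n d m,
    0 < d <= 1 -> 40 * d <= PI -> Rabs (IZR m0) * d <= / 4 -> 1 <= d ^ 2 * (INR n * d) ^ q ->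
    covered_by (distr_support c) d m -> 1 <= C2 * ((INR m + 1) * d * (energy n + 1)).
Proof.
intros HA Hm0.
pose proof two_PI_pos as hpi; pose proof (exp_pos 2) as he2; pose proof (exp_pos (-2)) as he.
apply Cmod_gt_0 in Hm0.
destruct (smoothed_energy_tail A q HA) as [T [HT0 HT]].
set (k := exp (-2) / 2 * Cmod (a m0)).
assert (hk : 0 < k) by (unfold k; apply Rmult_lt_0_compat; lra).
set (C0 := 4 * PI + PI * T + 40 * exp 2).
assert (hT : 0 <= PI * T) by (apply Rmult_le_pos; lra).
assert (hC0 : 0 < C0) by (unfold C0; lra).
exists (4 * (C0 / k) ^ 2); split.
{ apply Rmult_lt_0_compat; [lra|]; apply pow_lt, Rdiv_lt_0_compat; assumption. }
intros n d m Hd Hd' Hm0d Hn Hcov.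
destruct (covered_near d m (proj1 Hd) Hd' Hcov) as [W [HW [HWpos [HWint HW1]]]].
assert (hE : 0 <= energy n) by (apply real_symmetric_sum_nonneg; intro; apply pow2_ge_0).
pose proof (pos_INR m) as hm.
(* Makes the second AM-GM term equal to [k / 2]; the summand 1 keeps [t] positive when [m = 0]. *)
set (t := 2 * C0 * (INR m + 1) / k).
assert (Ht : 0 < t).
{ unfold t; apply Rdiv_lt_0_compat; [|exact hk]; apply Rmult_lt_0_compat; lra. }
destruct (duality_bound d (fun x => Cexpi (IZR m0 * x)) W 1) as [A' HA']; auto with cont.
{ lra. }
{ intro x; rewrite Cmod_Cexpi; lra. }
{ intros x y Hy Hxy; rewrite Cmod_Cexpi; specialize (HW1 x y Hy Hxy); lra. }
assert (hmain : k * d <= t * (PI * (d ^ 2 * (4 * energy n + T))) + 80 * exp 2 * (INR m * d) / (2 * t)).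
{ match goal with |- ?L <= ?U => assert (Hdiff : L - U <= 0); [|lra] end.
  apply (le_0_of_le_div _ (Rabs A')); intro M.
  set (M' := (M + Z.to_nat (Z.abs m0))%nat).
  specialize (HA' M' t Ht).
  unfold smoothed in HA'; rewrite cint_exp_poly_Cexpi in HA' by lia.
  assert (hlow : k * d <= Cmod (RtoC (2 * PI) * (bump_coef d m0 * a m0))).
  { rewrite !Cmod_mult, Cmod_R, Rabs_pos_eq by lra; unfold k.
    pose proof (bump_coef_Re_ge d m0 Hd Hm0d) as h1.
    assert (h2 : exp (-2) / 2 * d <= 2 * PI * Cmod (bump_coef d m0)).
    { pose proof (re_le_Cmod (bump_coef d m0)) as h3; pose proof (Rle_abs (Re (bump_coef d m0))) as h4.
      assert (h5 : 4 * PI * Re (bump_coef d m0) <= 4 * PI * Cmod (bump_coef d m0)).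
      { apply Rmult_le_compat_l; lra. }
      lra. }
    apply (Rmult_le_compat_r (Cmod (a m0))) in h2; [lra|apply Cmod_ge_0]. }
  assert (hmid : t * (PI * real_symmetric_sum (fun m => Cmod (bump_coef d m * a m) ^ 2) M')
    <= t * (PI * (d ^ 2 * (4 * energy n + T)))).
  { apply Rmult_le_compat_l; [lra|]; apply Rmult_le_compat_l; [lra|apply HT; auto; lra]. }
  assert (hW : RInt W 0 (2 * PI) / (2 * t) <= 80 * exp 2 * (INR m * d) / (2 * t)).
  { apply Rmult_le_compat_r; [apply Rlt_le, Rinv_0_lt_compat; lra|exact HWint]. }
  assert (hA' : A' / (INR M' + 1) <= Rabs A' / (INR M + 1)).
  { unfold M'; pose proof (pos_INR M); pose proof (pos_INR (Z.to_nat (Z.abs m0))).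
    rewrite plus_INR.
    eapply Rle_trans.
    - apply Rmult_le_compat_r; [apply Rlt_le, Rinv_0_lt_compat; lra|apply Rle_abs].
    - apply Rmult_le_compat_l; [apply Rabs_pos|apply Rinv_le_contravar; lra]. }
  lra. }
assert (h1 : k <= C0 * t * (d * (energy n + 1)) + C0 * (INR m + 1) / t).
{ apply Rmult_le_reg_l with d; [lra|].
  rewrite (Rmult_comm d k); eapply Rle_trans; [exact hmain|].
  rewrite (Rmult_plus_distr_l d); apply Rplus_le_compat.
  - replace (t * (PI * (d ^ 2 * (4 * energy n + T)))) with (t * d ^ 2 * (PI * (4 * energy n + T))) by ring.
    replace (d * (C0 * t * (d * (energy n + 1)))) with (t * d ^ 2 * (C0 * (energy n + 1))) by ring.
    apply Rmult_le_compat_l; [apply Rmult_le_pos; [lra|apply pow2_ge_0]|].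
    unfold C0; nra.
  - replace (80 * exp 2 * (INR m * d) / (2 * t)) with (d * (40 * exp 2 * INR m / t)) by (field; lra).
    apply Rmult_le_compat_l; [lra|].
    apply Rmult_le_compat_r; [apply Rlt_le, Rinv_0_lt_compat; lra|].
    apply Rmult_le_compat; unfold C0; lra. }
replace (C0 * (INR m + 1) / t) with (k / 2) in h1 by (unfold t; field; lra).
replace (C0 * t * (d * (energy n + 1))) with (2 * C0 ^ 2 / k * ((INR m + 1) * d * (energy n + 1))) in h1
  by (unfold t; field; lra).
set (X := (INR m + 1) * d * (energy n + 1)) in *.
assert (h2 : k / 2 <= 2 * C0 ^ 2 / k * X) by lra.
apply (Rmult_le_compat_r (2 / k)) in h2; [|apply Rlt_le, Rdiv_lt_0_compat; lra].
replace (k / 2 * (2 / k)) with 1 in h2 by (field; lra).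
eapply Rle_trans; [exact h2|]; apply Req_le; field; lra.
Qed.

End Energy.

(** * Dimension and conclusion *)

Lemma covered_by_some K d : 0 < d -> exists m, covered_by K d m.
Proof.
intros Hd; pose proof two_PI_pos as hpi.
destruct (nfloor_ex (2 * PI / d)) as [N [_ HN]]; [apply Rle_mult_inv_pos; lra|].
exists (S N), (fun i => INR i * d); intros x _.
destruct (period_representative x) as [k Hk].
destruct (nfloor_ex ((x + 2 * PI * IZR k) / d)) as [i [Hi1 Hi2]]; [apply Rle_mult_inv_pos; lra|].
exists i, k; split.
- apply INR_lt; rewrite S_INR.
  eapply Rle_lt_trans; [exact Hi1|]; eapply Rle_lt_trans; [|exact HN].
  apply Rmult_le_compat_r; [apply Rlt_le, Rinv_0_lt_compat; exact Hd|lra].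
- apply (Rmult_le_compat_r d) in Hi1; [|lra].
  apply (Rmult_lt_compat_r d) in Hi2; [|lra].
  replace ((x + 2 * PI * IZR k) / d * d) with (x + 2 * PI * IZR k) in * by (field; lra).
  lra.
Qed.

Lemma covering_number_attained K d :
  0 < d -> exists m, covered_by K d m /\ covering_number K d = INR m.
Proof.
intros Hd; destruct (covered_by_some K d Hd) as [m0 Hm0].
destruct (dec_inh_nat_subset_has_unique_least_element (covered_by K d)) as [m [[Hm Hmin] _]].
- intro; apply classic.
- now exists m0.
- exists m; split; [exact Hm|].
  unfold covering_number.
  rewrite (is_glb_Rbar_unique _ (Finite (INR m))); [reflexivity|].
  split.
  + intros r [m' [-> Hm']]; simpl; apply le_INR, Hmin, Hm'.
  + intros b Hb; apply Hb; now exists m.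
Qed.

(** As the dimension is an infimum of eventual upper bounds, one of them lies below [D]; its maximum
    with 0 still does because [0 < D]. The bound [exp (- y * ln d)] is [d ^ (- y)], and [d0 <= 1]
    makes [ln (1 / d)] positive. *)
Lemma covering_of_dim_lt K D :
  0 < D -> Rbar_lt (upper_Minkowski_dim K) (Finite D) ->
  exists y d0, 0 <= y < D /\ 0 < d0 /\ forall d, 0 < d < d0 ->
    exists m, covered_by K d m /\ INR m <= exp (- y * ln d).
Proof.
intros HD H.
assert (Hy : exists y, at_right 0 (fun d => ln (covering_number K d) / ln (1 / d) <= y) /\ y < D).
{ apply NNPP; intro Hno.
  apply (Rbar_lt_not_le _ _ H).
  unfold upper_Minkowski_dim, LimSup_right0.
  apply (Glb_Rbar_correct _); intros y Hy; simpl.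
  apply Rnot_lt_le; intro h; apply Hno; now exists y. }
destruct Hy as [y [[eps Heps] HyD]].
exists (Rmax 0 y), (Rmin eps 1).
pose proof (cond_pos eps) as he.
split; [|split].
- split; [apply Rmax_l|]; now apply Rmax_lub_lt.
- apply Rmin_pos; lra.
- intros d Hd.
  assert (Hd1 : d < eps /\ d < 1).
  { pose proof (Rmin_l eps 1); pose proof (Rmin_r eps 1); lra. }
  destruct (covering_number_attained K d (proj1 Hd)) as [m [Hm Em]].
  exists m; split; [exact Hm|].
  specialize (Heps d); rewrite Em in Heps.
  assert (h : ln (INR m) / ln (1 / d) <= y).
  { apply Heps; [|lra]; change (Rabs (d - 0) < eps); rewrite Rminus_0_r, Rabs_pos_eq; lra. }
  replace (1 / d) with (/ d) in h by (field; lra).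
  rewrite ln_Rinv in h by lra.
  assert (hl : ln d < 0) by (rewrite <- ln_1; apply ln_increasing; lra).
  apply Rle_div_l in h; [|lra].
  (* For [m = 0] the value [ln 0 = 0] carries no information, but the bound is trivial. *)
  destruct m as [|m]; [simpl; apply Rlt_le, exp_pos|].
  assert (hm : 0 < INR (S m)) by (apply lt_0_INR; lia).
  rewrite <- (exp_ln (INR (S m)) hm).
  assert (h' : ln (INR (S m)) <= - Rmax 0 y * ln d).
  { pose proof (Rmax_r 0 y); nra. }
  destruct (Rle_lt_or_eq_dec _ _ h') as [h''|h'']; [apply Rlt_le, exp_increasing, h''|rewrite h''; lra].
Qed.

(** The margin [(2 + y) (1 - y) - 2 y = 2 - 3 y - y ^ 2] is positive below its root
    [(sqrt 17 - 3) / 2]. The factor [q / (q + 2)] preserves the strict inequality once [q] times the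
    margin exceeds [4 y], and [y < 1]. *)
Lemma exponent_margin y : 0 <= y -> y < (sqrt 17 - 3) / 2 ->
  exists q : nat, (0 < q)%nat /\ 2 * y < INR q / (INR q + 2) * ((2 + y) * (1 - y)).
Proof.
intros Hy0 Hy.
assert (hs : sqrt 17 * sqrt 17 = 17) by (apply sqrt_sqrt; lra).
pose proof (sqrt_pos 17) as hs0.
assert (hmu : 0 < 2 - 3 * y - y ^ 2) by nra.
destruct (nfloor_ex (4 / (2 - 3 * y - y ^ 2))) as [q [_ Hq]].
{ apply Rle_mult_inv_pos; lra. }
exists (S q); split; [lia|]; rewrite S_INR.
pose proof (pos_INR q) as hq.
apply Rlt_div_l in Hq; [|exact hmu].
set (r := INR q + 1) in *.
replace (r / (r + 2) * ((2 + y) * (1 - y))) with (r * ((2 + y) * (1 - y)) / (r + 2)) by (field; unfold r; lra).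
apply -> Rlt_div_r; [|unfold r; lra].
assert (y < 1) by nra.
nra.
Qed.

Lemma bounded_of_vanishing c : vanishes_at_infinity c -> exists B, forall l, Cmod (c l) <= B.
Proof.
intros H; destruct (H (mkposreal 1 Rlt_0_1)) as [L HL]; simpl in HL.
set (N := Z.to_nat (Z.abs L)).
exists (1 + real_symmetric_sum (fun l => Cmod (c l)) N); intro l.
pose proof (real_symmetric_sum_nonneg (fun l => Cmod (c l)) N (fun l => Cmod_ge_0 (c l))).
destruct (Z_le_gt_dec (Z.abs l) (Z.of_nat N)) as [h|h].
- pose proof (real_symmetric_sum_ge_term (fun l => Cmod (c l)) l N (fun l => Cmod_ge_0 (c l)) h); lra.
- specialize (HL l ltac:(lia)); lra.
Qed.

Lemma bounded_of_convergent (u : nat -> C) z :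
  filterlim u eventually (locally z) -> exists A, forall k, Cmod (u k) <= A.
Proof.
intros H; destruct (proj1 (filterlim_C_eps u z) H 1 Rlt_0_1) as [N HN].
assert (HF : exists A, forall k, (k < N)%nat -> Cmod (u k) <= A).
{ clear HN; induction N as [|N [A HA]]; [exists 0; lia|].
  exists (Rmax A (Cmod (u N))); intros k Hk.
  destruct (Nat.eq_dec k N) as [->|h]; [apply Rmax_r|].
  eapply Rle_trans; [apply HA; lia|apply Rmax_l]. }
destruct HF as [A HA]; exists (Rmax A (1 + Cmod z)); intro k.
destruct (Nat.lt_ge_cases k N) as [h|h].
- eapply Rle_trans; [now apply HA|apply Rmax_l].
- eapply Rle_trans; [|apply Rmax_r].
  specialize (HN k h).
  replace (u k) with ((u k - z) + z)%C by ring.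
  eapply Rle_trans; [apply Cmod_triangle|lra].
Qed.

Lemma trig_partial_sum_periodic c N (k : Z) x :
  trig_partial_sum c N (x + 2 * PI * IZR k) = trig_partial_sum c N x.
Proof.
unfold trig_partial_sum; apply symmetric_sum_ext; intros l _; f_equal.
rewrite <- (Cexpi_shift_IZR (l * k) (IZR l * x)), mult_IZR; f_equal; ring.
Qed.

Lemma localization c B (n : nat -> nat) p0 :
  (forall l, Cmod (c l) <= B) ->
  (forall x, 0 <= x <= 2 * PI ->
     filterlim (fun k => trig_partial_sum c (n k) x) eventually (locally (RtoC 0))) ->
  distr_support c p0 ->
  exists chi m0 A0, test_function chi /\ localized_coef c chi m0 <> RtoC 0 /\
    forall k y, distr_support c y -> Cmod (exp_poly (localized_coef c chi) (n k) y) <= A0.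
Proof.
intros Hc Hlim Hp0.
destruct (pointwise_bounded_locally_bounded (fun k x => Cmod (trig_partial_sum c (n k) x))
  (distr_support c) p0) as [p [r [A [Hp [Hr HA]]]]].
- intro k; unfold trig_partial_sum; auto 10 with cont.
- intro x; destruct (period_representative x) as [j Hj].
  destruct (bounded_of_convergent _ _ (Hlim _ Hj)) as [A HA]; exists A; intro k.
  rewrite <- (trig_partial_sum_periodic c (n k) j x); apply HA.
- exact Hp0.
- destruct (exists_nonzero_localization c B p r Hc Hp Hr) as [d [x0 [m0 [Hd [Hdr Hm0]]]]].
  set (chi := fun x => RtoC (circle_bump d (x - x0))).
  assert (Hchi : test_function chi) by apply test_circle_bump.
  destruct (localized_partial_sum_close c B chi Hc Hchi) as [A1 HA1].
  (* [A1] is the error of the formal multiplication; [2 * PI] is the normalization of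
     [localized_coef]. *)
  exists chi, m0, (A1 + 2 * PI * Rabs A); split; [exact Hchi|split; [exact Hm0|]].
  intros k y Hy; pose proof two_PI_pos as hpi.
  specialize (HA1 (n k) y).
  assert (h : Cmod (chi y * trig_partial_sum c (n k) y) <= Rabs A).
  { unfold chi; rewrite Cmod_mult, Cmod_R.
    pose proof (circle_bump_range d (y - x0)) as hb; rewrite Rabs_pos_eq by lra.
    pose proof (Cmod_ge_0 (trig_partial_sum c (n k) y)); pose proof (Rabs_pos A).
    destruct (Rle_lt_dec d (Rabs (sin ((y - x0) / 2)))) as [h|h].
    - rewrite circle_bump_eq0 by lra; lra.
    - destruct (near_period_of_sin_half_le (y - x0) d) as [j Hj]; [lra|].
      assert (h1 : Cmod (trig_partial_sum c (n k) (y + 2 * PI * IZR j)) <= A).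
      { apply HA; [now apply distr_support_IZR|].
        replace (y + 2 * PI * IZR j - p) with ((y - x0 + 2 * PI * IZR j) + (x0 - p)) by ring.
        eapply Rle_lt_trans; [apply Rabs_triang|lra]. }
      rewrite trig_partial_sum_periodic in h1.
      pose proof (Rle_abs A); nra. }
  replace (exp_poly (localized_coef c chi) (n k) y) with
    ((exp_poly (localized_coef c chi) (n k) y - RtoC (2 * PI) * (chi y * trig_partial_sum c (n k) y))
     + RtoC (2 * PI) * (chi y * trig_partial_sum c (n k) y))%C by ring.
  eapply Rle_trans; [apply Cmod_triangle|].
  rewrite (Cmod_mult (RtoC (2 * PI))), Cmod_R, (Rabs_pos_eq (2 * PI)) by lra.
  apply Rplus_le_compat; [exact HA1|apply Rmult_le_compat_l; lra].
Qed.

(** * Energy bounds in logarithmic form and the contradiction *)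

Lemma ln_le_of_le x y : 0 < x -> x <= y -> ln x <= ln y.
Proof. intros Hx [H|H]; [apply Rlt_le, ln_increasing; assumption|rewrite H; lra]. Qed.

Lemma ln_pow_nat x k : 0 < x -> ln (x ^ k) = INR k * ln x.
Proof.
intros Hx; induction k as [|k IH]; [simpl; rewrite ln_1; ring|].
rewrite S_INR; simpl; rewrite ln_mult, IH by (auto; now apply pow_lt); ring.
Qed.

(** The scale [d = E / (2 C' n ^ 2)] turns the derivative term into [E ^ 2 / 2], which is absorbed
    on the left; [E ^ 2 <= 2 C' d ^ (- y)] remains, and [d] contains [E] again, whence the exponent
    [2 + y]. *)
Lemma energy_log_upper (K : R -> Prop) C1 A2 y d0 :
  0 < C1 -> 0 <= A2 -> 0 <= y -> 0 < d0 ->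
  (forall d, 0 < d < d0 -> exists m, covered_by K d m /\ INR m <= exp (- y * ln d)) ->
  exists C3 N, forall n E, (N <= n)%nat -> 0 < E -> E <= A2 * INR n ->
    (forall d m, 0 < d <= 1 -> 40 * d <= PI -> INR n * d <= / 4 -> covered_by K d m ->
       E ^ 2 <= C1 * (INR m + d * INR n ^ 2 * E)) ->
    (2 + y) * ln E <= 2 * y * ln (INR n) + C3.
Proof.
intros HC1 HA2 Hy Hd0 Hcov.
(* Enlarged by [2 * A2] so that [E <= A2 * n] implies [n d = E / (2 C' n) <= 1 / 4]. *)
set (C' := C1 + 2 * A2).
assert (HC' : 0 < C') by (unfold C'; lra).
destruct (nfloor_ex (/ d0)) as [N [_ HN]]; [apply Rlt_le, Rinv_0_lt_compat, Hd0|].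
exists ((1 + y) * ln (2 * C')), (N + 4)%nat; intros n E Hn HE HEA H.
pose proof PI_gt_3 as hpi.
assert (hn4 : 4 <= INR n) by (replace 4 with (INR 4) by (simpl; ring); apply le_INR; lia).
assert (hnN : / d0 < INR n).
{ eapply Rlt_le_trans; [exact HN|]; rewrite <- S_INR; apply le_INR; lia. }
set (d := E / (2 * C' * INR n ^ 2)).
assert (hn2 : 0 < 2 * C' * INR n ^ 2).
{ apply Rmult_lt_0_compat; [lra|apply pow_lt; lra]. }
assert (hd : 0 < d) by (unfold d; now apply Rdiv_lt_0_compat).
assert (hnd : INR n * d <= / 4).
{ unfold d; replace (INR n * (E / (2 * C' * INR n ^ 2))) with (E / (2 * C' * INR n)) by (field; lra).
  apply Rle_div_l; [apply Rmult_lt_0_compat; lra|].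
  unfold C'; nra. }
assert (hd4 : d <= / (4 * INR n)).
{ apply Rmult_le_reg_l with (INR n); [lra|].
  eapply Rle_trans; [exact hnd|]; apply Req_le; field; lra. }
assert (hd16 : d <= / 16) by (eapply Rle_trans; [exact hd4|apply Rinv_le_contravar; lra]).
assert (hdd0 : d < d0).
{ eapply Rle_lt_trans; [exact hd4|].
  assert (hi : 0 < / d0) by now apply Rinv_0_lt_compat.
  rewrite <- (Rinv_inv d0); apply Rinv_lt_contravar.
  - apply Rmult_lt_0_compat; lra.
  - lra. }
destruct (Hcov d (conj hd hdd0)) as [m [Hm Hmd]].
specialize (H d m ltac:(lra) ltac:(lra) hnd Hm).
pose proof (pos_INR m) as hm.
assert (h : E ^ 2 <= 2 * C' * exp (- y * ln d)).
{ assert (h1 : E ^ 2 <= C' * (INR m + d * INR n ^ 2 * E)).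
  { eapply Rle_trans; [exact H|]; apply Rmult_le_compat_r; [|unfold C'; lra].
    apply Rplus_le_le_0_compat; [exact hm|].
    apply Rmult_le_pos; [apply Rmult_le_pos; [lra|apply pow2_ge_0]|lra]. }
  replace (d * INR n ^ 2 * E) with (E ^ 2 / (2 * C')) in h1 by (unfold d; field; lra).
  rewrite Rmult_plus_distr_l in h1.
  replace (C' * (E ^ 2 / (2 * C'))) with (E ^ 2 / 2) in h1 by (field; lra).
  assert (C' * INR m <= C' * exp (- y * ln d)) by (apply Rmult_le_compat_l; lra).
  lra. }
apply ln_le_of_le in h; [|now apply pow_lt].
rewrite ln_pow_nat, ln_mult, ln_exp in h by (try apply exp_pos; lra).
assert (E1 : ln d = ln E - (ln (2 * C') + 2 * ln (INR n))).
{ unfold d; rewrite ln_div, ln_mult, ln_pow_nat by (try (apply pow_lt); lra).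
  simpl; ring. }
rewrite E1 in h; simpl in h; lra.
Qed.

(** The scale is [d = n ^ (- s)] with [s = q / (q + 2)], for which [d ^ 2 (n d) ^ q = 1]. The
    covering bound then gives [1 <= C3 d ^ (1 - y) E]; [e0 <= E] serves to replace [E + 1] by a
    multiple of [E]. *)
Lemma energy_log_lower (K : R -> Prop) C2 e0 y d0 (m0 : Z) q :
  0 < C2 -> 0 < e0 -> 0 <= y -> 0 < d0 -> (0 < q)%nat ->
  (forall d, 0 < d < d0 -> exists m, covered_by K d m /\ INR m <= exp (- y * ln d)) ->
  exists C4 L, forall n E, L <= ln (INR n) -> (1 <= n)%nat -> e0 <= E ->
    (forall d m, 0 < d <= 1 -> 40 * d <= PI -> Rabs (IZR m0) * d <= / 4 ->
       1 <= d ^ 2 * (INR n * d) ^ q -> covered_by K d m ->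
       1 <= C2 * ((INR m + 1) * d * (E + 1))) ->
    INR q / (INR q + 2) * (1 - y) * ln (INR n) <= ln E + C4.
Proof.
intros HC2 He0 Hy Hd0 Hq Hcov.
assert (hq : 1 <= INR q) by (replace 1 with (INR 1) by reflexivity; apply le_INR; lia).
set (s := INR q / (INR q + 2)).
assert (hs : 0 < s) by (unfold s; apply Rdiv_lt_0_compat; lra).
(* The three bounds secure [40 * d <= PI], [d < d0] and [|m0| d <= 1 / 4]; the threshold [L] forces
   [d <= eta]. *)
set (eta := Rmin (/ 16) (Rmin (d0 / 2) (/ (4 * (Rabs (IZR m0) + 1))))).
pose proof (Rabs_pos (IZR m0)) as hm0.
assert (heta : 0 < eta).
{ unfold eta; repeat apply Rmin_pos; try lra; apply Rinv_0_lt_compat; lra. }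
set (C3 := 2 * C2 * (1 + / e0)).
assert (hC3 : 0 < C3).
{ assert (hi : 0 < / e0) by now apply Rinv_0_lt_compat.
  unfold C3; apply Rmult_lt_0_compat; lra. }
exists (ln C3), (- ln eta / s); intros n E HL Hn HE H.
assert (hn : 1 <= INR n) by (replace 1 with (INR 1) by reflexivity; now apply le_INR).
set (d := exp (- s * ln (INR n))).
assert (hd : 0 < d) by apply exp_pos.
assert (hlnd : ln d = - s * ln (INR n)) by apply ln_exp.
assert (hdeta : d <= eta).
{ rewrite <- (exp_ln eta heta); unfold d.
  apply Rle_div_l in HL; [|exact hs].
  assert (h : - s * ln (INR n) <= ln eta) by lra.
  destruct h as [h|h]; [apply Rlt_le, exp_increasing, h|rewrite h; lra]. }
assert (h16 : d <= / 16) by (eapply Rle_trans; [exact hdeta|apply Rmin_l]).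
assert (hdd0 : d < d0).
{ apply Rle_lt_trans with (d0 / 2); [|lra].
  eapply Rle_trans; [exact hdeta|]; eapply Rle_trans; [apply Rmin_r|apply Rmin_l]. }
assert (hdm : Rabs (IZR m0) * d <= / 4).
{ assert (h : d <= / (4 * (Rabs (IZR m0) + 1))).
  { eapply Rle_trans; [exact hdeta|]; eapply Rle_trans; [apply Rmin_r|apply Rmin_r]. }
  apply Rle_trans with ((Rabs (IZR m0) + 1) * / (4 * (Rabs (IZR m0) + 1))).
  - apply Rmult_le_compat; lra.
  - apply Req_le; field; lra. }
pose proof PI_gt_3 as hpi.
destruct (Hcov d (conj hd hdd0)) as [m [Hm Hmd]].
assert (hcond : 1 <= d ^ 2 * (INR n * d) ^ q).
{ apply Req_le.
  assert (hnd : 0 < INR n * d) by (apply Rmult_lt_0_compat; lra).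
  assert (h1 : 0 < d ^ 2) by now apply pow_lt.
  assert (h2 : 0 < (INR n * d) ^ q) by now apply pow_lt.
  rewrite <- (exp_ln (d ^ 2 * (INR n * d) ^ q)) by now apply Rmult_lt_0_compat.
  rewrite ln_mult, !ln_pow_nat, ln_mult, hlnd by (auto; lra).
  rewrite <- exp_0; f_equal; unfold s; simpl; field; lra. }
specialize (H d m ltac:(lra) ltac:(lra) hdm hcond Hm).
set (P := exp (- y * ln d)) in *.
assert (hlnd0 : ln d <= 0).
{ rewrite <- ln_1; apply ln_le_of_le; lra. }
assert (hP : 1 <= P).
{ unfold P; rewrite <- exp_0.
  assert (h : 0 <= - y * ln d) by nra.
  destruct h as [h|h]; [apply Rlt_le, exp_increasing, h|rewrite <- h; lra]. }
assert (h : 1 <= C3 * (P * (d * E))).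
{ eapply Rle_trans; [exact H|].
  assert (hE1 : E + 1 <= (1 + / e0) * E).
  { assert (1 <= / e0 * E); [|lra].
    rewrite Rmult_comm; apply -> Rle_div_r; lra. }
  unfold C3; replace (2 * C2 * (1 + / e0) * (P * (d * E))) with (C2 * (2 * P * d * ((1 + / e0) * E))) by ring.
  apply Rmult_le_compat_l; [lra|].
  pose proof (pos_INR m).
  apply Rmult_le_compat; [apply Rmult_le_pos; lra|lra| |exact hE1].
  apply Rmult_le_compat_r; lra. }
apply ln_le_of_le in h; [|lra].
assert (hE : 0 < E) by lra.
assert (hP0 : 0 < P) by lra.
assert (hdE : 0 < d * E) by now apply Rmult_lt_0_compat.
assert (hPdE : 0 < P * (d * E)) by now apply Rmult_lt_0_compat.
rewrite ln_1, !ln_mult in h by assumption.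
unfold P in h; rewrite ln_exp, hlnd in h.
lra.
Qed.

Theorem theorem3 :
  forall (c : Z -> C) (n : nat -> nat),
    vanishes_at_infinity c ->
    (forall k : nat, (1 <= k)%nat -> (0 < n k)%nat) ->
    filterlim n eventually eventually ->
    (forall x : R, 0 <= x <= 2 * PI ->
       filterlim (fun k : nat => trig_partial_sum c (n k) x)
         eventually (locally (RtoC 0))) ->
    Rbar_lt (upper_Minkowski_dim (distr_support c))
            (Finite ((sqrt 17 - 3) / 2)) ->
    forall l : Z, c l = RtoC 0.
Proof.
intros c n Hvan _ Hn Hlim Hdim l.
apply NNPP; intro Hl.
destruct (bounded_of_vanishing c Hvan) as [B HB].
(* With an empty support the distribution would annihilate every character. *)
assert (HK : exists p0, distr_support c p0).
{ apply NNPP; intro h; apply Hl.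
  assert (E : pairing c (fun x => Cexpi (IZR (- l) * x)) = RtoC 0).
  { apply (pairing_eq0_off_support c B); [exact HB|apply test_Cexpi|].
    intros y _ Hy; apply h; now exists y. }
  rewrite pairing_Cexpi, Z.opp_involutive in E.
  apply NNPP; intro h'; refine (Cmult_neq_0 _ _ _ h' E).
  intro h0; apply RtoC_inj in h0; pose proof two_PI_pos; lra. }
destruct HK as [p0 Hp0].
destruct (localization c B n p0 HB Hlim Hp0) as [chi [m0 [A0 [Hchi [Hm0 HA0]]]]].
destruct (localized_coef_bounded c B chi HB Hchi) as [A HA].
assert (HD : 0 < (sqrt 17 - 3) / 2).
{ assert (hs : sqrt 17 * sqrt 17 = 17) by (apply sqrt_sqrt; lra).
  pose proof (sqrt_pos 17); nra. }
destruct (covering_of_dim_lt _ _ HD Hdim) as [y [d0 [[Hy0 HyD] [Hd0 Hcov]]]].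
destruct (exponent_margin y Hy0 HyD) as [q [Hq Hmargin]].
destruct (energy_upper c B chi HB Hchi A A0 HA) as [C1 [HC1 Hup]].
destruct (energy_lower c B chi HB Hchi A m0 q HA Hm0) as [C2 [HC2 Hlow]].
set (a := localized_coef c chi) in *.
set (energy := fun N => real_symmetric_sum (fun m => Cmod (a m) ^ 2) N).
set (e0 := Cmod (a m0) ^ 2).
assert (He0 : 0 < e0) by (apply pow_lt, Cmod_gt_0, Hm0).
pose proof (pow2_ge_0 A) as hA2.
destruct (energy_log_upper (distr_support c) C1 (3 * A ^ 2) y d0 HC1 ltac:(lra) Hy0 Hd0 Hcov)
  as [C3 [N HN]].
destruct (energy_log_lower (distr_support c) C2 e0 y d0 m0 q HC2 He0 Hy0 Hd0 Hq Hcov)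
  as [C4 [L HL]].
set (s := INR q / (INR q + 2)) in *.
set (mu := s * ((2 + y) * (1 - y)) - 2 * y).
assert (Hmu : 0 < mu) by (unfold mu; lra).
(* The two logarithmic bounds combine to [mu * ln n <= (2 + y) * C4 + C3]; the summand 1 makes this
   fail once [ln n >= L']. *)
set (L' := Rmax L (((2 + y) * C4 + C3 + 1) / mu)).
destruct (nfloor_ex (exp L')) as [N2 [_ HN2]]; [apply Rlt_le, exp_pos|].
(* Beyond [|m0|] the energy includes the term of [m0], hence is at least [e0]. *)
set (N0 := (N + N2 + Z.to_nat (Z.abs m0) + 1)%nat).
destruct (Hn (fun j => (N0 <= j)%nat)) as [k Hk]; [now exists N0|].
specialize (Hk k (Nat.le_refl k)).
set (nk := n k) in *.
assert (hnk1 : (1 <= nk)%nat) by (unfold N0 in Hk; lia).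
assert (hnk : 1 <= INR nk) by (replace 1 with (INR 1) by reflexivity; now apply le_INR).
assert (hlog : L' <= ln (INR nk)).
{ rewrite <- (ln_exp L'); apply ln_le_of_le; [apply exp_pos|].
  apply Rlt_le; eapply Rlt_le_trans; [exact HN2|]; rewrite <- S_INR; apply le_INR; unfold N0 in Hk; lia. }
assert (hE0 : e0 <= energy nk).
{ apply (real_symmetric_sum_ge_term (fun m => Cmod (a m) ^ 2)); [intro; apply pow2_ge_0|unfold N0 in Hk; lia]. }
assert (hEA : energy nk <= 3 * A ^ 2 * INR nk).
{ eapply Rle_trans; [apply (coef_energy_bound c chi A nk HA)|]; nra. }
assert (h1 : (2 + y) * ln (energy nk) <= 2 * y * ln (INR nk) + C3).
{ apply HN; [unfold N0 in Hk; lia|lra|exact hEA|].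
  intros d m Hd Hd' Hnd Hm; apply Hup; auto; [intros; now apply HA0|fold (energy nk); lra]. }
assert (h2 : s * (1 - y) * ln (INR nk) <= ln (energy nk) + C4).
{ apply HL; [eapply Rle_trans; [apply Rmax_l|exact hlog]|exact hnk1|exact hE0|].
  intros d m Hd Hd' Hdm Hcond Hm; now apply Hlow. }
assert (h3 : ((2 + y) * C4 + C3 + 1) / mu <= ln (INR nk)).
{ eapply Rle_trans; [apply Rmax_r|exact hlog]. }
apply Rle_div_l in h3; [|exact Hmu].
apply (Rmult_le_compat_l (2 + y)) in h2; [|lra].
unfold mu in h3; lra.
Qed.
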